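(* Let $f\in S^4V$ be a nonzero plane quartic and let $\mathrm{WM}_f$ be its White--Miller quartic in $\mathbb{P}^5=\{\text{conics } q\in S^2V^\vee\}$. (i) If the singular locus of $\mathrm{WM}_f$ has dimension zero and degree $28$, then $f$ is not a Lüroth quartic. (ii) Suppose that the singular locus of $\mathrm{WM}_f$ contains a point corresponding to a smooth conic $Q$, and let $g\in S^4V$ be defined by $$g(x)=\det\begin{pmatrix}L_f&\overline{Q^2}\\ (x)^4&0\end{pmatrix}.$$ Then $g$ is apolar to $Q$. If moreover $\det L_g\neq0$, then, up to a nonzero scalar, $$f(x)=\det\begin{pmatrix}L_g&\overline{Q^2}\\ (x)^4&0\end{pmatrix},$$ $f$ coincides with $S(g)$ up to a nonzero scalar, and $f$ is a Lüroth quartic.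
   Context: Let $V$ be the 3-dimensional complex vector space with basis $x_0,x_1,x_2$, and let $y_0,y_1,y_2$ be the dual basis of $V^\vee$. Elements of $S^4V$ are quartic forms in $x_0,x_1,x_2$ (plane quartics, up to scalar); elements of $S^dV^\vee$ are forms in $y_0,y_1,y_2$, acting on $S^4V$ by contraction, i.e. with $y_i$ acting as $\partial/\partial x_i$. A quartic $g\in S^4V$ is apolar to a conic $Q\in S^2V^\vee$ if the contraction $Q\cdot g\in S^2V$ is zero. The cubic invariant $A(f,g,h)$ is the symmetric trilinear form on $S^4V$ determined by $A(a^4,b^4,c^4)=\det(a,b,c)^4$ for linear forms $a=\sum a_ix_i$, $b=\sum b_ix_i$, $c=\sum c_ix_i$ ($3\times3$ determinant of coefficients). For $f=\sum_{i+j+k=4}\frac{4!}{i!j!k!}f_{ijk}x_0^ix_1^jx_2^k$ let $\overline f=(f_{ijk})\in\mathbb{C}^{15}$ (column vector). For $g\in S^4V$ let $L_g$ be the symmetric $15\times15$ matrix with $A(f,g,h)=\overline f^{\,t}L_g\overline h$ for all $f,h$. For $H\in S^4V^\vee$ let $\overline H\in\mathbb{C}^{15}$ be the column vector of coefficients of the monomials $y_0^iy_1^jy_2^k$ in $H$ (same ordering). $(x)^4$ is the row vector with entries $\frac{4!}{i!j!k!}x_0^ix_1^jx_2^k$, $i+j+k=4$ (same ordering). The White--Miller quartic is the quartic form on $S^2V^\vee$ $$\mathrm{WM}_f(q)=\det\begin{pmatrix}L_f&\overline{q^2}\\ \overline{q^2}^{\,t}&0\end{pmatrix},\qquad q\in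 S^2V^\vee.$$ Its singular locus is the closed subscheme of $\mathbb{P}^5$ defined by its six partial derivatives. The Scorza map $S$ sends a quartic $g\in S^4V$ to the quartic form $S(g)$ whose value at a point $a=(a_0,a_1,a_2)$ is $\mathrm{Ar}(P_a(g))$, where $P_a(g)=\sum a_i\,\partial g/\partial x_i$ is the polar cubic and $\mathrm{Ar}$ is the Aronhold invariant (the degree 4 invariant of ternary cubics). A Lüroth quartic is a plane quartic containing the ten vertices (pairwise intersection points of the five lines) of a complete pentalateral, or a limit of such quartics (i.e. an element of the Zariski closure in $\mathbb{P}^{14}$ of the set of such quartics). *)

(* Defs.v *)
From mathcomp Require Export all_boot all_order all_algebra all_fingroup.
From mathcomp Require Export classical_sets reals complex mpoly.
From mathcomp Require Import ring.

Set Implicit Arguments.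
Unset Strict Implicit.
Unset Printing Implicit Defensive.

Import Order.TTheory GRing.Theory Num.Theory.
Local Open Scope ring_scope.

(* Forms in x_0, x_1, x_2 (elements of S^d V) and forms in y_0, y_1, y_2
   (elements of S^d V^dual) are both elements of {mpoly K[3]}. *)

Definition mon3 (i j k : nat) : 'X_{1..3} := [multinom [tuple i; j; k]].

Definition mon2 : 6.-tuple 'X_{1..3} :=
  [tuple mon3 2 0 0; mon3 1 1 0; mon3 1 0 1; mon3 0 2 0; mon3 0 1 1; mon3 0 0 2].

Definition mon4 : 15.-tuple 'X_{1..3} :=
  [tuple mon3 4 0 0; mon3 3 1 0; mon3 3 0 1; mon3 2 2 0; mon3 2 1 1;
         mon3 2 0 2; mon3 1 3 0; mon3 1 2 1; mon3 1 1 2; mon3 1 0 3;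
         mon3 0 4 0; mon3 0 3 1; mon3 0 2 2; mon3 0 1 3; mon3 0 0 4].

(* 4! / (i! j! k!) for m = (i, j, k) of degree 4 *)
Definition multi4 (m : 'X_{1..3}) : nat := (4`! %/ \prod_(i < 3) (m i)`!)%N.

(* f_ijk, where f = \sum 4!/(i!j!k!) f_ijk x_0^i x_1^j x_2^k *)
Definition ncoef (K : fieldType) (f : {mpoly K[3]}) (m : 'X_{1..3}) : K :=
  f@_m / (multi4 m)%:R.

Definition fbar (K : fieldType) (f : {mpoly K[3]}) : 'cV[K]_15 :=
  \col_i ncoef f (tnth mon4 i).

Definition Hbar (K : comNzRingType) (H : {mpoly K[3]}) : 'cV[K]_15 :=
  \col_i H@_(tnth mon4 i).

Definition quartic_basis (K : comNzRingType) (i : 'I_15) : {mpoly K[3]} :=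
  (multi4 (tnth mon4 i))%:R *: 'X_[tnth mon4 i].

Definition xpow4 (K : comNzRingType) : 'rV[{mpoly K[3]}]_15 :=
  \row_i quartic_basis K i.

(* The entries of the symmetric tensor of a quartic: those of a^4 are the
   products a_i a_j a_k a_l. *)
Definition tensor4 (K : fieldType) (f : {mpoly K[3]}) (i j k l : 'I_3) : K :=
  ncoef f (U_(i) + U_(j) + U_(k) + U_(l))%MM.

(* Trilinear extension of the expansion of the product of four determinants
   det(a,b,c)^4 over 'S_3 ^ 4; see cubicA_pow4. *)
Definition cubicA (K : fieldType) (f g h : {mpoly K[3]}) : K :=
  \sum_(s : 'S_3) \sum_(t : 'S_3) \sum_(u : 'S_3) \sum_(v : 'S_3)
    (-1) ^+ s * (-1) ^+ t * (-1) ^+ u * (-1) ^+ v *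
    (tensor4 f (s 0) (t 0) (u 0) (v 0) *
     tensor4 g (s 1) (t 1) (u 1) (v 1) *
     tensor4 h (s 2) (t 2) (u 2) (v 2)).

(* See cubicA_Lmat. *)
Definition Lmat (K : fieldType) (g : {mpoly K[3]}) : 'M[K]_15 :=
  \matrix_(i, j) cubicA (quartic_basis K i) g (quartic_basis K j).

Definition bordered (K : comNzRingType) n (L : 'M[K]_n) (u : 'cV[K]_n)
    (v : 'rV[K]_n) : 'M[K]_(n + 1) :=
  block_mx L u v 0.

(* The coordinates on S^2 V^dual, that is the variables of WM f, are the
   coefficients on the monomials listed in mon2. *)
Definition generic_conic (K : comNzRingType) : {mpoly {mpoly K[6]}[3]} :=
  \sum_(i < 6) 'X_i *: 'X_[tnth mon2 i].

Definition conic_coord (K : comNzRingType) (q : {mpoly K[3]}) (i : 'I_6) : K :=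
  q@_(tnth mon2 i).

Definition WM (K : fieldType) (f : {mpoly K[3]}) : {mpoly K[6]} :=
  let v := Hbar (generic_conic K ^+ 2) in
  \det (bordered (map_mx (@mpolyC 6 K) (Lmat f)) v v^T).

Definition border_quartic (K : fieldType) (f Q : {mpoly K[3]}) : {mpoly K[3]} :=
  \det (bordered (map_mx (@mpolyC 3 K) (Lmat f))
                 (map_mx (@mpolyC 3 K) (Hbar (Q ^+ 2))) (xpow4 K)).

Definition contraction (K : comNzRingType) (Q g : {mpoly K[3]}) : {mpoly K[3]} :=
  \sum_(m <- msupp Q) Q@_m *: g^`M[m].

Definition apolar (K : comNzRingType) (g Q : {mpoly K[3]}) : Prop :=
  contraction Q g = 0.

Definition smooth_conic (K : comNzRingType) (Q : {mpoly K[3]}) : Prop :=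
  Q \is 2.-homog /\
  forall p : 'I_3 -> K, (exists i, p i != 0) ->
    Q.@[p] = 0 -> exists i, Q^`M(i).@[p] != 0.

Definition polar (K : comNzRingType) (a : 'I_3 -> K) (g : {mpoly K[3]}) :
    {mpoly K[3]} :=
  \sum_(i < 3) a i *: g^`M(i).

(* The classical symbolic expression (abc)(abd)(acd)(bcd), where the symbol
   a_i a_j a_k (and likewise for b, c, d) stands for the third derivative
   d_i d_j d_k F of the cubic F.  The derivatives are 6 times the entries of
   the symmetric tensor of F, which only rescales the invariant. *)
Definition tensor3 (K : comNzRingType) (F : {mpoly K[3]}) (i j k : 'I_3) : K :=
  (F^`M(i)^`M(j)^`M(k))@_0%MM.

Definition aronhold (K : comNzRingType) (F : {mpoly K[3]}) : K :=
  \sum_(s : 'S_3) \sum_(t : 'S_3) \sum_(u : 'S_3) \sum_(v : 'S_3)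
    (-1) ^+ s * (-1) ^+ t * (-1) ^+ u * (-1) ^+ v *
    (tensor3 F (s 0) (t 0) (u 0) * tensor3 F (s 1) (t 1) (v 0) *
     tensor3 F (s 2) (u 1) (v 1) * tensor3 F (t 2) (u 2) (v 2)).

(* The invariant of the polar at the generic point; see scorzaE. *)
Definition scorza (K : comNzRingType) (g : {mpoly K[3]}) : {mpoly K[3]} :=
  aronhold (polar (fun i => 'X_i) (map_mpoly (@mpolyC 3 K) g)).

Definition linform (K : comNzRingType) (a : 'rV[K]_3) : {mpoly K[3]} :=
  \sum_(i < 3) a 0 i *: 'X_i.

Definition det3 (K : comNzRingType) (a b c : 'rV[K]_3) : K :=
  \det (\matrix_(i < 3) tnth [tuple a; b; c] i).

(* No three of the five lines are concurrent, so that the ten vertices are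
   distinct. *)
Definition complete_pentalateral (K : comNzRingType) (l : 'I_5 -> 'rV[K]_3) :
    Prop :=
  forall i j k, i != j -> i != k -> j != k -> det3 (l i) (l j) (l k) != 0.

Definition pentalateral_quartic (K : comNzRingType) (f : {mpoly K[3]}) : Prop :=
  [/\ f \is 4.-homog, f != 0 &
      exists2 l : 'I_5 -> 'rV[K]_3, complete_pentalateral l &
        forall i j p, i != j ->
          (linform (l i)).@[p] = 0 -> (linform (l j)).@[p] = 0 -> f.@[p] = 0].

(* Membership in the Zariski closure in P^14, whose homogeneous coordinates are
   the entries of fbar. *)
Definition luroth (K : fieldType) (f : {mpoly K[3]}) : Prop :=
  [/\ f \is 4.-homog, f != 0 &
      forall d (F : {mpoly K[15]}), F \is d.-homog ->
        (forall h, pentalateral_quartic h -> F.@[fun i => fbar h i 0] = 0) ->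
        F.@[fun i => fbar f i 0] = 0].

(* Subsets of P^(n-1) are given by their sets of homogeneous coordinates. *)
Definition zero_locus (K : comNzRingType) n (S : set {mpoly K[n]}) :
    set ('I_n -> K) :=
  [set x | (exists i, x i != 0) /\ forall p, S p -> p.@[x] = 0]%classic.

Definition proj_closed (K : comNzRingType) n (Z : set ('I_n -> K)) : Prop :=
  exists2 S : set {mpoly K[n]},
    (forall p, S p -> exists d, p \is d.-homog) & Z = zero_locus S.

Definition proj_irreducible (K : comNzRingType) n (Z : set ('I_n -> K)) :
    Prop :=
  (Z !=set0)%classic /\
  forall A B, proj_closed A -> proj_closed B ->
    (Z `<=` A `|` B -> Z `<=` A \/ Z `<=` B)%classic.

Definition irreducible_chain (K : comNzRingType) n (Z : set ('I_n -> K))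
    (r : nat) : Prop :=
  exists c : nat -> set ('I_n -> K),
    (forall i, (i <= r)%N ->
       [/\ proj_closed (c i), proj_irreducible (c i) & (c i `<=` Z)%classic]) /\
    (forall i, (i < r)%N -> (c i `<` c i.+1)%classic).

Definition krull_dim (K : comNzRingType) n (Z : set ('I_n -> K)) (r : nat) :
    Prop :=
  irreducible_chain Z r /\ ~ irreducible_chain Z r.+1.

(* The degree d piece of the ideal generated by homogeneous polynomials: the
   function indhomog sends to 0 the products that are not of degree d. *)
Definition ideal_piece (K : fieldType) n (gens : seq {mpoly K[n.+1]})
    (d : nat) : {vspace dhomog n.+1 K d} :=
  (\sum_(p <- gens) \sum_(m : 'X_{1..n.+1 < d.+1}) <[indhomog d ('X_[m] * p)]>)%VS.

Definition hilbert_function (K : fieldType) n (gens : seq {mpoly K[n.+1]})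
    (d : nat) : nat :=
  (\dim (fullv : {vspace dhomog n.+1 K d}) - \dim (ideal_piece gens d))%N.

(* The closed subscheme of P^n defined by the homogeneous polynomials gens has
   dimension r and degree e: its Hilbert polynomial has leading term
   e / r! * z^r. *)
Definition scheme_dim_degree (K : fieldType) n (gens : seq {mpoly K[n.+1]})
    (r e : nat) : Prop :=
  krull_dim (zero_locus [set` gens]%classic) r /\
  exists P : {poly rat},
    [/\ exists d0, forall d, (d0 <= d)%N ->
          P.[d%:R] = (hilbert_function gens d)%:R,
        size P = r.+1 & lead_coef P = e%:R / (r`!)%:R].

Definition partials (K : comNzRingType) n (F : {mpoly K[n]}) :
    seq {mpoly K[n]} :=
  [seq F^`M(i) | i <- enum 'I_n].

Lemma multi4K (m : 'X_{1..3}) :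
  mdeg m = 4%N -> (multi4 m * \prod_(i < 3) (m i)`!)%N = 4`!.
Proof.
rewrite /multi4 mdegE !big_ord_recl !big_ord0 /=.
move: (m _) (m _) (m _) => a b c.
by case: a => [|[|[|[|[|a]]]]]; case: b => [|[|[|[|[|b]]]]];
   case: c => [|[|[|[|[|c]]]]].
Qed.

Lemma mderiv_linform (K : comNzRingType) (a : 'rV[K]_3) i :
  (linform a)^`M(i) = (a 0 i)%:MP.
Proof.
have U0 : (U_(i) - U_(i))%MM = 0%MM by apply/mnmP => x; rewrite mnmBE mnm0E subnn.
rewrite /linform raddf_sum (bigD1 i) //= big1 => [|j ji].
  by rewrite linearZ /= mderivX mnm1E eqxx U0 mpolyX0 scale1r addr0 -mul_mpolyC mulr1.
by rewrite linearZ /= mderivX mnm1E (negbTE ji) scale0r scaler0.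
Qed.

Lemma mderiv_linform_exp (K : comNzRingType) (a : 'rV[K]_3) i n :
  (linform a ^+ n.+1)^`M(i) = (n.+1%:R * a 0 i) *: linform a ^+ n.
Proof.
elim: n => [|n IH]; first by rewrite expr1 mderiv_linform expr0 mul1r -mul_mpolyC mulr1.
rewrite exprS mderivM IH mderiv_linform -scalerAr -exprS mul_mpolyC -scalerDl.
by congr (_ *: _); rewrite -[n.+2]addn1 natrD mulrDl mul1r addrC.
Qed.

Lemma tensor4_pow4 (K : numFieldType) (a : 'rV[K]_3) i j k l :
  tensor4 (linform a ^+ 4) i j k l = a 0 i * a 0 j * a 0 k * a 0 l.
Proof.
rewrite /tensor4 /ncoef; set m := (_ + _)%MM.
have mE : mdeg m = 4%N by rewrite /m !mdegD !mdeg1.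
have := multi4K mE; set M := multi4 m => /(congr1 (fun n : nat => n%:R : K)).
rewrite natrM => HM.
have M0 : M%:R != 0 :> K.
  by apply/eqP => M0; move: HM; rewrite M0 mul0r => /esym/eqP; rewrite pnatr_eq0.
have := mcoeff_mderivm m (linform a ^+ 4) 0%MM.
under eq_bigr => x _ do rewrite addm0 ffactnn.
rewrite addm0 /m !mderivmDm !mderivmU1m -/m.
rewrite mderiv_linform_exp mderivZ mderiv_linform_exp !mderivZ.
rewrite mderiv_linform_exp !mderivZ mderiv_linform_exp.
rewrite !mcoeffZ expr0 mcoeff1 eqxx mulr1 => E.
have P0 : (\prod_(i0 < 3) (m i0)`!)%N%:R != 0 :> K.
  by apply/eqP => P0; move: HM; rewrite P0 mulr0 => /esym/eqP; rewrite pnatr_eq0.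
apply: (mulIf M0); rewrite divfK //; apply: (mulIf P0); rewrite mulr_natr -E -mulrA HM.
rewrite -[4`!]/(4 * (3 * (2 * 1)))%N !natrM.
by ring.
Qed.

Lemma prod_det4 (K : comNzRingType)
    (s t u v a1 a2 a3 a4 b1 b2 b3 b4 c1 c2 c3 c4 : K) :
  s * t * u * v * (a1 * a2 * a3 * a4 * (b1 * b2 * b3 * b4) * (c1 * c2 * c3 * c4))
  = s * (a1 * b1 * c1) * (t * (a2 * b2 * c2) *
      (u * (a3 * b3 * c3) * (v * (a4 * b4 * c4)))).
Proof. by ring. Qed.

Lemma prod_scalel (K : comNzRingType) (x c a b d : K) :
  x * (c * a * b * d) = c * (x * (a * b * d)).
Proof. by ring. Qed.

Lemma prod_scaler (K : comNzRingType) (x c a b d : K) :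
  x * (a * b * (c * d)) = x * (a * b * d) * c.
Proof. by ring. Qed.

Lemma cubicA_pow4 (K : numFieldType) (a b c : 'rV[K]_3) :
  cubicA (linform a ^+ 4) (linform b ^+ 4) (linform c ^+ 4) = det3 a b c ^+ 4.
Proof.
pose e (s : 'S_3) := (-1) ^+ s * (a 0 (s 0) * b 0 (s 1) * c 0 (s 2)).
have -> : det3 a b c = \sum_(s : 'S_3) e s.
  apply: eq_bigr => s _; rewrite !big_ord_recl big_ord0 mulr1 !mxE /e !mulrA.
  by congr (_ * a 0 (s _) * b 0 (s _) * c 0 (s _)); apply: val_inj.
have X4 (x : K) : x ^+ 4 = x * (x * (x * x)) by ring.
rewrite /cubicA X4 mulr_suml; apply: eq_bigr => s _.
rewrite mulr_suml mulr_sumr; apply: eq_bigr => t _.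
rewrite mulr_suml !mulr_sumr; apply: eq_bigr => u _.
rewrite !mulr_sumr; apply: eq_bigr => v _.
by rewrite !tensor4_pow4; apply: prod_det4.
Qed.

Lemma mon4P (m : 'X_{1..3}) : mdeg m = 4%N -> m \in mon4.
Proof.
move=> mE; have -> : m = mon3 (m 0) (m 1) (m 2).
  apply/mnmP => i; rewrite [RHS](mnm_nth 0).
  by case: i => [[|[|[|//]]] ?] /=; congr (m _); apply: val_inj.
move: mE; rewrite mdegE !big_ord_recl !big_ord0 /=.
have -> : lift ord0 ord0 = 1 :> 'I_3 by apply: val_inj.
have -> : lift ord0 (lift ord0 ord0) = 2 :> 'I_3 by apply: val_inj.
move: (m _) (m _) (m _) => x y z.
by case: x => [|[|[|[|[|x]]]]]; case: y => [|[|[|[|[|y]]]]];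
   case: z => [|[|[|[|[|z]]]]] // _; rewrite !inE eqxx ?orbT.
Qed.

Lemma ncoef_fbar (K : numFieldType) (f : {mpoly K[3]}) m : mdeg m = 4%N ->
  ncoef f m = \sum_p fbar f p 0 * ncoef (quartic_basis K p) m.
Proof.
move=> mE; have [p ->] := tnthP _ _ (mon4P mE).
have M0 q : (multi4 (tnth mon4 q))%:R != 0 :> K.
  have : all (fun m => multi4 m != 0%N) mon4.
    by rewrite /= /multi4 !big_ord_recl !big_ord0.
  by move/all_tnthP => /(_ q); rewrite pnatr_eq0.
have U : uniq mon4 by [].
rewrite (bigD1 p) //= big1 => [|q qp].
  by rewrite addr0 mxE /ncoef mcoeffZ mcoeffX eqxx mulr1 divff ?mulr1.
rewrite /ncoef mcoeffZ mcoeffX (inj_eq (@tuple_uniqP _ _ _ U)) (negbTE qp).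
by rewrite mulr0 mul0r mulr0.
Qed.

Lemma cubicA_Lmat (K : numFieldType) (f g h : {mpoly K[3]}) :
  ((fbar f)^T *m Lmat g *m fbar h) 0 0 = cubicA f g h.
Proof.
have T q i j k l : tensor4 q i j k l
    = \sum_p fbar q p 0 * tensor4 (quartic_basis K p) i j k l.
  by apply: ncoef_fbar; rewrite !mdegD !mdeg1.
have X (F : 'S_3 -> 'S_3 -> 'S_3 -> 'S_3 -> 'I_15 -> K) :
    \sum_s \sum_t \sum_u \sum_v \sum_p F s t u v p =
    \sum_p \sum_s \sum_t \sum_u \sum_v F s t u v p.
  rewrite [RHS]exchange_big; apply: eq_bigr => s _.
  rewrite [RHS]exchange_big; apply: eq_bigr => t _.
  rewrite [RHS]exchange_big; apply: eq_bigr => u _.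
  by rewrite [RHS]exchange_big.
have Hl q : cubicA f g q = \sum_p fbar f p 0 * cubicA (quartic_basis K p) g q.
  rewrite /cubicA; under [RHS]eq_bigr => p _.
    rewrite mulr_sumr; under eq_bigr => s _.
      rewrite mulr_sumr; under eq_bigr => t _.
        rewrite mulr_sumr; under eq_bigr => u _ do rewrite mulr_sumr.
        over.
      over.
    over.
  rewrite -X; do 4 (apply: eq_bigr => ? _).
  rewrite (T f) !mulr_suml mulr_sumr; apply: eq_bigr => p _; exact: prod_scalel.
have Hr q : cubicA q g h = \sum_p cubicA q g (quartic_basis K p) * fbar h p 0.
  rewrite /cubicA; under [RHS]eq_bigr => p _.
    rewrite mulr_suml; under eq_bigr => s _.
      rewrite mulr_suml; under eq_bigr => t _.
        rewrite mulr_suml; under eq_bigr => u _ do rewrite mulr_suml.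
        over.
      over.
    over.
  rewrite -X; do 4 (apply: eq_bigr => ? _).
  rewrite (T h) !mulr_sumr; apply: eq_bigr => p _; exact: prod_scaler.
rewrite Hr mxE; apply: eq_bigr => q _; rewrite Hl mxE; congr (_ * _).
by apply: eq_bigr => p _; rewrite !mxE.
Qed.


Lemma scorzaE (K : comNzRingType) (g : {mpoly K[3]}) (a : 'I_3 -> K) :
  (scorza g).@[a] = aronhold (polar a g).
Proof.
have T i j k :
    (tensor3 (polar (fun i => 'X_i) (map_mpoly (@mpolyC 3 K) g)) i j k).@[a]
    = tensor3 (polar a g) i j k.
  have C m : ((polar (fun i => 'X_i) (map_mpoly (@mpolyC 3 K) g))@_m).@[a]
      = (polar a g)@_m.
    rewrite /polar !raddf_sum /=; apply: eq_bigr => l _.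
    rewrite !mcoeffZ mevalM mevalXU; congr (_ * _).
    by rewrite !mcoeff_deriv mcoeff_map_mpoly /= mevalMn mevalC.
  by rewrite /tensor3 !mcoeff_deriv !mevalMn C.
have S (s : 'S_3) : ((-1) ^+ s : {mpoly K[3]}).@[a] = (-1) ^+ s.
  by rewrite rmorph_sign.
have P (x1 x2 x3 x4 x5 x6 x7 x8 : {mpoly K[3]}) :
    (x1 * x2 * x3 * x4 * (x5 * x6 * x7 * x8)).@[a] =
    x1.@[a] * x2.@[a] * x3.@[a] * x4.@[a] *
    (x5.@[a] * x6.@[a] * x7.@[a] * x8.@[a]).
  by rewrite !mevalM.
rewrite /scorza /aronhold raddf_sum /=; apply: eq_bigr => s _.
rewrite raddf_sum /=; apply: eq_bigr => t _.
rewrite raddf_sum /=; apply: eq_bigr => u _.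
rewrite raddf_sum /=; apply: eq_bigr => v _.
by rewrite P; congr (_ * _ * _ * _ * (_ * _ * _ * _)); first [exact: S | exact: T].
Qed.

Lemma mon2P (m : 'X_{1..3}) : mdeg m = 2%N -> m \in mon2.
Proof.
move=> mE; have -> : m = mon3 (m 0) (m 1) (m 2).
  apply/mnmP => i; rewrite [RHS](mnm_nth 0).
  by case: i => [[|[|[|//]]] ?] /=; congr (m _); apply: val_inj.
move: mE; rewrite mdegE !big_ord_recl !big_ord0 /=.
have -> : lift ord0 ord0 = 1 :> 'I_3 by apply: val_inj.
have -> : lift ord0 (lift ord0 ord0) = 2 :> 'I_3 by apply: val_inj.
move: (m _) (m _) (m _) => x y z.
by case: x => [|[|[|x]]]; case: y => [|[|[|y]]];
   case: z => [|[|[|z]]] // _; rewrite !inE eqxx ?orbT.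
Qed.

Lemma WM_eval (K : fieldType) (f q : {mpoly K[3]}) : q \is 2.-homog ->
  (WM f).@[conic_coord q] =
  \det (bordered (Lmat f) (Hbar (q ^+ 2)) (Hbar (q ^+ 2))^T).
Proof.
move=> q2; pose ev := @map_mpoly 3 _ _ (meval (conic_coord q)).
have evq : ev (generic_conic K) = q.
  have U : uniq mon2 by [].
  apply/mpolyP => m; rewrite mcoeff_map_mpoly /= /generic_conic !raddf_sum /=.
  under eq_bigr => i _.
    rewrite mcoeffZ mcoeffX mevalM mevalXU /conic_coord.
    have -> : ((tnth mon2 i == m)%:R : {mpoly K[6]}).@[conic_coord q]
        = (tnth mon2 i == m)%:R.
      by case: (_ == m); rewrite ?meval1 ?meval0.
    over.
  have [/eqP/mon2P/tnthP[p ->]|m2] := boolP (mdeg m == 2%N).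
    rewrite (bigD1 p) //= big1 => [|i ip].
      by rewrite addr0 eqxx mulr1.
    by rewrite (inj_eq (@tuple_uniqP _ _ _ U)) (negbTE ip) mulr0.
  rewrite (dhomog_nemf_coeff q2 m2) big1 // => i _.
  case: eqP => [E|]; last by rewrite mulr0.
  suff : all (fun m => mdeg m == 2%N) mon2.
    by move/all_tnthP => /(_ i); rewrite E (negbTE m2).
  by rewrite /= !mdegE !big_ord_recl !big_ord0.
have evH i : ((generic_conic K ^+ 2)@_(tnth mon4 i)).@[conic_coord q]
    = (q ^+ 2)@_(tnth mon4 i).
  by rewrite -[in RHS]evq -rmorphXn /= mcoeff_map_mpoly.
rewrite /WM -det_map_mx map_block_mx; congr (\det (block_mx _ _ _ _)).
- by apply/matrixP => i j; rewrite 2!mxE /= mevalC.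
- by apply/matrixP => i j; rewrite !mxE /= evH.
- by apply/matrixP => i j; rewrite !mxE /= evH.
- by apply/matrixP => i j; rewrite !mxE /= meval0.
Qed.

(* Main.v *)
(* Write L for the matrix of the quartic and v_b for the vector of values at b of
   the monomials of degree 4, so that v_c^t L v_b is the value of the quartic at
   the vector product of b and c.  A conic q is a singular point of the
   White-Miller quartic as soon as L w = C q^2, with C <> 0, for some w
   orthogonal to all multiples of q.

   (ii) If q = Q is smooth, parametrize it by nu(t).  A quartic g apolar to Q is
   determined by nine moments, that is by a binary form of degree 8 whose Hankel
   determinant does not vanish when det L_g <> 0; it is then a combination of
   the fourth powers of five tangent lines l_i, S(g) is a combination of the
   products of four of the l_i, and L_g S(g) is a multiple of Q^2.  Applying the
   symmetry L_f g = L_g f one finds f = S(g) up to a factor.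

   (i) A pentalateral quartic h has 29 singular points on WM_h when it is
   general: the 28 conics given by the pairs of points of contact of the
   bitangents (for a bitangent l touching h at x and y, L v_l is a multiple of
   the square of the conic xy), and the smooth conic of (ii).  If the Hilbert
   function of the singular scheme at f is at most 28 in some degree d >= 28,
   then some determinant F, polynomial in the quartic, does not vanish at f,
   while F vanishes at every quartic for which 29 distinct singular points are
   known.  If f is Lueroth, F(h) <> 0 for some pentalateral quartic h.  Join h
   to the quartic x^4 + y^4 + z^4 + 7 (x^2 y^2 + y^2 z^2 + z^2 x^2), all of
   whose bitangents are explicit, by a segment in the space of parameters.  The
   29 points lift to power series along the segment, so F vanishes to infinite
   order at its origin, hence also at h. *)

Require Import Defs.
From mathcomp Require Import ring zify separable boolp.

Set Implicit Arguments.
Unset Strict Implicit.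
Unset Printing Implicit Defensive.

Import Order.TTheory GRing.Theory Num.Theory.
Local Open Scope ring_scope.

(** * Polarization of quartics *)

(** Part (i) never determines the singular scheme of WM_f: the number 28 enters only as a constant
    Hilbert polynomial, so it is enough that the Hilbert function exceeds 28 in every degree d >=
    28. Let G be the Macaulay matrix of the partials. If its corank at f is at most 28, constant
    matrices U, Z1, Z2, with Z1 Z2 of rank at most 28, make U G + Z1 Z2 invertible at f; its
    determinant is F. At 29 singular points imposing independent conditions, the columns E of values
    of the monomials satisfy G E = 0, so (U G + Z1 Z2) E = Z1 Z2 E has rank at most 28 and F
    vanishes. The obstacle is that 29 such points are not at hand for a general pentalateral
    quartic. But these quartics are parametrized by an affine space (a conic, five parameters, five
    weights), so genericity can be tested at a single one. The one chosen has octahedral symmetry: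
    its 28 conics have coordinates in Z[sqrt(-2)], and the distinctness of the 29 points becomes a
    computation with integers. No power series is constructed: approximations modulo s^k, for each
    k, suffice. *)

Section Pol4.
Variable A : comNzRingType.
Implicit Types (u : 'cV[A]_15) (p q r s a b c : 'rV[A]_3).

Definition ver4 a : 'cV[A]_15 := \col_p mmap1 (a 0) (tnth mon4 p).

Definition idx4 (i j k l : 'I_3) : 'I_15 :=
  inord (index (U_(i) + U_(j) + U_(k) + U_(l))%MM mon4).

Lemma tnth_idx4 i j k l :
  tnth mon4 (idx4 i j k l) = (U_(i) + U_(j) + U_(k) + U_(l))%MM.
Proof.
have h : (U_(i) + U_(j) + U_(k) + U_(l))%MM \in mon4.
  by apply: mon4P; rewrite !mdegD !mdeg1.
by rewrite (tnth_nth 0%MM) /idx4 inordK ?nth_index // -[15%N]/(size mon4) index_mem.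
Qed.

Lemma mmap1M (h : 'I_3 -> A) m1 m2 : mmap1 h (m1 + m2) = mmap1 h m1 * mmap1 h m2.
Proof. by apply: commr_mmap1_M => i x; apply: mulrC. Qed.

Lemma ver4_idx4 a i j k l : ver4 a (idx4 i j k l) 0 = a 0 i * a 0 j * a 0 k * a 0 l.
Proof. by rewrite mxE tnth_idx4 !mmap1M !mmap1U. Qed.

(** The polar form of a quartic. Since [fbar] divides by the multinomial coefficients, its entries
    are those of the symmetric tensor, and [pol4 u p p p p] is the value of the quartic at p
    ([meval_quartic_of]). *)
Definition pol4 u p q r s : A :=
  \sum_i \sum_j \sum_k \sum_l u (idx4 i j k l) 0 * (p 0 i * q 0 j * r 0 k * s 0 l).

Definition dot3 a b : A := \sum_i a 0 i * b 0 i.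

Lemma idx4C12 i j k l : idx4 i j k l = idx4 j i k l.
Proof. by rewrite /idx4 (addmC U_(i)%MM U_(j)%MM). Qed.
Lemma idx4C23 i j k l : idx4 i j k l = idx4 i k j l.
Proof. by rewrite /idx4 -(addmA U_(i)%MM) (addmC U_(j)%MM) addmA. Qed.
Lemma idx4C34 i j k l : idx4 i j k l = idx4 i j l k.
Proof. by rewrite /idx4 -addmA (addmC U_(k)%MM) addmA. Qed.

Lemma pol4C12 u p q r s : pol4 u p q r s = pol4 u q p r s.
Proof.
rewrite /pol4 exchange_big; do 4 (apply: eq_bigr => ? _).
by rewrite idx4C12; ring.
Qed.
Lemma pol4C23 u p q r s : pol4 u p q r s = pol4 u p r q s.
Proof.
rewrite /pol4; apply: eq_bigr => i _; rewrite exchange_big; do 3 (apply: eq_bigr => ? _).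
by rewrite idx4C23; ring.
Qed.
Lemma pol4C34 u p q r s : pol4 u p q r s = pol4 u p q s r.
Proof.
rewrite /pol4; apply: eq_bigr => i _; apply: eq_bigr => j _.
rewrite exchange_big; do 2 (apply: eq_bigr => ? _).
by rewrite idx4C34; ring.
Qed.

Lemma pol4_lin1 u (x y : A) p p' q r s :
  pol4 u (x *: p + y *: p') q r s = x * pol4 u p q r s + y * pol4 u p' q r s.
Proof.
rewrite /pol4 !mulr_sumr -big_split; apply: eq_bigr => i _.
rewrite !mulr_sumr -big_split; apply: eq_bigr => j _.
rewrite !mulr_sumr -big_split; apply: eq_bigr => k _.
rewrite !mulr_sumr -big_split; apply: eq_bigr => l _.
by rewrite !mxE /=; ring.
Qed.
Lemma pol4_lin2 u (x y : A) p q q' r s :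
  pol4 u p (x *: q + y *: q') r s = x * pol4 u p q r s + y * pol4 u p q' r s.
Proof. by rewrite pol4C12 pol4_lin1 pol4C12 (pol4C12 _ q'). Qed.
Lemma pol4_lin3 u (x y : A) p q r r' s :
  pol4 u p q (x *: r + y *: r') s = x * pol4 u p q r s + y * pol4 u p q r' s.
Proof. by rewrite pol4C23 pol4_lin2 pol4C23 (pol4C23 _ _ r'). Qed.
Lemma pol4_lin4 u (x y : A) p q r s s' :
  pol4 u p q r (x *: s + y *: s') = x * pol4 u p q r s + y * pol4 u p q r s'.
Proof. by rewrite pol4C34 pol4_lin3 pol4C34 (pol4C34 _ _ _ s'). Qed.

Lemma pol4_linu (x y : A) u u' p q r s :
  pol4 (x *: u + y *: u') p q r s = x * pol4 u p q r s + y * pol4 u' p q r s.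
Proof.
rewrite /pol4 !mulr_sumr -big_split; apply: eq_bigr => i _.
rewrite !mulr_sumr -big_split; apply: eq_bigr => j _.
rewrite !mulr_sumr -big_split; apply: eq_bigr => k _.
rewrite !mulr_sumr -big_split; apply: eq_bigr => l _.
by rewrite !mxE /=; ring.
Qed.

Lemma pol4_sumu (I : finType) (c : I -> A) (u : I -> 'cV[A]_15) p q r s :
  pol4 (\sum_i c i *: u i) p q r s = \sum_i c i * pol4 (u i) p q r s.
Proof.
have hZ x v : pol4 (x *: v) p q r s = x * pol4 v p q r s.
  by rewrite -[x *: v]addr0 -[0 in LHS](scale0r 0) pol4_linu mul0r addr0.
have hD v v' : pol4 (v + v') p q r s = pol4 v p q r s + pol4 v' p q r s.
  by rewrite -[v in LHS]scale1r -[v' in LHS]scale1r pol4_linu !mul1r.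
have h0 : pol4 0 p q r s = 0 by rewrite -(scale0r 0) hZ mul0r.
by rewrite (big_morph (fun u => pol4 u p q r s) hD h0); apply: eq_bigr.
Qed.

Lemma pol4_ver4 a p q r s :
  pol4 (ver4 a) p q r s = dot3 a p * dot3 a q * dot3 a r * dot3 a s.
Proof.
rewrite /pol4 /dot3 -!mulrA mulr_suml; apply: eq_bigr => i _.
rewrite mulr_suml mulr_sumr; apply: eq_bigr => j _.
rewrite mulr_suml !mulr_sumr; apply: eq_bigr => k _.
rewrite !mulr_sumr; apply: eq_bigr => l _.
by rewrite ver4_idx4; ring.
Qed.

Definition vec3 (x y z : A) : 'rV[A]_3 := \row_i [tuple x; y; z]`_i.

Definition cross b c : 'rV[A]_3 :=
  vec3 (b 0 1 * c 0 2 - b 0 2 * c 0 1) (b 0 2 * c 0 0 - b 0 0 * c 0 2)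
       (b 0 0 * c 0 1 - b 0 1 * c 0 0).

Lemma sum3E (F : 'I_3 -> A) : \sum_i F i = F 0 + F 1 + F 2.
Proof.
rewrite !big_ord_recl big_ord0 addr0 addrA.
by congr (_ + F _ + F _); apply: val_inj.
Qed.

Lemma vec3E x y z : (vec3 x y z 0 0 = x) * (vec3 x y z 0 1 = y) * (vec3 x y z 0 2 = z).
Proof. by rewrite /vec3 !mxE. Qed.

Lemma vec3P a b : a 0 0 = b 0 0 -> a 0 1 = b 0 1 -> a 0 2 = b 0 2 -> a = b.
Proof.
move=> h0 h1 h2; apply/rowP => i.
by case: i => [[|[|[|//]]] hi];
   [move: h0 | move: h1 | move: h2]; congr (a 0 _ = b 0 _); apply: val_inj.
Qed.

Lemma dot3E a b : dot3 a b = a 0 0 * b 0 0 + a 0 1 * b 0 1 + a 0 2 * b 0 2.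
Proof. exact: sum3E. Qed.

Lemma dot3C a b : dot3 a b = dot3 b a.
Proof. by rewrite !dot3E; ring. Qed.

Lemma det33E (M : 'M[A]_3) : \det M =
  M 0 0 * (M 1 1 * M 2 2 - M 1 2 * M 2 1) + M 0 1 * (M 1 2 * M 2 0 - M 1 0 * M 2 2)
  + M 0 2 * (M 1 0 * M 2 1 - M 1 1 * M 2 0).
Proof.
have [f ->] : exists f : nat -> nat -> A, M = \matrix_(i, j) f i j.
  exists (fun m n => M (inord m) (inord n)).
  by apply/matrixP => i j; rewrite mxE !inord_val.
rewrite (expand_det_row _ 0) !big_ord_recl big_ord0 /cofactor.
rewrite ![\det _](expand_det_row _ 0) !big_ord_recl !big_ord0 /cofactor !det_mx11 !mxE /=.
rewrite /bump /= !expr0 !expr1 ?addn0 ?add0n.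
rewrite -[(1 %% 3)%N]/1%N -[((1 + 1) %% 3)%N]/2%N -[(1 + 1)%N]/2%N.
by ring.
Qed.

Lemma det3E a b c : det3 a b c = dot3 a (cross b c).
Proof.
rewrite /det3 det33E dot3E !vec3E !mxE /=.
rewrite !(tnth_nth 0) /=; ring.
Qed.
End Pol4.

Lemma poly_horner0 (K : numFieldType) (p : {poly K}) : (forall t, p.[t] = 0) -> p = 0.
Proof.
move=> p0; apply/eqP/negPn/negP => pn0.
have := @max_poly_roots _ p [seq i%:R | i <- iota 0 (size p)] pn0.
rewrite size_map size_iota ltnn => h.
have h1 : all (root p) [seq i%:R | i <- iota 0 (size p)].
  by apply/allP => x _; rewrite /root p0.
have h2 : uniq [seq i%:R : K | i <- iota 0 (size p)].
  rewrite map_inj_uniq ?iota_uniq // => i j /eqP.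
  by rewrite eqr_nat => /eqP.
by have := h h1 h2.
Qed.

Lemma mnm_split n k (m : 'X_{1..n}) : mdeg m = k.+1 ->
  exists i m', m = (U_(i) + m')%MM /\ mdeg m' = k.
Proof.
move=> mE; have [i mi] : exists i, m i != 0%N.
  apply/existsP; apply: contraTT isT => /existsPn h; rewrite -[_ true]/false.
  by move: mE; rewrite mdegE big1 // => i _; have := h i; rewrite negbK => /eqP.
have le : (U_(i) <= m)%MM by rewrite lep1mP.
exists i, (m - U_(i))%MM; rewrite addmC submK //; split=> //.
by move: mE; rewrite -[in mdeg m](submK le) mdegD mdeg1 addn1 => -[].
Qed.

(** With normalized coefficients on the left and plain ones on the right, this is the apolarity
    pairing of S^4 V with its dual; pairing [ver4 b] with H evaluates H at b. *)
Definition pair15 (A : comNzRingType) (w H : 'cV[A]_15) : A := \sum_p w p 0 * H p 0.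

Section Pair.
Variable A : comNzRingType.
Implicit Types w H : 'cV[A]_15.
Lemma pair15C w H : pair15 w H = pair15 H w.
Proof. by apply: eq_bigr => p _; rewrite mulrC. Qed.
Lemma pair15E w H : pair15 w H = (w^T *m H) 0 0.
Proof. by rewrite mxE; apply: eq_bigr => p _; rewrite mxE. Qed.
Lemma pair15_mul w (L : 'M[A]_15) H : pair15 w (L *m H) = pair15 (L^T *m w) H.
Proof. by rewrite !pair15E trmx_mul trmxK mulmxA. Qed.
Lemma pair15Zr w c H : pair15 w (c *: H) = c * pair15 w H.
Proof. by rewrite !pair15E -scalemxAr mxE. Qed.
Lemma pair15Zl w c H : pair15 (c *: w) H = c * pair15 w H.
Proof. by rewrite pair15C pair15Zr pair15C. Qed.
Lemma pair15Dr w H H' : pair15 w (H + H') = pair15 w H + pair15 w H'.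
Proof. by rewrite !pair15E mulmxDr mxE. Qed.
Lemma pair15Br w H H' : pair15 w (H - H') = pair15 w H - pair15 w H'.
Proof. by rewrite !pair15E mulmxBr !mxE. Qed.
Lemma pair15_sumr w (I : finType) (c : I -> A) (H : I -> 'cV[A]_15) :
  pair15 w (\sum_i c i *: H i) = \sum_i c i * pair15 w (H i).
Proof.
rewrite pair15E mulmx_sumr summxE; apply: eq_bigr => i _.
by rewrite -pair15E pair15Zr.
Qed.
Lemma pair15_suml w (I : finType) (c : I -> A) (H : I -> 'cV[A]_15) :
  pair15 (\sum_i c i *: H i) w = \sum_i c i * pair15 (H i) w.
Proof. by rewrite pair15C pair15_sumr; under eq_bigr do rewrite pair15C. Qed.
Lemma col_delta w : w = \sum_p w p 0 *: delta_mx p 0.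
Proof.
apply/matrixP => p j; rewrite ord1 summxE (bigD1 p) //= big1 => [|q qp].
  by rewrite !mxE eqxx mulr1 addr0.
by rewrite !mxE eq_sym (negbTE qp) mulr0.
Qed.
End Pair.

(** * The cubic invariant and its matrices *)

Section Cubic.
Variable K : numFieldType.
Implicit Types (u v w : 'cV[K]_15) (a b c : 'rV[K]_3).

(** On the curve (1, t, t^5) the fifteen monomials of degree 4 become distinct powers of t, so
    fourth powers of linear forms span. Linear identities between quartics can therefore be checked
    on fourth powers. *)
Lemma ver4_ext (w : 'cV[K]_15) : (forall a, pair15 (ver4 a) w = 0) -> w = 0.
Proof.
move=> h; pose e (m : 'X_{1..3}) := (m 1%R + 5 * m 2%R)%N.
pose P : {poly K} := \sum_p w p 0 *: 'X^(e (tnth mon4 p)).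
have P0 : P = 0.
  apply: poly_horner0 => t; rewrite -(h (vec3 1 t (t ^+ 5))) /P /pair15 horner_sum.
  apply: eq_bigr => p _; rewrite hornerZ hornerXn mulrC mxE; congr (_ * _).
  rewrite /mmap1 !big_ord_recl big_ord0 mulr1 !mxE /= expr1n mul1r exprD exprM.
  by congr (_ ^+ _ * _ ^+ _); congr (tnth mon4 p _); apply: val_inj.
have U : uniq [seq e m | m <- mon4].
  by [].
apply/matrixP => p j; rewrite ord1 mxE.
have := congr1 (fun q : {poly K} => q`_(e (tnth mon4 p))) P0.
rewrite coef0 /P coef_sum (bigD1 p) //= big1 ?addr0 => [|q qp].
  by rewrite coefZ coefXn eqxx mulr1.
rewrite coefZ coefXn.
have -> : (e (tnth mon4 p) == e (tnth mon4 q)) = (p == q).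
  have s15 : size [seq e m | m <- mon4] = 15 by [].
  rewrite !(tnth_nth 0%MM) -!(nth_map 0%MM 0%N e) //.
  by rewrite nth_uniq // ?s15.
by rewrite eq_sym (negbTE qp) mulr0.
Qed.

Lemma ver4_eq w w' : (forall a, pair15 (ver4 a) w = pair15 (ver4 a) w') -> w = w'.
Proof.
move=> h; apply/eqP; rewrite -subr_eq0; apply/eqP/ver4_ext => a.
by rewrite pair15Br h subrr.
Qed.

Lemma fbar_pow4 a : fbar (linform a ^+ 4) = ver4 a.
Proof.
apply/matrixP => p j; rewrite ord1 !mxE.
have : mdeg (tnth mon4 p) = 4%N.
  have : all (fun m => mdeg m == 4%N) mon4.
    by rewrite /= !mdegE !big_ord_recl !big_ord0.
  by move/all_tnthP => /(_ p)/eqP.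
move=> /mnm_split[i1 [m1 [-> ]]] /mnm_split[i2 [m2 [-> ]]].
move=> /mnm_split[i3 [m3 [-> ]]] /mnm_split[i4 [m4 [-> ]]] /eqP.
 rewrite mdeg_eq0 => /eqP->; rewrite addm0 !addmA -/(tensor4 _ _ _ _ _) tensor4_pow4.
by rewrite !mmap1M !mmap1U.
Qed.

Definition tri (i p j : 'I_15) : K :=
  cubicA (quartic_basis K i) (quartic_basis K p) (quartic_basis K j).

(** The structure constants [tri] stay in K and are transported by [iota], so that the matrix also
    makes sense for quartics whose coordinates are polynomials, where [Lmat], which divides, does
    not. *)
Definition Lvec (A : comNzRingType) (iota : K -> A) (u : 'cV[A]_15) : 'M[A]_15 :=
  \matrix_(i, j) \sum_p u p 0 * iota (tri i p j).

Lemma prod_scalem (x c a b d : K) : x * (a * (c * b) * d) = c * (x * (a * b * d)).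
Proof. by ring. Qed.

Lemma LmatE (f : {mpoly K[3]}) : Lmat f = Lvec id (fbar f).
Proof.
apply/matrixP => i0 j0; rewrite !mxE.
have T q i j k l : tensor4 q i j k l
    = \sum_p fbar q p 0 * tensor4 (quartic_basis K p) i j k l.
  by apply: ncoef_fbar; rewrite !mdegD !mdeg1.
have X (F : 'S_3 -> 'S_3 -> 'S_3 -> 'S_3 -> 'I_15 -> K) :
    \sum_s \sum_t \sum_u \sum_v \sum_p F s t u v p =
    \sum_p \sum_s \sum_t \sum_u \sum_v F s t u v p.
  rewrite [RHS]exchange_big; apply: eq_bigr => s _.
  rewrite [RHS]exchange_big; apply: eq_bigr => t _.
  rewrite [RHS]exchange_big; apply: eq_bigr => u _.
  by rewrite [RHS]exchange_big.
rewrite /tri /cubicA; under [RHS]eq_bigr => p _.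
  rewrite mulr_sumr; under eq_bigr => s _.
    rewrite mulr_sumr; under eq_bigr => t _.
      rewrite mulr_sumr; under eq_bigr => u _ do rewrite mulr_sumr.
      over.
    over.
  over.
rewrite -X; do 4 (apply: eq_bigr => ? _).
rewrite (T f) mulr_sumr mulr_suml mulr_sumr; apply: eq_bigr => p _; exact: prod_scalem.
Qed.

Definition Lk := Lvec (@id K).

Definition trif u v w : K := pair15 u (Lk v *m w).

Lemma trif_cubicA (f g h : {mpoly K[3]}) : trif (fbar f) (fbar g) (fbar h) = cubicA f g h.
Proof. by rewrite -cubicA_Lmat LmatE /trif pair15E mulmxA. Qed.

Lemma trifE u v w : trif u v w = \sum_i \sum_p \sum_j u i 0 * v p 0 * w j 0 * tri i p j.
Proof.
apply: eq_bigr => i _; rewrite mxE mulr_sumr exchange_big; apply: eq_bigr => j _.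
by rewrite mxE mulr_suml mulr_sumr; apply: eq_bigr => p _; rewrite /=; ring.
Qed.

Lemma trif_ver4 a b c : trif (ver4 a) (ver4 b) (ver4 c) = det3 a b c ^+ 4.
Proof. by rewrite -!fbar_pow4 trif_cubicA cubicA_pow4. Qed.

(** [ver4_ext] applied in each of the three slots. It reduces the symmetry of [tri] to that of
    det(a,b,c)^4, an even power of a determinant. *)
Lemma tri_ext (phi : 'I_15 -> 'I_15 -> 'I_15 -> K) :
  (forall a b c, \sum_i \sum_p \sum_j ver4 a i 0 * ver4 b p 0 * ver4 c j 0 * phi i p j = 0) ->
  forall i p j, phi i p j = 0.
Proof.
move=> h i p j.
have h1 b c : \col_i \sum_p \sum_j ver4 b p 0 * ver4 c j 0 * phi i p j = 0.
  apply: ver4_ext => a; rewrite -[RHS](h a b c); apply: eq_bigr => i' _.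
  rewrite [X in _ * X]mxE mulr_sumr; apply: eq_bigr => p' _.
  by rewrite mulr_sumr; apply: eq_bigr => j' _; ring.
have h2 c : \col_p \sum_j ver4 c j 0 * phi i p j = 0.
  apply: ver4_ext => b; have /matrixP/(_ i 0) E := h1 b c.
  rewrite [LHS]mxE [RHS]mxE in E; rewrite -[RHS]E; apply: eq_bigr => p' _.
  by rewrite [X in _ * X]mxE mulr_sumr; apply: eq_bigr => j' _; ring.
have /matrixP/(_ j 0) : \col_j phi i p j = 0.
  apply: ver4_ext => c; have /matrixP/(_ p 0) E := h2 c.
  rewrite [LHS]mxE [RHS]mxE in E; rewrite -[RHS]E; apply: eq_bigr => p' _.
  by rewrite [X in _ * X]mxE.
by rewrite !mxE.
Qed.

Lemma sum3C13 (F : 'I_15 -> 'I_15 -> 'I_15 -> K) :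
  \sum_i \sum_p \sum_j F i p j = \sum_i \sum_p \sum_j F j p i.
Proof.
rewrite exchange_big [RHS]exchange_big; apply: eq_bigr => p _.
by rewrite exchange_big.
Qed.

Lemma triC13 i p j : tri i p j = tri j p i.
Proof.
apply/eqP; rewrite -subr_eq0; apply/eqP; move: i p j.
apply: (tri_ext (phi := fun i p j => tri i p j - tri j p i)) => a b c.
transitivity (trif (ver4 a) (ver4 b) (ver4 c) - trif (ver4 c) (ver4 b) (ver4 a)); last first.
  by rewrite !trif_ver4 !det3E !dot3E /cross !vec3E; ring.
rewrite !trifE [X in _ = _ - X]sum3C13 -sumrB; apply: eq_bigr => i _.
rewrite -sumrB; apply: eq_bigr => p _; rewrite -sumrB; apply: eq_bigr => j _.
by ring.
Qed.

Lemma triC12 i p j : tri i p j = tri p i j.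
Proof.
apply/eqP; rewrite -subr_eq0; apply/eqP; move: i p j.
apply: (tri_ext (phi := fun i p j => tri i p j - tri p i j)) => a b c.
transitivity (trif (ver4 a) (ver4 b) (ver4 c) - trif (ver4 b) (ver4 a) (ver4 c)); last first.
  by rewrite !trif_ver4 !det3E !dot3E /cross !vec3E; ring.
rewrite !trifE [X in _ = _ - X]exchange_big -sumrB; apply: eq_bigr => i _.
rewrite -sumrB; apply: eq_bigr => p _; rewrite -sumrB; apply: eq_bigr => j _.
by ring.
Qed.

Lemma pol4_delta u p q r s : pol4 u p q r s =
  pair15 u (\col_m pol4 (delta_mx m 0) p q r s).
Proof.
rewrite {1}[u]col_delta pol4_sumu; apply: eq_bigr => m _.
by rewrite mxE.
Qed.

(** By symmetry of the cubic invariant [u] can be moved to the first slot. Both sides are then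
    linear in [u], and for the fourth power of a both equal det(a,b,c)^4. *)
Lemma Lk_mul_ver4 u b c (x := cross b c) :
  pair15 (ver4 b) (Lk u *m ver4 c) = pol4 u x x x x.
Proof.
rewrite pol4_delta.
have -> : pair15 (ver4 b) (Lk u *m ver4 c) = pair15 u (Lk (ver4 b) *m ver4 c).
  rewrite -!/(trif _ _ _) !trifE exchange_big; apply: eq_bigr => i _.
  apply: eq_bigr => p _; apply: eq_bigr => j _.
  by rewrite triC12; ring.
congr pair15; apply: ver4_eq => a; rewrite -pol4_delta pol4_ver4.
by rewrite -/(trif _ _ _) trif_ver4 det3E -/x; ring.
Qed.
End Cubic.

Section Lvec.
Variables (K : numFieldType) (A : comNzRingType) (iota : K -> A).
Implicit Types u w : 'cV[A]_15.

Lemma Lvec_sym u : (Lvec iota u)^T = Lvec iota u.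
Proof.
by apply/matrixP => i j; rewrite !mxE; apply: eq_bigr => p _; rewrite triC13.
Qed.

Lemma Lvec_mulC u w : Lvec iota u *m w = Lvec iota w *m u.
Proof.
apply/matrixP => i j; rewrite !mxE ord1.
under eq_bigr do rewrite mxE mulr_suml.
under [RHS]eq_bigr do rewrite mxE mulr_suml.
rewrite exchange_big; apply: eq_bigr => p _; apply: eq_bigr => q _.
by rewrite (triC13 _ i p q) (triC12 _ q p i) (triC13 _ p q i); ring.
Qed.

Lemma Lvec_map (B : comNzRingType) (phi : {rmorphism A -> B}) u :
  map_mx phi (Lvec iota u) = Lvec (phi \o iota) (map_mx phi u).
Proof.
apply/matrixP => i j; rewrite !mxE rmorph_sum; apply: eq_bigr => p _.
by rewrite rmorphM !mxE.
Qed.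
End Lvec.

(** * Bordered determinants and the partial derivatives of the White-Miller quartic *)

Section BorderedDet.
Variables (A : comNzRingType) (n : nat).
Implicit Types (L : 'M[A]_n) (u : 'cV[A]_n) (v : 'rV[A]_n).

(** Multiplication on the right by [N] clears the upper right block, because L adj(L) u = det(L)
    u. *)
Lemma det_bordered_mul L u v :
  \det (bordered L u v) * \det L = - (v *m \adj L *m u) 0 0 * \det L.
Proof.
pose N : 'M_(n + 1) := block_mx 1%:M (- (\adj L *m u)) 0 (\det L)%:M.
have dN : \det N = \det L by rewrite det_ublock det1 mul1r det_scalar1.
rewrite -{1}dN -det_mulmx /bordered mulmx_block !mulmx1 !mulmx0 !mul0mx !addr0.
rewrite mulmxN mulmxA mul_mx_adj mul_scalar_mx mul_mx_scalar addNr det_lblock.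
by rewrite mulmxN det_mx11 mxE mulmxA mulrC.
Qed.
End BorderedDet.

(** To cancel det L over an arbitrary ring, L is replaced by X + L, whose determinant is monic and
    hence regular; then X is set to 0. *)
Lemma det_bordered (A : comNzRingType) n (L : 'M[A]_n) (u : 'cV[A]_n) (v : 'rV[A]_n) :
  \det (bordered L u v) = - (v *m \adj L *m u) 0 0.
Proof.
pose L' := char_poly_mx (- L); pose ev := horner_eval (0 : A).
have evP (p : {poly A}) : ev p = p.[0] by [].
have evC m k (M : 'M[A]_(m, k)) : map_mx ev (map_mx polyC M) = M.
  by apply/matrixP => i j; rewrite !mxE evP hornerC.
have evL : map_mx ev L' = L.
  apply/matrixP => i j; rewrite !mxE evP hornerD hornerN hornerC opprK.
  by case: (i == j); rewrite ?mulr1n ?mulr0n ?hornerX ?hornerC add0r.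
have := det_bordered_mul L' (map_mx polyC u) (map_mx polyC v).
move/(monic_rreg (char_poly_monic (- L))) => /(congr1 ev).
rewrite -[ev (\det _)]det_map_mx /bordered map_block_mx evL !evC raddf0.
move->; rewrite [LHS]hornerN; congr (- _).
have E (M : 'M_1) : ev (M 0 0) = (map_mx ev M) 0 0 by rewrite mxE.
by rewrite -[LHS]/(ev _) E !map_mxM map_mx_adj evL !evC.
Qed.

Section Singular.
Variable A : comNzRingType.
Implicit Types (q r : 'I_6 -> A) (b : 'rV[A]_3).

(** The coefficients of the product of two conics ([Hbar_conicM]), written as a bilinear expression
    in their coordinates. *)
Definition sqv q r : 'cV[A]_15 :=
  \col_i \sum_a \sum_c q a * r c * ((tnth mon2 a + tnth mon2 c)%MM == tnth mon4 i)%:R.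

Definition ev2 q b : A := \sum_a q a * mmap1 (b 0) (tnth mon2 a).

Definition conic_of q : {mpoly A[3]} := \sum_a q a *: 'X_[tnth mon2 a].

Definition dirac (k : 'I_6) : 'I_6 -> A := fun a => (a == k)%:R.

Lemma mdeg_mon4 (p : 'I_15) : mdeg (tnth mon4 p) = 4%N.
Proof.
have : all (fun m => mdeg m == 4%N) mon4.
  by rewrite /= !mdegE !big_ord_recl !big_ord0.
by move/all_tnthP => /(_ p)/eqP.
Qed.

Lemma mdeg_mon2 (p : 'I_6) : mdeg (tnth mon2 p) = 2%N.
Proof.
have : all (fun m => mdeg m == 2%N) mon2.
  by rewrite /= !mdegE !big_ord_recl !big_ord0.
by move/all_tnthP => /(_ p)/eqP.
Qed.

Lemma mon4_inj : injective (tnth mon4).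
Proof. exact/tuple_uniqP. Qed.

Lemma sum_mon4 (m : 'X_{1..3}) (F : 'X_{1..3} -> A) : mdeg m = 4%N ->
  \sum_(i < 15) F (tnth mon4 i) * (m == tnth mon4 i)%:R = F m.
Proof.
move=> /mon4P/tnthP[p ->]; rewrite (bigD1 p) //= eqxx mulr1 big1 ?addr0 // => i ip.
by rewrite (inj_eq mon4_inj) eq_sym (negbTE ip) mulr0.
Qed.

Lemma pair15_sqv b q r : pair15 (ver4 b) (sqv q r) = ev2 q b * ev2 r b.
Proof.
rewrite /pair15 /ev2 mulr_suml.
under eq_bigr => i _ do rewrite [sqv _ _ _ _]mxE mulr_sumr.
rewrite exchange_big; apply: eq_bigr => a _; rewrite mulr_sumr.
under eq_bigr => i _ do rewrite mulr_sumr.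
rewrite exchange_big; apply: eq_bigr => c _.
transitivity (q a * r c * mmap1 (b 0) (tnth mon2 a + tnth mon2 c)%MM); last first.
  by rewrite mmap1M; ring.
rewrite -(sum_mon4 (mmap1 (b 0))) ?mdegD ?mdeg_mon2 // mulr_sumr.
by apply: eq_bigr => i _; rewrite [ver4 _ _ _]mxE; ring.
Qed.

Lemma Hbar_conicM q r : Hbar (conic_of q * conic_of r) = sqv q r.
Proof.
apply/matrixP => i j; rewrite !mxE /conic_of mulr_suml raddf_sum /=.
apply: eq_bigr => a _; rewrite mulr_sumr raddf_sum /=; apply: eq_bigr => c _.
by rewrite -scalerAl -scalerAr scalerA -mpolyXD mcoeffZ mcoeffX.
Qed.

Lemma sqv_sumr q r : sqv q r = \sum_c r c *: sqv q (dirac c).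
Proof.
apply/matrixP => i j; rewrite summxE !mxE exchange_big; apply: eq_bigr => c _.
rewrite !mxE mulr_sumr; apply: eq_bigr => a _.
rewrite (bigD1 c) //= big1 ?addr0 => [|d dc]; last first.
  by rewrite /dirac (negbTE dc) mulr0 mul0r.
by rewrite /dirac eqxx mulr1; ring.
Qed.
End Singular.

Lemma sqv_map (A B : comNzRingType) (phi : {rmorphism A -> B}) (q r : 'I_6 -> A) :
  map_mx phi (sqv q r) = sqv (phi \o q) (phi \o r).
Proof.
apply/matrixP => i j; rewrite !mxE rmorph_sum; apply: eq_bigr => a _.
rewrite rmorph_sum; apply: eq_bigr => c _.
by rewrite !rmorphM rmorph_nat.
Qed.

Section WMvec.
Variables (K : numFieldType) (A : comNzRingType) (iota : K -> A).
Implicit Types (u : 'cV[A]_15) (q : 'I_6 -> A).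
Let X : 'I_6 -> {mpoly A[6]} := fun i => 'X_i.

Definition WMv u : {mpoly A[6]} :=
  - pair15 (map_mx (@mpolyC 6 A) (\adj (Lvec iota u)) *m sqv X X) (sqv X X).

(** The derivative of - v^t adj(L) v at v = q^2 in the direction y_k: one factor 2 comes from the
    quadratic form in v and one from the derivative of q^2. *)
Definition WMd u k : {mpoly A[6]} :=
  pair15 (map_mx (@mpolyC 6 A) (\adj (Lvec iota u)) *m sqv X X) (sqv X (dirac _ k)) *- 4.

Lemma sqv_homog i : sqv X X i 0 \is 2.-homog.
Proof.
rewrite mxE; apply: rpred_sum => a _; apply: rpred_sum => c _.
rewrite mulr_natr; apply: rpredMn; rewrite -[2%N]/(1 + 1)%N.
by apply: dhomogM; rewrite dhomogX /= mdeg1.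
Qed.

Lemma sqv_dirac_homog i k : sqv X (dirac _ k) i 0 \is 1.-homog.
Proof.
rewrite mxE; apply: rpred_sum => a _; apply: rpred_sum => c _.
rewrite mulr_natr; apply: rpredMn; rewrite /dirac mulr_natr; apply: rpredMn.
by rewrite dhomogX /= mdeg1.
Qed.

Lemma WMd_homog u k : WMd u k \is 3.-homog.
Proof.
rewrite /WMd rpredN; apply: rpredMn; apply: rpred_sum => i _.
rewrite -[3%N]/(2 + 1)%N; apply: dhomogM; last exact: sqv_dirac_homog.
rewrite mxE; apply: rpred_sum => j _; rewrite mxE mul_mpolyC.
by apply: rpredZ; apply: sqv_homog.
Qed.

Lemma mderiv_sqv i k : (sqv X X i 0)^`M(k) = sqv X (dirac _ k) i 0 *+ 2.
Proof.
have dX a : ('X_a : {mpoly A[6]})^`M(k) = dirac _ k a.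
  rewrite mderivX mnm1E /dirac; case: eqP => [->|_]; last by rewrite scale0r.
  have -> : (U_(k) - U_(k))%MM = 0%MM by apply/mnmP => x; rewrite mnmBE mnm0E subnn.
  by rewrite mpolyX0 scale1r.
have dN (n : nat) : (n%:R : {mpoly A[6]})^`M(k) = 0.
  by rewrite -mpolyC_nat mderivC.
have E : sqv X X i 0 = \sum_a \sum_c X a * X c *
    ((tnth mon2 a + tnth mon2 c)%MM == tnth mon4 i)%:R by rewrite mxE.
rewrite E raddf_sum /=; under eq_bigr => a _.
  rewrite raddf_sum /=; under eq_bigr => c _.
    rewrite mderivM dN mulr0 addr0 mderivM !dX mulrDl; over.
  rewrite big_split; over.
rewrite big_split mulr2n; congr (_ + _); last by rewrite mxE.
rewrite mxE exchange_big; apply: eq_bigr => a _; apply: eq_bigr => c _.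
by rewrite addmC [X in X * _]mulrC.
Qed.

Lemma mderiv_WMv u k : (WMv u)^`M(k) = WMd u k.
Proof.
rewrite /WMv /WMd mderivN; congr (- _); set L := map_mx _ _.
have Lsym : L^T = L.
  by rewrite /L map_trmx trmx_adj Lvec_sym.
have LC i j : (L i j)^`M(k) = 0 by rewrite mxE mderivC.
pose v := sqv X X; pose w := sqv X (dirac _ k).
have dL i : ((L *m v) i 0)^`M(k) = (L *m w) i 0 *+ 2.
  rewrite !mxE raddf_sum -sumrMnl; apply: eq_bigr => j _ /=.
  by rewrite mderivM LC mul0r add0r mderiv_sqv mulrnAr.
transitivity (pair15 (L *m w) v *+ 2 + pair15 (L *m v) w *+ 2).
  rewrite /pair15 raddf_sum -!sumrMnl -big_split; apply: eq_bigr => i _ /=.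
  by rewrite mderivM dL mderiv_sqv mulrnAl mulrnAr.
rewrite -[pair15 (L *m w) v]pair15C pair15_mul Lsym.
by rewrite -mulrnDr.
Qed.

Lemma meval_WMd u k q :
  (WMd u k).@[q] = pair15 (\adj (Lvec iota u) *m sqv q q) (sqv q (dirac _ k)) *- 4.
Proof.
have Xq : meval q \o X =1 q by move=> i; rewrite /= mevalXU.
have E1 i : (sqv X X i 0).@[q] = sqv q q i 0.
  rewrite !mxE raddf_sum; apply: eq_bigr => a _; rewrite raddf_sum; apply: eq_bigr => c _.
  by rewrite /= !mevalM !mevalXU rmorph_nat.
have E2 i : (sqv X (dirac _ k) i 0).@[q] = sqv q (dirac _ k) i 0.
  rewrite !mxE raddf_sum; apply: eq_bigr => a _; rewrite raddf_sum; apply: eq_bigr => c _.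
  by rewrite /= !mevalM !mevalXU !rmorph_nat.
rewrite /WMd mevalN mevalMn; congr (- (_ *+ _)).
rewrite raddf_sum; apply: eq_bigr => i _; rewrite /= mevalM E2; congr (_ * _).
rewrite !mxE raddf_sum; apply: eq_bigr => j _.
by rewrite /= mevalM mxE mevalC E1.
Qed.

(* If L w = C q^2 with w apolar to q, then q is a singular point; the error term
   e Delta makes this usable modulo e. *)
Lemma WMd_singular u w q (C e : A) (Delta : 'cV[A]_15) :
  Lvec iota u *m w = C *: sqv q q + e *: Delta ->
  (forall k, pair15 w (sqv q (dirac _ k)) = 0) ->
  forall k, exists z, C * (WMd u k).@[q] = e * z.
Proof.
move=> Lw hw k; rewrite meval_WMd; set L := Lvec iota u in Lw *.
exists (pair15 (\adj L *m Delta) (sqv q (dirac _ k)) *+ 4).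
have : pair15 (\adj L *m (L *m w)) (sqv q (dirac _ k)) = 0.
  by rewrite mulmxA mul_adj_mx mul_scalar_mx pair15Zl hw mulr0.
rewrite Lw mulmxDr -!scalemxAr pair15C pair15Dr !pair15Zr !(pair15C (sqv _ _)).
move/eqP; rewrite addr_eq0 => /eqP h.
by rewrite mulrN mulrnAr h mulNrn opprK mulrnAr.
Qed.
End WMvec.

Lemma WM_partial (K : numFieldType) (f : {mpoly K[3]}) k :
  (WM f)^`M(k) = WMd id (fbar f) k.
Proof.
rewrite -mderiv_WMv; congr mderiv; rewrite /WM /WMv det_bordered LmatE.
have -> : Hbar (generic_conic K ^+ 2) = sqv (fun i => 'X_i) (fun i => 'X_i).
  by rewrite expr2 -Hbar_conicM.
set v := sqv _ _; set L := map_mx _ _; congr (- _).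
rewrite -map_mx_adj; set L' := map_mx _ _.
by rewrite pair15C pair15E mulmxA.
Qed.

(** * Coordinates of conics and quartics, and apolarity *)

Section Expansions.
Variable A : comNzRingType.
Implicit Types (H : {mpoly A[3]}) (b : 'rV[A]_3).

Lemma homog_expand n (d : nat) (t : n.-tuple 'X_{1..3}) H : uniq t ->
  (forall m, mdeg m = d -> m \in t) -> (forall i, mdeg (tnth t i) = d) ->
  H \is d.-homog -> H = \sum_i H@_(tnth t i) *: 'X_[tnth t i].
Proof.
move=> U cov dt hH; apply/mpolyP => m; rewrite raddf_sum /=.
under eq_bigr do rewrite mcoeffZ mcoeffX.
have [/eqP/cov/tnthP[p ->]|md] := boolP (mdeg m == d).
  rewrite (bigD1 p) //= eqxx mulr1 big1 ?addr0 // => i ip.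
  by rewrite (inj_eq (@tuple_uniqP _ _ _ U)) (negbTE ip) mulr0.
rewrite (dhomog_nemf_coeff hH md) big1 // => i _.
by case: eqP => [E|]; rewrite ?mulr0 //; move: md; rewrite -E dt eqxx.
Qed.

Lemma homog4_expand H : H \is 4.-homog -> H = \sum_i H@_(tnth mon4 i) *: 'X_[tnth mon4 i].
Proof. by apply: homog_expand => //; [exact: mon4P | exact: mdeg_mon4]. Qed.

Lemma homog2_expand H : H \is 2.-homog -> H = \sum_i H@_(tnth mon2 i) *: 'X_[tnth mon2 i].
Proof. by apply: homog_expand => //; [exact: mon2P | exact: mdeg_mon2]. Qed.

Lemma mevalX1 b m : ('X_[m] : {mpoly A[3]}).@[b 0] = mmap1 (b 0) m.
Proof. by rewrite mevalX. Qed.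

Lemma pair15_Hbar b H : H \is 4.-homog -> pair15 (ver4 b) (Hbar H) = H.@[b 0].
Proof.
move=> hH; rewrite [in RHS](homog4_expand hH) raddf_sum; apply: eq_bigr => i _ /=.
by rewrite mevalZ mevalX1 !mxE mulrC.
Qed.

Lemma ev2_conic_coord b H : H \is 2.-homog -> ev2 (conic_coord H) b = H.@[b 0].
Proof.
move=> hH; rewrite [in RHS](homog2_expand hH) raddf_sum; apply: eq_bigr => i _ /=.
by rewrite mevalZ mevalX1.
Qed.

Lemma conic_of_coord H : H \is 2.-homog -> conic_of (conic_coord H) = H.
Proof. by move=> hH; rewrite [RHS]homog2_expand. Qed.

Lemma linform_homog a : linform a \is [in A[3], 1.-homog].
Proof. by apply: rpred_sum => i _; apply: rpredZ; rewrite dhomogX /= mdeg1. Qed.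

Lemma meval_linform a b : (linform a).@[b 0] = dot3 a b.
Proof.
rewrite /linform raddf_sum; apply: eq_bigr => i _.
by rewrite /= mevalZ mevalXU.
Qed.
End Expansions.

Section Quartics.
Variable K : numFieldType.
Implicit Types (f g : {mpoly K[3]}) (u w : 'cV[K]_15).

Definition quartic_of w : {mpoly K[3]} := \sum_p w p 0 *: quartic_basis K p.

Lemma multi4_neq0 p : (multi4 (tnth mon4 p))%:R != 0 :> K.
Proof.
have : all (fun m => multi4 m != 0%N) mon4.
  by rewrite /= /multi4 !big_ord_recl !big_ord0.
by move/all_tnthP => /(_ p); rewrite pnatr_eq0.
Qed.

Lemma quartic_of_homog w : quartic_of w \is 4.-homog.
Proof.
apply: rpred_sum => p _; apply: rpredZ; apply: rpredZ.
by rewrite dhomogX /= mdeg_mon4.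
Qed.

Lemma fbar_quartic_of w : fbar (quartic_of w) = w.
Proof.
apply/matrixP => p j; rewrite ord1 mxE /ncoef /quartic_of raddf_sum /=.
rewrite (bigD1 p) //= big1 ?addr0 => [|q qp].
  by rewrite !mcoeffZ mcoeffX eqxx mulr1 mulfK ?multi4_neq0.
by rewrite !mcoeffZ mcoeffX (inj_eq (@mon4_inj)) (negbTE qp) !mulr0.
Qed.

Lemma quartic_of_fbar f : f \is 4.-homog -> quartic_of (fbar f) = f.
Proof.
move=> hf; rewrite [RHS]homog4_expand //; apply: eq_bigr => p _.
by rewrite mxE /ncoef /quartic_basis scalerA divfK ?multi4_neq0.
Qed.

Lemma fbarZ c f : fbar (c *: f) = c *: fbar f.
Proof. by apply/matrixP => p j; rewrite !mxE /ncoef mcoeffZ mulrA. Qed.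

Lemma meval_quartic_of w (p : 'rV_3) : (quartic_of w).@[p 0] = pol4 w p p p p.
Proof.
rewrite pol4_delta raddf_sum.
suff E : \col_m (quartic_basis K m).@[p 0] = \col_m pol4 (delta_mx m 0) p p p p.
  apply: eq_bigr => m _; rewrite /= mevalZ; congr (_ * _).
  by have /matrixP/(_ m 0) := E; rewrite !mxE.
apply: ver4_eq => a; rewrite -pol4_delta pol4_ver4.
transitivity ((quartic_of (ver4 a)).@[p 0]).
  rewrite raddf_sum; apply: eq_bigr => m _.
  by rewrite /= mevalZ; congr (_ * _); rewrite mxE.
rewrite -fbar_pow4 quartic_of_fbar.
  by rewrite rmorphXn /= meval_linform; ring.
by rewrite -[4%N]mul1n; apply: dhomogMn; apply: linform_homog.
Qed.

Lemma pol4_fbar f (p : 'rV_3) : f \is 4.-homog -> pol4 (fbar f) p p p p = f.@[p 0].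
Proof. by move=> hf; rewrite -meval_quartic_of quartic_of_fbar. Qed.

Lemma border_quarticE f (Q : {mpoly K[3]}) : Q \is 2.-homog ->
  border_quartic f Q =
  quartic_of (- (\adj (Lk (fbar f)) *m sqv (conic_coord Q) (conic_coord Q))).
Proof.
move=> hQ; rewrite /border_quartic det_bordered LmatE -map_mx_adj.
rewrite -mulmxA -map_mxM -Hbar_conicM conic_of_coord // -expr2.
rewrite mxE -sumrN; apply: eq_bigr => p _.
by rewrite !mxE scaleNr mulrC mul_mpolyC.
Qed.

Lemma border_quartic_homog f (Q : {mpoly K[3]}) : Q \is 2.-homog ->
  border_quartic f Q \is 4.-homog.
Proof. by move=> hQ; rewrite border_quarticE // quartic_of_homog. Qed.

(** For n of degree 2, the coefficient of x^n in the contraction, times n!, is 4! times the pairing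
    of g with Q y^n: differentiation along m turns x^(m+n) into (m+n)!/n! x^n, and [fbar] divides by
    4!/(m+n)!. *)
Lemma apolarP g (Q : {mpoly K[3]}) : g \is 4.-homog -> Q \is 2.-homog ->
  (forall k, pair15 (fbar g) (sqv (conic_coord Q) (dirac K k)) = 0) -> apolar g Q.
Proof.
move=> hg hQ h; apply/mpolyP => n; rewrite mcoeff0 /contraction raddf_sum /=.
have [nd|nd] := eqVneq (mdeg n) 2%N; last first.
  rewrite big_seq big1 // => m /(dhomog_mf hQ) /= md.
  rewrite mcoeffZ mcoeff_mderivm (dhomog_nemf_coeff hg) ?mul0rn ?mulr0 //=.
  by rewrite mdegD md -[4%N]/(2 + 2)%N eqn_add2l.
have [k nE] := tnthP _ _ (mon2P nd); subst n.
pose F2 := (\prod_(i < 3) (tnth mon2 k i)`!)%N.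
have nf0 : F2%:R != 0 :> K.
  by rewrite pnatr_eq0 -lt0n prodn_gt0 // => i; apply: fact_gt0.
apply: (mulIf nf0); rewrite mul0r mulr_suml.
transitivity (4`!%:R * pair15 (fbar g) (sqv (conic_coord Q) (dirac K k))); last first.
  by rewrite h mulr0.
rewrite -Hbar_conicM conic_of_coord //.
have -> : conic_of (dirac K k) = 'X_[tnth mon2 k].
  rewrite /conic_of (bigD1 k) //= big1 ?addr0 /dirac ?eqxx ?scale1r // => i ik.
  by rewrite (negbTE ik) scale0r.
rewrite /pair15.
under eq_bigr => m _ do rewrite mcoeffZ mcoeff_mderivm.
transitivity (\sum_(m <- msupp Q) Q@_m * (4`!%:R * ncoef g (m + tnth mon2 k)%MM)).
  rewrite !big_seq; apply: eq_bigr => m /(dhomog_mf hQ) /= md.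
  have d4 : mdeg (m + tnth mon2 k)%MM = 4%N by rewrite mdegD md mdeg_mon2.
  have /tnthP[p pE] := mon4P d4.
  pose F1 := (\prod_(i < 3) ((m + tnth mon2 k)%MM i) ^_ (m i))%N.
  have FF : (F1 * F2 = \prod_(i < 3) ((m + tnth mon2 k)%MM i)`!)%N.
    rewrite -big_split; apply: eq_bigr => i _ /=; rewrite mnmDE.
    by rewrite -[in (tnth mon2 k i)`!](addKn (m i) (tnth mon2 k i)) ffact_fact ?leq_addr.
  have M0 : (multi4 (m + tnth mon2 k))%:R != 0 :> K by rewrite pE multi4_neq0.
  rewrite -(multi4K d4) -FF !natrM -/F1 -mulr_natr /ncoef -!mulrA; congr (_ * _).
  by field.
rewrite mulr_sumr; under [RHS]eq_bigr => p _.
  rewrite [Hbar _ _ _]mxE [X in (X * _)@__]mpolyE mulr_suml raddf_sum mulr_sumr mulr_sumr /=.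
  over.
rewrite exchange_big !big_seq; apply: eq_bigr => m /(dhomog_mf hQ) /= md.
have d4 : mdeg (m + tnth mon2 k)%MM = 4%N by rewrite mdegD md mdeg_mon2.
rewrite -(sum_mon4 (ncoef g) d4) !mulr_sumr; apply: eq_bigr => p _.
rewrite -scalerAl -mpolyXD mcoeffZ mcoeffX [fbar g _ _]mxE.
by ring.
Qed.
End Quartics.

(** * Quartics apolar to a smooth conic *)

Section Border.
Variable K : numFieldType.
Implicit Types (f Q : {mpoly K[3]}).

Lemma fbar_border f Q : Q \is 2.-homog ->
  fbar (border_quartic f Q) = - (\adj (Lk (fbar f)) *m sqv (conic_coord Q) (conic_coord Q)).
Proof. by move=> hQ; rewrite border_quarticE // fbar_quartic_of. Qed.

Lemma border_apolar f Q : Q \is 2.-homog ->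
  zero_locus [set` partials (WM f)]%classic (conic_coord Q) ->
  forall k, pair15 (fbar (border_quartic f Q)) (sqv (conic_coord Q) (dirac K k)) = 0.
Proof.
move=> hQ [_ h] k; have := h (WM f)^`M(k).
rewrite WM_partial meval_WMd => /(_ _)/eqP.
rewrite oppr_eq0 mulrn_eq0 /= => /(_ _)/eqP E.
rewrite fbar_border // -scaleN1r pair15Zl E ?mulr0 // -WM_partial.
by apply: map_f; rewrite mem_enum.
Qed.

Lemma fbar_eq0 f : f \is 4.-homog -> fbar f = 0 -> f = 0.
Proof.
move=> hf f0; rewrite -(quartic_of_fbar hf) f0 /quartic_of big1 // => p _.
by rewrite mxE scale0r.
Qed.

(** Here L_g f = L_f g and g = - adj(L_f) Q^2. Multiplying by adj(L_g) recovers f from g, which is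
    the source of both the invertibility of L_f and the inverse formula. *)
Lemma Lk_border f Q : Q \is 2.-homog ->
  Lk (fbar (border_quartic f Q)) *m fbar f =
  - \det (Lk (fbar f)) *: sqv (conic_coord Q) (conic_coord Q).
Proof.
move=> hQ; rewrite Lvec_mulC fbar_border // mulmxN mulmxA mul_mx_adj mul_scalar_mx.
by rewrite scaleNr.
Qed.

Lemma det_Lk_neq0 f Q (g := border_quartic f Q) : f \is 4.-homog -> f != 0 ->
  Q \is 2.-homog -> \det (Lk (fbar g)) != 0 -> \det (Lk (fbar f)) != 0.
Proof.
move=> hf f0 hQ dg; apply: contra f0 => /eqP df; apply/eqP/fbar_eq0 => //.
have := Lk_border f hQ; rewrite df oppr0 scale0r => /(congr1 (mulmx (\adj (Lk (fbar g))))).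
rewrite mulmx0 mulmxA mul_adj_mx mul_scalar_mx => /eqP.
by rewrite scaler_eq0 (negbTE dg) => /eqP.
Qed.

Lemma border_inv f Q (g := border_quartic f Q) : f \is 4.-homog -> f != 0 ->
  Q \is 2.-homog -> \det (Lk (fbar g)) != 0 ->
  exists2 c : K, c != 0 & f = c *: border_quartic g Q.
Proof.
move=> hf f0 hQ dg; have df := det_Lk_neq0 hf f0 hQ dg.
exists (\det (Lk (fbar f)) / \det (Lk (fbar g))).
  by rewrite mulf_neq0 ?invr_neq0.
rewrite -[LHS](quartic_of_fbar hf) -[border_quartic g Q](quartic_of_fbar (border_quartic_homog g hQ)).
have {1}-> : fbar f = \det (Lk (fbar f)) / \det (Lk (fbar g)) *: fbar (border_quartic g Q).
  apply: (scalerI dg); rewrite scalerA [_ * (_ / _)]mulrC divfK // fbar_border //.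
  rewrite -mul_scalar_mx -mul_adj_mx -mulmxA (Lk_border f hQ) -scalemxAr.
  rewrite scaleNr scalerN. reflexivity.
rewrite /quartic_of scaler_sumr; apply: eq_bigr => p _.
by rewrite mxE scalerA.
Qed.
End Border.

Section Conics.
Variable A : comNzRingType.
Implicit Types (q : 'I_6 -> A) (a b c p : 'rV[A]_3).

Lemma sum6E (F : 'I_6 -> A) : \sum_i F i = F 0 + F 1 + F 2 + F 3 + F 4 + F 5.
Proof.
rewrite !big_ord_recl big_ord0 addr0 !addrA.
by congr (_ + F _ + F _ + F _ + F _ + F _); apply: val_inj.
Qed.

Lemma mmap1_mon3 a i j k : mmap1 (a 0) (mon3 i j k) = a 0 0 ^+ i * a 0 1 ^+ j * a 0 2 ^+ k.
Proof.
rewrite /mmap1 !big_ord_recl big_ord0 mulr1 mulrA.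
have -> : lift ord0 ord0 = 1 :> 'I_3 by apply: val_inj.
by have -> : lift ord0 (lift ord0 ord0) = 2 :> 'I_3 by apply: val_inj.
Qed.

Lemma ev2E q a : ev2 q a = q 0 * a 0 0 ^+ 2 + q 1 * (a 0 0 * a 0 1) + q 2 * (a 0 0 * a 0 2)
  + q 3 * a 0 1 ^+ 2 + q 4 * (a 0 1 * a 0 2) + q 5 * a 0 2 ^+ 2.
Proof.
rewrite /ev2 sum6E !(tnth_nth 0%MM) /= !mmap1_mon3 !expr0 !expr1; ring.
Qed.

Definition grad2 q a : 'rV[A]_3 :=
  vec3 (q 0 * a 0 0 *+ 2 + q 1 * a 0 1 + q 2 * a 0 2)
       (q 1 * a 0 0 + q 3 * a 0 1 *+ 2 + q 4 * a 0 2)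
       (q 2 * a 0 0 + q 4 * a 0 1 + q 5 * a 0 2 *+ 2).

Lemma conic_ofE q : conic_of q = q 0 *: ('X_0 * 'X_0) + q 1 *: ('X_0 * 'X_1) + q 2 *: ('X_0 * 'X_2)
  + q 3 *: ('X_1 * 'X_1) + q 4 *: ('X_1 * 'X_2) + q 5 *: ('X_2 * 'X_2).
Proof.
have E (m : 'X_{1..3}) i j k : m = mon3 i j k ->
    'X_[m] = 'X_0 ^+ i * 'X_1 ^+ j * 'X_2 ^+ k :> {mpoly A[3]}.
  move=> ->; rewrite mpolyXE_id !big_ord_recl big_ord0 mulr1 mulrA.
  have -> : lift ord0 ord0 = 1 :> 'I_3 by apply: val_inj.
  by have -> : lift ord0 (lift ord0 ord0) = 2 :> 'I_3 by apply: val_inj.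
rewrite /conic_of !big_ord_recl big_ord0 addr0 !addrA !(tnth_nth 0%MM) /=.
rewrite !(E _ _ _ _ erefl) !expr0 !expr1 !mul1r !mulr1 !expr2.
by congr (q _ *: _ + q _ *: _ + q _ *: _ + q _ *: _ + q _ *: _ + q _ *: _); apply: val_inj.
Qed.

Lemma mderiv_conic_of q a i : ((conic_of q)^`M(i)).@[a 0] = grad2 q a 0 i.
Proof.
have dX (j : 'I_3) : ('X_j : {mpoly A[3]})^`M(i) = (j == i)%:R.
  rewrite mderivX mnm1E; case: eqP => [->|_]; last by rewrite scale0r.
  have -> : (U_(i) - U_(i))%MM = 0%MM by apply/mnmP => x; rewrite mnmBE mnm0E subnn.
  by rewrite mpolyX0 scale1r.
rewrite conic_ofE !mderivD !mderivZ !mderivM !dX !(mevalD, mevalZ, mevalM) !mevalXU !rmorph_nat.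
case: i {dX} => [[|[|[|//]]] hi].
- rewrite (_ : Ordinal hi = 0) ?vec3E; last exact: val_inj.
  by rewrite eqxx /=; ring.
- rewrite (_ : Ordinal hi = 1) ?vec3E; last exact: val_inj.
  by rewrite eqxx /=; ring.
- rewrite (_ : Ordinal hi = 2) ?vec3E; last exact: val_inj.
  by rewrite eqxx /=; ring.
Qed.

Lemma ev2_lin q a b x y : ev2 q (x *: a + y *: b) =
  x ^+ 2 * ev2 q a + x * y * dot3 (grad2 q a) b + y ^+ 2 * ev2 q b.
Proof. by rewrite !ev2E dot3E !vec3E !mxE; ring. Qed.

Lemma grad2C q a b : dot3 (grad2 q a) b = dot3 (grad2 q b) a.
Proof. by rewrite !dot3E !vec3E; ring. Qed.

Lemma grad2_self q a : dot3 (grad2 q a) a = ev2 q a *+ 2.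
Proof. by rewrite ev2E dot3E !vec3E; ring. Qed.

Lemma dot3_linr a b c x y : dot3 a (x *: b + y *: c) = x * dot3 a b + y * dot3 a c.
Proof. by rewrite !dot3E !mxE; ring. Qed.

Lemma dot3_cross a b : (dot3 a (cross a b) = 0) * (dot3 b (cross a b) = 0).
Proof. by split; rewrite !dot3E !vec3E; ring. Qed.

Lemma det3Z3 a b c x : det3 a b (x *: c) = x * det3 a b c.
Proof. by rewrite !det3E !dot3E !vec3E !mxE; ring. Qed.

Lemma det3_cross2 a b c d : det3 a (cross b c) d = dot3 b d * dot3 c a - dot3 b a * dot3 c d.
Proof. by rewrite det3E !dot3E !vec3E; ring. Qed.

Lemma cramer3 a b c p : det3 a b c *: p =
  dot3 p a *: cross b c + dot3 p b *: cross c a + dot3 p c *: cross a b.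
Proof. by apply: vec3P; rewrite det3E !dot3E !mxE /=; ring. Qed.

Lemma cramer3' a b c p : det3 a b c *: p =
  dot3 p (cross b c) *: a + dot3 p (cross c a) *: b + dot3 p (cross a b) *: c.
Proof. by apply: vec3P; rewrite det3E !dot3E !mxE /=; ring. Qed.
End Conics.

(** p0 and p2 are two points of the conic, normalized so that their polar pairing is 1, and p1 is
    the pole of the line joining them. If p1 lay on the conic, its gradient would be orthogonal to
    the whole basis, against smoothness. *)
Lemma smooth_conic_param (K : numClosedFieldType) (Q : {mpoly K[3]}) : smooth_conic Q ->
  exists p0 p1 p2 c, [/\ c != 0, det3 p0 p1 p2 != 0 &
    forall x y z, ev2 (conic_coord Q) (x *: p0 + y *: p1 + z *: p2) = c * (y ^+ 2 - x * z)].
Proof.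
case=> hQ sm; pose q := conic_coord Q.
have smq a : a != 0 -> ev2 q a = 0 -> grad2 q a != 0.
  move=> a0; rewrite ev2_conic_coord // => Qa.
  have [|i] := sm (a 0) _ Qa.
    apply/existsP; apply: contraNT a0 => /existsPn h; apply/eqP/rowP => i.
    by have := h i; rewrite negbK mxE => /eqP.
  by apply: contra => /eqP g0; rewrite -[Q](conic_of_coord hQ) mderiv_conic_of g0 mxE.
have [p0 p00 q0] : exists2 p : 'rV_3, p != 0 & ev2 q p = 0.
  have v3 (x y z : K) : (vec3 x y z == 0) = [&& x == 0, y == 0 & z == 0].
    apply/eqP/and3P => [/rowP h|[/eqP-> /eqP-> /eqP->]].
      by have := (h 0, h 1, h 2); rewrite !vec3E !mxE => -[[-> ->] ->].
    by apply: vec3P; rewrite vec3E mxE.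
  have [q00|q00] := eqVneq (q 0) 0.
    exists (vec3 1 0 0); first by rewrite v3 oner_eq0.
    by rewrite ev2E !vec3E q00; ring.
  (* A point of the conic on the line where the last coordinate vanishes, by the quadratic
     formula. *)
  exists (vec3 ((- q 1 + sqrtC (q 1 ^+ 2 - q 0 * q 3 *+ 4)) / (q 0 *+ 2)) 1 0).
    by rewrite v3 oner_eq0 andbF.
  rewrite ev2E !vec3E; set s := sqrtC _.
  have s2 : s ^+ 2 = q 1 ^+ 2 - q 0 * q 3 *+ 4 by rewrite sqrtCK.
  transitivity ((s ^+ 2 - (q 1 ^+ 2 - q 0 * q 3 *+ 4)) / (q 0 *+ 4)); first by field.
  by rewrite s2 subrr mul0r.
have [w w1] : exists w, dot3 (grad2 q p0) w = 1.
  have := smq _ p00 q0 => g0.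
  have [i gi] : exists i, grad2 q p0 0 i != 0.
    apply/existsP; apply: contraNT g0 => /existsPn h; apply/eqP/rowP => i.
    by have := h i; rewrite negbK [RHS]mxE => /eqP.
  exists ((grad2 q p0 0 i)^-1 *: delta_mx 0 i); rewrite /dot3 (bigD1 i) //= big1 => [|j ji].
    by rewrite [X in _ * X]mxE [X in _ * (_ * X)]mxE !eqxx mulr1 addr0 divff.
  by rewrite [X in _ * X]mxE [X in _ * (_ * X)]mxE (negbTE ji) andbF !mulr0.
(* Adding a multiple of p0 moves w onto the conic without changing its pairing with p0. *)
pose p2 := 1 *: w + (- ev2 q w) *: p0.
have p0p0 : dot3 (grad2 q p0) p0 = 0.
  by rewrite grad2_self q0 mul0rn.
have q2 : ev2 q p2 = 0.
  by rewrite /p2 ev2_lin q0 grad2C w1; ring.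
have p0p2 : dot3 (grad2 q p0) p2 = 1.
  by rewrite dot3_linr w1 p0p0 mulr0 addr0 mulr1.
have p2p2 : dot3 (grad2 q p2) p2 = 0.
  by rewrite grad2_self q2 mul0rn.
pose p1 := cross (grad2 q p0) (grad2 q p2).
have p0p1 : dot3 (grad2 q p0) p1 = 0 by rewrite dot3_cross.
have p2p1 : dot3 (grad2 q p2) p1 = 0 by rewrite dot3_cross.
have d1 : det3 p0 p1 p2 = 1.
  by rewrite det3_cross2 p0p0 mul0r subr0 p0p2 mul1r grad2C.
clearbody p1 p2.
have q1 : ev2 q p1 != 0.
  apply/eqP => q1; have p10 : p1 != 0.
    apply/eqP => p10; move: d1; rewrite p10 det3E dot3E !vec3E !mxE => /eqP.
    by rewrite !(mul0r, mulr0, subr0, addr0) eq_sym oner_eq0.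
  have := smq _ p10 q1; rewrite -[grad2 q p1]scale1r -{1}d1 cramer3.
  rewrite -(grad2C q p0) p0p1 -(grad2C q p2) p2p1.
  by rewrite grad2_self q1 mul0rn !scale0r !addr0 eqxx.
(* In the basis p0, p1, p2 the conic is q(p1) y^2 + x z; rescaling p2 makes q(p1) a common
   factor. *)
exists p0, p1, (- ev2 q p1 *: p2), (ev2 q p1); split=> //.
  by rewrite det3Z3 d1 mulr1 oppr_eq0.
move=> x y z; rewrite -/q.
have -> : x *: p0 + y *: p1 + z *: (- ev2 q p1 *: p2) =
   1 *: (x *: p0 + y *: p1) + (- z * ev2 q p1) *: p2.
  by rewrite scale1r scalerA mulrN mulNr.
rewrite ev2_lin ev2_lin q0 q2 p0p1 grad2C.
by rewrite dot3_linr p2p1 grad2C p0p2; ring.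
Qed.

(** The relation T 1 1 = T 0 2 and the symmetry let any two indices i, j be replaced by min(i + j,
    2) and the remainder i + j - 2. Six such moves, one for each pair of positions, reach a normal
    form determined by the sum: the largest possible indices first. The nine values are the moments
    of an apolar quartic. *)
Lemma sym4_gamma (V : Type) (T : nat -> nat -> nat -> nat -> V) :
  (forall i j k l, T i j k l = T j i k l) -> (forall i j k l, T i j k l = T i k j l) ->
  (forall i j k l, T i j k l = T i j l k) ->
  (forall k l, T 1 1 k l = T 0 2 k l)%N ->
  exists gam : nat -> V, forall i j k l, (i < 3)%N -> (j < 3)%N -> (k < 3)%N -> (l < 3)%N ->
    T i j k l = gam (i + j + k + l)%N.
Proof.
move=> C12 C23 C34 T11.
exists (fun n => T (minn n 2) (minn (n - 2) 2) (minn (n - 4) 2) (n - 6))%N => i j k l hi hj hk hl.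
have H12 i' j' k' l' : (i' < 3)%N -> (j' < 3)%N ->
    T i' j' k' l' = T (minn (i' + j') 2) (i' + j' - 2)%N k' l'.
  case: i' => [|[|[|//]]]; case: j' => [|[|[|//]]] _ _ //=; rewrite ?T11 //; exact: C12.
have H13 i' j' k' l' : (i' < 3)%N -> (k' < 3)%N ->
    T i' j' k' l' = T (minn (i' + k') 2) j' (i' + k' - 2)%N l'.
  by move=> h1 h2; rewrite C23 H12 // C23.
have H14 i' j' k' l' : (i' < 3)%N -> (l' < 3)%N ->
    T i' j' k' l' = T (minn (i' + l') 2) j' k' (i' + l' - 2)%N.
  by move=> h1 h2; rewrite C34 H13 // C34.
have H23 i' j' k' l' : (j' < 3)%N -> (k' < 3)%N ->
    T i' j' k' l' = T i' (minn (j' + k') 2) (j' + k' - 2)%N l'.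
  by move=> h1 h2; rewrite C12 H13 // C12.
have H24 i' j' k' l' : (j' < 3)%N -> (l' < 3)%N ->
    T i' j' k' l' = T i' (minn (j' + l') 2) k' (j' + l' - 2)%N.
  by move=> h1 h2; rewrite C12 H14 // C12.
have H34 i' j' k' l' : (k' < 3)%N -> (l' < 3)%N ->
    T i' j' k' l' = T i' j' (minn (k' + l') 2) (k' + l' - 2)%N.
  by move=> h1 h2; rewrite C23 H24 // C23.
move: i j k l hi hj hk hl.
do 4 (case=> [|[|[|//]]]); move=> _ _ _ _;
  by rewrite [LHS]H12 // [LHS]H13 // [LHS]H14 // [LHS]H23 // [LHS]H24 // [LHS]H34.
Qed.

Lemma prod_sum4 (A : comNzRingType) (I : finType) (x y z t : I -> A) :
  (\sum_i x i) * (\sum_i y i) * (\sum_i z i) * (\sum_i t i) =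
  \sum_i \sum_j \sum_k \sum_l x i * y j * z k * t l.
Proof.
rewrite !mulr_suml; apply: eq_bigr => i _.
rewrite [x i * _]mulr_sumr !mulr_suml; apply: eq_bigr => j _.
rewrite [x i * y j * _]mulr_sumr mulr_suml; apply: eq_bigr => k _.
by rewrite mulr_sumr.
Qed.

Section Gamma.
Variable K : numFieldType.
Implicit Types (w : 'cV[K]_15) (p q r s : 'rV[K]_3).

Lemma idx4_surj m : exists i j k l, m = idx4 i j k l.
Proof.
have /mnm_split[i [m1 [E1 /mnm_split[j [m2 [E2 /mnm_split[k [m3 [E3]]]]]]]]] := mdeg_mon4 m.
move=> /mnm_split[l [m4 [E4 /eqP]]]; rewrite mdeg_eq0 => /eqP E5.
exists i, j, k, l; apply: mon4_inj.
by rewrite tnth_idx4 E1 E2 E3 E4 E5 addm0 !addmA.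
Qed.

Lemma pol4_delta4 w i j k l :
  pol4 w (delta_mx 0 i) (delta_mx 0 j) (delta_mx 0 k) (delta_mx 0 l) = w (idx4 i j k l) 0.
Proof.
have D (y : 'I_3) (F : 'I_3 -> K) : \sum_x F x * (delta_mx 0 y : 'rV[K]_3) 0 x = F y.
  rewrite (bigD1 y) //= big1 => [|z zy]; first by rewrite mxE !eqxx mulr1 addr0.
  by rewrite mxE (negbTE zy) andbF mulr0.
rewrite /pol4.
under eq_bigr => a _.
  under eq_bigr => b _.
    under eq_bigr => c _.
      under eq_bigr => d _ do rewrite mulrA.
      rewrite (D l (fun d => w (idx4 a b c d) 0 * (delta_mx 0 i 0 a * delta_mx 0 j 0 b * delta_mx 0 k 0 c))).
      rewrite mulrA; over.
    rewrite (D k (fun c => w (idx4 a b c l) 0 * (delta_mx 0 i 0 a * delta_mx 0 j 0 b))) mulrA; over.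
  rewrite (D j (fun b => w (idx4 a b k l) 0 * (delta_mx 0 i 0 a))); over.
by rewrite (D i (fun a => w (idx4 a j k l) 0)).
Qed.

Lemma pol4_eq w w' : (forall p q r s, pol4 w p q r s = pol4 w' p q r s) -> w = w'.
Proof.
move=> h; apply/matrixP => m z; rewrite ord1.
by have [i [j [k [l ->]]]] := idx4_surj m; rewrite -!pol4_delta4.
Qed.

Lemma pol4_sum1 w (I : finType) (x : I -> K) (d : I -> 'rV_3) q r s :
  pol4 w (\sum_i x i *: d i) q r s = \sum_i x i * pol4 w (d i) q r s.
Proof.
have hZ y p : pol4 w (y *: p) q r s = y * pol4 w p q r s.
  by rewrite -[y *: p]addr0 -[0 in LHS](scale0r 0) pol4_lin1 mul0r addr0.
have hD p p' : pol4 w (p + p') q r s = pol4 w p q r s + pol4 w p' q r s.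
  by rewrite -[p in LHS]scale1r -[p' in LHS]scale1r pol4_lin1 !mul1r.
have h0 : pol4 w 0 q r s = 0 by rewrite -(scale0r 0) hZ mul0r.
by rewrite (big_morph (fun p => pol4 w p q r s) hD h0); apply: eq_bigr.
Qed.

Lemma pol4_sum2 w (I : finType) (x : I -> K) (d : I -> 'rV_3) q r s :
  pol4 w q (\sum_i x i *: d i) r s = \sum_i x i * pol4 w q (d i) r s.
Proof. by rewrite pol4C12 pol4_sum1; apply: eq_bigr => i _; rewrite pol4C12. Qed.
Lemma pol4_sum3 w (I : finType) (x : I -> K) (d : I -> 'rV_3) q r s :
  pol4 w q r (\sum_i x i *: d i) s = \sum_i x i * pol4 w q r (d i) s.
Proof. by rewrite pol4C23 pol4_sum2; apply: eq_bigr => i _; rewrite pol4C23. Qed.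
Lemma pol4_sum4 w (I : finType) (x : I -> K) (d : I -> 'rV_3) q r s :
  pol4 w q r s (\sum_i x i *: d i) = \sum_i x i * pol4 w q r s (d i).
Proof. by rewrite pol4C34 pol4_sum3; apply: eq_bigr => i _; rewrite pol4C34. Qed.

Lemma pol4_sum w (I : finType) (x y z t : I -> K) (d : I -> 'rV_3) :
  pol4 w (\sum_i x i *: d i) (\sum_i y i *: d i) (\sum_i z i *: d i) (\sum_i t i *: d i) =
  \sum_i \sum_j \sum_k \sum_l x i * y j * z k * t l * pol4 w (d i) (d j) (d k) (d l).
Proof.
rewrite pol4_sum1; apply: eq_bigr => i _.
rewrite pol4_sum2 mulr_sumr; apply: eq_bigr => j _.
rewrite pol4_sum3 !mulr_sumr; apply: eq_bigr => k _.
rewrite pol4_sum4 !mulr_sumr; apply: eq_bigr => l _.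
by ring.
Qed.

Lemma vandermonde_solve n (t : 'I_n -> K) (gam : nat -> K) : injective t ->
  exists c : 'I_n -> K, forall k, (k < n)%N -> gam k = \sum_i c i * t i ^+ k.
Proof.
move=> tinj; pose V := Vandermonde n (\row_i t i).
have uV : V \in unitmx.
  rewrite unitmxE det_Vandermonde unitfE; apply/prodf_neq0 => i _.
  apply/prodf_neq0 => j ij; rewrite !mxE subr_eq0.
  by apply/eqP => /tinj ji; move: ij; rewrite ji ltnn.
pose g := \col_(k < n) gam k.
exists (fun i => (invmx V *m g) i 0) => k kn.
have /matrixP/(_ (Ordinal kn) 0) := mulKVmx uV g; rewrite [RHS]mxE /= => <-.
by rewrite mxE; apply: eq_bigr => r _; rewrite [V _ _]mxE mxE mulrC.
Qed.
End Gamma.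

Section ConicParam.
Variables (A : comNzRingType) (p0 p1 p2 : 'rV[A]_3).
Definition nu (t : A) : 'rV[A]_3 := p0 + t *: p1 + t ^+ 2 *: p2.

Lemma det3_nu r s t :
  det3 (nu r) (nu s) (nu t) = det3 p0 p1 p2 * ((s - r) * (t - r) * (t - s)).
Proof. by rewrite !det3E !dot3E !vec3E /nu !mxE; ring. Qed.

Lemma det3_nu2 x y z s t :
  det3 (x *: p0 + y *: p1 + z *: p2) (nu s) (nu t) =
  det3 p0 p1 p2 * ((t - s) * (x * s * t - y * (s + t) + z)).
Proof. by rewrite !det3E !dot3E !vec3E /nu !mxE; ring. Qed.
End ConicParam.

Section Apolar.
Variables (K : numFieldType) (p0 p1 p2 : 'rV[K]_3) (q : 'I_6 -> K) (c : K).
Hypothesis D0 : det3 p0 p1 p2 != 0.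
Hypothesis c0 : c != 0.
Hypothesis qE : forall x y z, ev2 q (x *: p0 + y *: p1 + z *: p2) = c * (y ^+ 2 - x * z).
Variable w : 'cV[K]_15.
Hypothesis apo : forall k, pair15 w (sqv q (dirac K k)) = 0.
Let D := det3 p0 p1 p2.
Let d (i : nat) : 'rV[K]_3 := D^-1 *: nth 0 [:: cross p1 p2; cross p2 p0; cross p0 p1] i.
Let pp (i : nat) : 'rV[K]_3 := nth 0 [:: p0; p1; p2] i.

Lemma dual_basis p : p = \sum_(i < 3) dot3 p (pp i) *: d i.
Proof.
apply: (scalerI D0); rewrite cramer3 !big_ord_recl big_ord0 addr0 /d /= /pp /=.
rewrite !scalerDr !scalerA -/D addrA.
by congr (_ *: _ + _ *: _ + _ *: _); rewrite mulrAC divff // mul1r.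
Qed.

Lemma coord_basis b : b = dot3 b (d 0) *: p0 + dot3 b (d 1) *: p1 + dot3 b (d 2) *: p2.
Proof.
apply: (scalerI D0); rewrite cramer3' /d /= !scalerDr !scalerA.
have E x : dot3 b (D^-1 *: x) = D^-1 * dot3 b x by rewrite !dot3E !mxE; ring.
by rewrite !E !mulrA divff // !mul1r.
Qed.

(** In the coordinates dual to p0, p1, p2 the form d1^2 - d0 d2 is Q / c, so the difference of the
    two sides pairs w with a multiple of Q. *)
Lemma apolar_rel r s : pol4 w (d 1) (d 1) r s = pol4 w (d 0) (d 2) r s.
Proof.
apply/eqP; rewrite -subr_eq0; apply/eqP; rewrite !(pol4_delta w) -pair15Br.
set h := _ - _.
pose rs := conic_coord (linform r * linform s).
have rsE b : ev2 rs b = dot3 b r * dot3 b s.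
  rewrite ev2_conic_coord; first by rewrite mevalM !meval_linform !(dot3C b).
  by rewrite -[2%N]/(1 + 1)%N; apply: dhomogM; apply: linform_homog.
have -> : h = c^-1 *: sqv q rs.
  apply: ver4_eq => b; rewrite pair15Br -!pol4_delta !pol4_ver4 pair15Zr pair15_sqv rsE.
  by rewrite [in ev2 q b](coord_basis b) qE mulrA mulKf //; ring.
rewrite pair15Zr sqv_sumr pair15_sumr big1 ?mulr0 // => k _.
by rewrite apo mulr0.
Qed.

(** Any nodes and weights with the same nine moments represent the quartic. This is used twice: with
    nine fixed nodes, and with the five roots of a quintic. *)
Lemma apolar_gamma : exists gam : nat -> K, forall n (t c : 'I_n -> K),
  (forall k, (k < 9)%N -> gam k = \sum_r c r * t r ^+ k) ->
  w = \sum_r c r *: ver4 (nu p0 p1 p2 (t r)).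
Proof.
have [||||gam gamE] := @sym4_gamma K (fun i j k l => pol4 w (d i) (d j) (d k) (d l)).
- by move=> *; rewrite pol4C12.
- by move=> *; rewrite pol4C23.
- by move=> *; rewrite pol4C34.
- by move=> *; apply: apolar_rel.
exists gam => n t e ge; apply: pol4_eq => a b x y.
rewrite pol4_sumu.
have dnu p r : dot3 (nu p0 p1 p2 (t r)) p = \sum_(i < 3) dot3 p (pp i) * t r ^+ i.
  rewrite !big_ord_recl big_ord0 /pp /= !dot3E /nu !mxE /bump /= expr0 expr1; ring.
under [RHS]eq_bigr => r _ do rewrite pol4_ver4 !dnu.
rewrite {1}(dual_basis a) {1}(dual_basis b) {1}(dual_basis x) {1}(dual_basis y).
rewrite pol4_sum.
have X (F : 'I_3 -> 'I_3 -> 'I_3 -> 'I_3 -> 'I_n -> K) :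
    \sum_i \sum_j \sum_k \sum_l \sum_r F i j k l r =
    \sum_r \sum_i \sum_j \sum_k \sum_l F i j k l r.
  rewrite [RHS]exchange_big; apply: eq_bigr => i _.
  rewrite [RHS]exchange_big; apply: eq_bigr => j _.
  rewrite [RHS]exchange_big; apply: eq_bigr => k _.
  by rewrite [RHS]exchange_big.
transitivity (\sum_(i < 3) \sum_(j < 3) \sum_(k < 3) \sum_(l < 3) \sum_r
   dot3 a (pp i) * dot3 b (pp j) * dot3 x (pp k) * dot3 y (pp l) * (e r * t r ^+ (i + j + k + l))).
  apply: eq_bigr => i _; apply: eq_bigr => j _; apply: eq_bigr => k _; apply: eq_bigr => l _.
  rewrite -mulr_sumr gamE // ge //.
  by move: (ltn_ord i) (ltn_ord j) (ltn_ord k) (ltn_ord l); lia.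
rewrite X; apply: eq_bigr => r _ /=.
rewrite prod_sum4 [RHS]mulr_sumr; apply: eq_bigr => i _.
rewrite [RHS]mulr_sumr; apply: eq_bigr => j _.
rewrite [RHS]mulr_sumr; apply: eq_bigr => k _.
rewrite [RHS]mulr_sumr; apply: eq_bigr => l _.
by rewrite !exprD; ring.
Qed.
End Apolar.

Lemma natr_notin (K : numFieldType) (s : seq K) : exists n, n%:R \notin s.
Proof.
have [h|/allPn[x /mapP[n _ ->] hn]] := boolP (all (mem s) [seq n%:R | n <- iota 0 (size s).+1]).
  have u : uniq [seq n%:R : K | n <- iota 0 (size s).+1].
    by rewrite map_inj_uniq ?iota_uniq // => i j /eqP; rewrite eqr_nat => /eqP.
  have := uniq_leq_size u (allP h); rewrite size_map size_iota ltnn; by [].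
by exists n.
Qed.

(** * Binary octics as sums of five eighth powers (Sylvester) *)

Section Hankel.
Variables (K : numClosedFieldType) (gam : nat -> K).
Definition hankel : 'M[K]_5 := \matrix_(i, j) gam (i + j)%N.
(** The value at s^a p(s) of the functional sending s^k to [gam k]; six terms are enough for
    quintics. *)
Definition hank a (p : {poly K}) : K := \sum_(b < 6) gam (a + b)%N * p`_b.

Lemma hankD a (p q : {poly K}) : hank a (p + q) = hank a p + hank a q.
Proof. by rewrite /hank -big_split; apply: eq_bigr => b _; rewrite coefD mulrDr. Qed.
Lemma hankZ a c (p : {poly K}) : hank a (c *: p) = c * hank a p.
Proof. by rewrite /hank mulr_sumr; apply: eq_bigr => b _; rewrite coefZ mulrCA. Qed.

Lemma hank_size5 a (p : {poly K}) : (size p <= 5)%N -> hank a p = \sum_(b < 5) gam (a + b)%N * p`_b.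
Proof. by move=> sp; rewrite /hank big_ord_recr /= [p`_5]nth_default // mulr0 addr0. Qed.

Lemma hankel_mul (p : {poly K}) (i : 'I_5) : (size p <= 5)%N ->
  (hankel *m \col_b p`_b) i 0 = hank i p.
Proof. by move=> sp; rewrite hank_size5 // mxE; apply: eq_bigr => b _; rewrite !mxE. Qed.

Lemma hank_shift a z (p : {poly K}) : (size p <= 5)%N ->
  hank a (('X - z%:P) * p) = hank a.+1 p - z * hank a p.
Proof.
move=> sp; rewrite [hank a.+1 p]hank_size5 // [hank a p]hank_size5 //.
rewrite /hank; under eq_bigr => b _ do rewrite mulrBl coefB coefXM coefCM mulrBr.
rewrite sumrB; congr (_ - _).
  rewrite big_ord_recl /= mulr0 add0r; apply: eq_bigr => b _.
  by rewrite /bump /= add1n addnS.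
rewrite big_ord_recr /= [p`_5]nth_default // !mulr0 addr0 mulr_sumr.
by apply: eq_bigr => b _; rewrite mulrCA.
Qed.

Hypothesis H0 : \det hankel != 0.
Let uH : hankel \in unitmx. Proof. by rewrite unitmxE unitfE. Qed.

Lemma hankel_eq0 (p : {poly K}) : (size p <= 5)%N -> (forall i, (i < 5)%N -> hank i p = 0) -> p = 0.
Proof.
move=> sp h; have E : \col_(b < 5) p`_b = 0.
  rewrite -[LHS](mulKmx uH); have -> : hankel *m \col_(b < 5) p`_b = 0; last by rewrite mulmx0.
  by apply/matrixP => i j; rewrite ord1 hankel_mul // h // mxE.
apply/polyP => b; rewrite coef0; have [hb|hb] := ltnP b 5; last first.
  by rewrite nth_default // (leq_trans sp).
by have /matrixP/(_ (Ordinal hb) 0) := E; rewrite !mxE.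
Qed.

Lemma hankel_solve (h : nat -> K) : exists2 p : {poly K}, (size p <= 5)%N &
  forall i, (i < 5)%N -> hank i p = h i.
Proof.
pose v := invmx hankel *m \col_(i < 5) h i.
exists (\poly_(b < 5) v (inord b) 0); first exact: size_poly.
move=> i hi; rewrite -(hankel_mul (Ordinal hi)) ?size_poly //.
have -> : \col_(b < 5) (\poly_(b0 < 5) v (inord b0) 0)`_b = v.
  by apply/matrixP => b j; rewrite ord1 mxE coef_poly ltn_ord inord_val.
by rewrite /v mulKVmx // mxE.
Qed.

Lemma geometric (z : K) (p : {poly K}) : (forall a, (a < 4)%N -> hank a.+1 p - z * hank a p = 0) ->
  forall a, (a < 5)%N -> hank a p = z ^+ a * hank 0 p.
Proof.
move=> h; elim=> [|a IH] ha; first by rewrite mul1r.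
by have /eqP := h a ha; rewrite subr_eq0 => /eqP->; rewrite IH ?exprS ?mulrA // ltnW.
Qed.

(* The octic is killed by the monic quintics of the pencil D1 + lambda D0, which has
   no base point; a general member is therefore separable. *)
Lemma octic_pencil : exists D0 D1 : {poly K},
  [/\ D0 != 0, (size D0 <= 5)%N, D1 \is monic /\ size D1 = 6%N,
      forall a, (a < 4)%N -> hank a D0 = 0 /\ hank a D1 = 0 &
      forall z, ~~ (root D0 z && root D1 z)].
Proof.
(* Both polynomials have to be killed for a < 4. [D0] is the solution with only the last moment
   nonzero, and [p] corrects X^5; the value 0 prescribed for it at a = 4 is an arbitrary choice. *)
have [D0 s0 h0] := hankel_solve (fun a => (a == 4%N)%:R).
have [p sp hp] := hankel_solve (fun a => if a == 4%N then 0 else - gam (a + 5)%N).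
pose D1 := 'X^5 + p; have sD1 : size D1 = 6%N by rewrite size_addl size_polyXn // ltnS.
have hX a : hank a 'X^5 = gam (a + 5)%N.
  rewrite /hank big_ord_recr /= coefXn eqxx mulr1 big1 ?add0r // => b _.
  by rewrite coefXn /= ltn_eqF ?mulr0 //; apply: ltn_ord.
have D0n : D0 != 0.
  apply/eqP => D00; have := h0 4%N isT; rewrite D00 /hank big1 => [/eqP|b _].
    by rewrite eq_sym oner_eq0.
  by rewrite coef0 mulr0.
have hD a : (a < 4)%N -> hank a D0 = 0 /\ hank a D1 = 0.
  move=> ha; have ha5 := leqW ha; have a4 := ltn_eqF ha; split; first by rewrite (h0 a ha5) a4.
  by rewrite hankD hX (hp a ha5) a4 subrr.
have mD1 : D1 \is monic by rewrite monicE lead_coefDl ?lead_coefXn // size_polyXn ltnS.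
exists D0, D1; split=> // z; apply/negP => /andP[].
move=> /factor_theorem[E0 E0E] /factor_theorem[E1 E1E].
have Xz := polyXsubC_eq0 z; have E00 : E0 != 0 by apply: contra D0n => /eqP E; rewrite E0E E mul0r.
have sE0 : (size E0 <= 4)%N.
  by move: s0; rewrite E0E size_mul ?Xz // size_XsubC addn2.
have E10 : E1 != 0.
  by apply: contraTN mD1 => /eqP E; rewrite E1E E mul0r monicE lead_coef0 eq_sym oner_eq0.
have sE1 : size E1 = 5%N.
  by move: sD1; rewrite E1E size_mul ?Xz // size_XsubC addn2 => -[].
have mE1 : E1 \is monic by move: mD1; rewrite E1E monicMr ?monicXsubC.
have g0 : forall a, (a < 5)%N -> hank a E0 = z ^+ a * hank 0 E0.
  apply: geometric => a ha; rewrite -hank_shift ?(leq_trans sE0) // mulrC -E0E.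
  by case: (hD a ha).
have g1 : forall a, (a < 5)%N -> hank a E1 = z ^+ a * hank 0 E1.
  apply: geometric => a ha; rewrite -hank_shift ?sE1 // mulrC -E1E.
  by case: (hD a ha).
(* At a common root z the moments of both cofactors are geometric of ratio z, so this combination
   has none and is zero. As E1 has degree 4 and E0 a smaller one, the coefficient of E1 vanishes,
   and then so does E0. *)
pose P := hank 0 E1 *: E0 + (- hank 0 E0) *: E1.
have P0 : P = 0.
  apply: hankel_eq0 => [|i hi].
    apply: leq_trans (size_polyD _ _) _; rewrite geq_max.
    by rewrite !(leq_trans (size_scale_leq _ _)) ?sE1 // (leq_trans sE0).
  by rewrite hankD !hankZ (g0 i) // (g1 i) //; ring.
have e0 : hank 0 E0 = 0.
  have := congr1 (fun p : {poly K} => p`_4) P0.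
  rewrite /P coefD !coefZ coef0 [E0`_4]nth_default // mulr0 add0r.
  have -> : E1`_4 = 1 by move/monicP: mE1; rewrite lead_coefE sE1.
  by rewrite mulr1 => /eqP; rewrite oppr_eq0 => /eqP.
move/eqP: E00; apply; apply: hankel_eq0 => [|i hi]; first exact: leq_trans sE0 _.
by rewrite (g0 i) // e0 mulr0.
Qed.

Lemma octic_separable : exists2 rs : seq K, uniq rs & size rs = 5%N /\
  forall a, (a < 4)%N -> hank a (\prod_(z <- rs) ('X - z%:P)) = 0.
Proof.
have [D0 [D1 [D0n s0 [mD1 sD1] hD base]]] := octic_pencil.
(* A multiple root a of D1 + lambda D0 is a root of this Wronskian, and lambda = - D1(a) / D0(a):
   only finitely many lambda are excluded. W is nonzero, for otherwise D1, being coprime to D0,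
   would divide its own derivative. *)
pose W := D1 * D0^`() - D1^`() * D0.
have W0 : W != 0.
  apply/negP; rewrite subr_eq0 => /eqP E.
  have cop : coprimep D1 D0.
    apply: Pdiv.ClosedField.root_coprimep => x r1.
    by have := base x; rewrite r1 andbT.
  have : D1 %| D1^`() * D0 by rewrite -E dvdp_mulr.
  rewrite Gauss_dvdpl // => /dvdp_leq.
  have s1 : (size D1^`() < size D1)%N by rewrite lt_size_deriv // -size_poly_gt0 sD1.
  rewrite leqNgt s1 => /(_ _)/notF; apply.
  apply/eqP => /(congr1 (fun p : {poly K} => p`_4)); rewrite coef_deriv coef0 => /eqP.
  have -> : D1`_5 = 1 by move/monicP: mD1; rewrite lead_coefE sD1.
  by rewrite pnatr_eq0.
have [ws WE] := closed_field_poly_normal W.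
have [n hn] := natr_notin [seq - D1.[a] / D0.[a] | a <- ws].
pose D := D1 + n%:R *: D0.
have sD : size D = 6%N.
  by rewrite size_addl ?sD1 // ltnS (leq_trans (size_scale_leq _ _)).
have mD : D \is monic.
  rewrite monicE lead_coefDl ?(monicP mD1) // sD1 ltnS.
  by rewrite (leq_trans (size_scale_leq _ _)).
have [rs DE] := closed_field_poly_normal D.
rewrite (monicP mD) scale1r in DE.
exists rs; last first.
  split; first by move: sD; rewrite DE size_prod_XsubC => -[].
  by move=> a /hD[h0 h1]; rewrite -DE hankD hankZ h0 h1 mulr0 addr0.
rewrite -separable_prod_XsubC -DE separable_poly.unlock.
apply: Pdiv.ClosedField.root_coprimep => a /rootP Da; apply/eqP => D'a.
rewrite /D derivD derivZ !hornerE in Da D'a.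
have aW : a \in ws.
  have : root W a.
    apply/rootP; rewrite /W !hornerE.
    have -> : D1.[a] = - (n%:R * D0.[a]) by apply/eqP; rewrite -addr_eq0 Da.
    have -> : D1^`().[a] = - (n%:R * D0^`().[a]) by apply/eqP; rewrite -addr_eq0 D'a.
    by ring.
  by rewrite WE rootZ ?lead_coef_eq0 // root_prod_XsubC.
have D0a : D0.[a] != 0.
  apply: contra (base a) => /eqP D0a; rewrite /root D0a eqxx /=.
  by move: Da; rewrite D0a mulr0 addr0 => ->.
move/negP: hn; apply; apply/mapP; exists a => //.
by apply: (mulIf D0a); rewrite divfK //; apply/eqP; rewrite -addr_eq0 addrC Da.
Qed.

(** A Vandermonde system fits the first five moments; the separable quintic is a recurrence
    satisfied by [gam] and by the powers of its roots, which gives the other four. The weights are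
    nonzero because the Hankel matrix factors through their diagonal matrix. *)
Lemma octic_decomp : exists t c : 'I_5 -> K, [/\ injective t, forall r, c r != 0 &
  forall k, (k < 9)%N -> gam k = \sum_r c r * t r ^+ k].
Proof.
have [rs U [s5 hrs]] := octic_separable.
pose t (i : 'I_5) := rs`_i.
have tinj : injective t.
  by move=> i j /eqP; rewrite nth_uniq ?s5 // => /eqP/val_inj.
have [c cE] := vandermonde_solve gam tinj.
have cE9 k : (k < 9)%N -> gam k = \sum_r c r * t r ^+ k.
  elim/ltn_ind: k => k IH hk; have [/cE//|k5] := ltnP k 5.
  pose a := (k - 5)%N; have kE : k = (a + 5)%N by rewrite subnK.
  have a4 : (a < 4)%N by rewrite -(ltn_add2r 5) -kE.
  have := hrs a a4; set D := \prod_(z <- rs) _.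
  have D5 : D`_5 = 1.
    have /monicP := monic_prod_XsubC rs xpredT id; rewrite -/D lead_coefE.
    by rewrite size_prod_XsubC s5.
  rewrite /hank big_ord_recr /= D5 mulr1 -kE => /eqP; rewrite addrC addr_eq0 => /eqP->.
  have E r : t r ^+ k = - \sum_(b < 5) t r ^+ (a + b) * D`_b.
    have : D.[t r] = 0.
      by apply/rootP; rewrite root_prod_XsubC mem_nth // s5.
    rewrite horner_coef size_prod_XsubC s5 big_ord_recr /= D5 mul1r => /eqP.
    rewrite addrC addr_eq0 => /eqP E; rewrite kE exprD E mulrN mulr_sumr; congr (- _).
    by apply: eq_bigr => b _; rewrite exprD; ring.
  under [RHS]eq_bigr => r _ do rewrite E mulrN mulr_sumr.
  rewrite sumrN exchange_big; congr (- _); apply: eq_bigr => b _.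
  rewrite IH; last 2 first.
  - by rewrite kE ltn_add2l.
  - by rewrite (leq_trans _ hk) // ltnS kE leq_add2l ltnW.
  by rewrite mulr_suml; apply: eq_bigr => r _; rewrite mulrA.
exists t, c; split=> // r; apply: contra H0 => /eqP cr.
pose T := \matrix_(i < 5, j < 5) t j ^+ i.
have -> : hankel = T *m diag_mx (\row_i c i) *m T^T.
  apply/matrixP => i j; rewrite !mxE cE9; last by move: (ltn_ord i) (ltn_ord j); lia.
  apply: eq_bigr => s _; rewrite mul_mx_diag !mxE exprD; ring.
rewrite !det_mulmx det_diag (bigD1 r) //= mxE cr !(mul0r, mulr0) //.
Qed.
End Hankel.

Lemma sum4_sym (V : zmodType) (F : nat -> nat -> nat -> nat -> V) :
  (forall i j k l, F i j k l = F j i k l) -> (forall i j k l, F i j k l = F i k j l) ->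
  (forall i j k l, F i j k l = F i j l k) -> (forall i k l, F i i k l = 0) ->
  \sum_(i < 4) \sum_(j < 4) \sum_(k < 4) \sum_(l < 4) F i j k l = F 0%N 1%N 2%N 3%N *+ 24.
Proof.
move=> C12 C23 C34 V12.
have V23 i j l : F i j j l = 0 by rewrite C12 C23 V12.
have V34 i j k : F i j k k = 0 by rewrite C23 C34 V23.
have S12 i j k l : F i j k l = F (minn i j) (maxn i j) k l.
  by case: (leqP i j) => _; rewrite // C12.
have S23 i j k l : F i j k l = F i (minn j k) (maxn j k) l.
  by case: (leqP j k) => _; rewrite // C23.
have S34 i j k l : F i j k l = F i j (minn k l) (maxn k l).
  by case: (leqP k l) => _; rewrite // C34.
have E i j k l : (i < 4 -> j < 4 -> k < 4 -> l < 4 ->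
    F i j k l = F 0 1 2 3 *+ uniq [:: i; j; k; l])%N.
  by move: i j k l; do 4 (case=> [|[|[|[|//]]]]); move=> _ _ _ _;
    rewrite [LHS]S12 [LHS]S23 [LHS]S34 [LHS]S12 [LHS]S23 [LHS]S12 /= ?V12 ?V23 ?V34.
transitivity (\sum_(i < 4) \sum_(j < 4) \sum_(k < 4) \sum_(l < 4)
    F 0%N 1%N 2%N 3%N *+ uniq [:: nat_of_ord i; nat_of_ord j; nat_of_ord k; nat_of_ord l]).
  by do 4 (apply: eq_bigr => ? _); rewrite E.
under eq_bigr => i _ do under eq_bigr => j _ do under eq_bigr => k _ do rewrite sumrMnr.
under eq_bigr => i _ do under eq_bigr => j _ do rewrite sumrMnr.
under eq_bigr => i _ do rewrite sumrMnr.
rewrite sumrMnr; congr (_ *+ _).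
have S4 (G : nat -> nat) : (\sum_(i < 4) G i = G 0 + G 1 + G 2 + G 3)%N.
  by rewrite !big_ord_recr big_ord0.
under eq_bigr => i _ do under eq_bigr => j _ do under eq_bigr => k _ do
  rewrite (S4 (fun l => uniq [:: i : nat; j : nat; k : nat; l])).
under eq_bigr => i _ do under eq_bigr => j _ do
  rewrite (S4 (fun k => uniq [:: i : nat; j : nat; k : nat; 0] +
    uniq [:: i : nat; j : nat; k : nat; 1] + uniq [:: i : nat; j : nat; k : nat; 2] +
    uniq [:: i : nat; j : nat; k : nat; 3]))%N.
by rewrite !big_ord_recr !big_ord0.
Qed.

(** * The Scorza quartic of a sum of five fourth powers *)

Definition vdm5 (A : comNzRingType) (t0 t1 t2 t3 t4 : A) : A :=
  (t1 - t0) * (t2 - t0) * (t3 - t0) * (t4 - t0) * (t2 - t1) * (t3 - t1) * (t4 - t1)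
  * (t3 - t2) * (t4 - t2) * (t4 - t3).
Definition vdm4 (A : comNzRingType) (t0 t1 t2 t3 : A) : A :=
  (t1 - t0) * (t2 - t0) * (t3 - t0) * (t2 - t1) * (t3 - t1) * (t3 - t2).

Section Identity.
Variables (A : comNzRingType) (x y z : A).
(* B s t = 0 iff the line joining nu s and nu t passes through (x, y, z). *)
Definition bip (s t : A) := x * s * t - y * (s + t) + z.
Let B := bip.

(** After division by [vdm5] this says that the sum over k of the products over j <> k of B(t_j,
    t_k) / (t_j - t_k) equals (y^2 - x z)^2, whatever the five parameters. *)
Lemma vdm_bip t0 t1 t2 t3 t4 :
  vdm4 t1 t2 t3 t4 * (B t1 t0 * B t2 t0 * B t3 t0 * B t4 t0)
  - vdm4 t0 t2 t3 t4 * (B t0 t1 * B t2 t1 * B t3 t1 * B t4 t1)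
  + vdm4 t0 t1 t3 t4 * (B t0 t2 * B t1 t2 * B t3 t2 * B t4 t2)
  - vdm4 t0 t1 t2 t4 * (B t0 t3 * B t1 t3 * B t2 t3 * B t4 t3)
  + vdm4 t0 t1 t2 t3 * (B t0 t4 * B t1 t4 * B t2 t4 * B t3 t4)
  = vdm5 t0 t1 t2 t3 t4 * (y ^+ 2 - x * z) ^+ 2.
Proof. rewrite /vdm4 /vdm5 /B /bip; ring. Qed.

Lemma vdm_bip2 t0 t1 t2 t3 t4 :
  vdm4 t1 t2 t3 t4 ^+ 2 * ((t0 - t1) * B t1 t0 * ((t0 - t2) * B t2 t0) *
     ((t0 - t3) * B t3 t0) * ((t0 - t4) * B t4 t0))
  + vdm4 t0 t2 t3 t4 ^+ 2 * ((t1 - t0) * B t0 t1 * ((t1 - t2) * B t2 t1) *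
     ((t1 - t3) * B t3 t1) * ((t1 - t4) * B t4 t1))
  + vdm4 t0 t1 t3 t4 ^+ 2 * ((t2 - t0) * B t0 t2 * ((t2 - t1) * B t1 t2) *
     ((t2 - t3) * B t3 t2) * ((t2 - t4) * B t4 t2))
  + vdm4 t0 t1 t2 t4 ^+ 2 * ((t3 - t0) * B t0 t3 * ((t3 - t1) * B t1 t3) *
     ((t3 - t2) * B t2 t3) * ((t3 - t4) * B t4 t3))
  + vdm4 t0 t1 t2 t3 ^+ 2 * ((t4 - t0) * B t0 t4 * ((t4 - t1) * B t1 t4) *
     ((t4 - t2) * B t2 t4) * ((t4 - t3) * B t3 t4))
  = (vdm5 t0 t1 t2 t3 t4 * (y ^+ 2 - x * z)) ^+ 2.
Proof.
transitivity (vdm5 t0 t1 t2 t3 t4 * (vdm5 t0 t1 t2 t3 t4 * (y ^+ 2 - x * z) ^+ 2)); last by ring.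
rewrite -vdm_bip; move: (B) => B'; rewrite !mulrDr !mulrN.
by congr (_ + _ + _ + _ + _); rewrite /vdm4 /vdm5; ring.
Qed.
End Identity.

Section Aronhold.
Variables (A : comNzRingType) (I : finType) (x : I -> A) (l : I -> 'rV[A]_3).

(** The symbolic expression of the Aronhold invariant evaluated at four linear forms. *)
Definition quad4 (a b c d : 'rV[A]_3) : A :=
  det3 a b c * det3 a b d * det3 a c d * det3 b c d.

Lemma det3_perm (a b c : 'rV[A]_3) :
  det3 a b c = \sum_(s : 'S_3) (-1) ^+ s * (a 0 (s 0) * b 0 (s 1) * c 0 (s 2)).
Proof.
apply: eq_bigr => s _; rewrite !big_ord_recl big_ord0 mulr1 !mxE !mulrA.
by congr (_ * a 0 (s _) * b 0 (s _) * c 0 (s _)); apply: val_inj.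
Qed.

Lemma aronhold_prod (es et eu ev xa xb xc xd s0 t0 u0 s1 t1 v0 s2 u1 v1 t2 u2 v2 : A) :
  es * et * eu * ev * (xa * (s0 * t0 * u0) * (xb * (s1 * t1 * v0)) *
    (xc * (s2 * u1 * v1)) * (xd * (t2 * u2 * v2))) =
  xa * xb * xc * xd * (es * (s0 * s1 * s2) * (et * (t0 * t1 * t2)) *
    (eu * (u0 * u1 * u2)) * (ev * (v0 * v1 * v2))).
Proof. by ring. Qed.

Lemma aronhold_sum (F : {mpoly A[3]}) :
  (forall i j k, tensor3 F i j k = \sum_r x r * (l r 0 i * l r 0 j * l r 0 k)) ->
  aronhold F = \sum_a \sum_b \sum_c \sum_d
    x a * x b * x c * x d * quad4 (l a) (l b) (l c) (l d).
Proof.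
move=> hF; rewrite /aronhold.
pose G (s t u v : 'S_3) a b c d : A := (-1) ^+ s * (-1) ^+ t * (-1) ^+ u * (-1) ^+ v *
  (x a * (l a 0 (s 0) * l a 0 (t 0) * l a 0 (u 0)) *
   (x b * (l b 0 (s 1) * l b 0 (t 1) * l b 0 (v 0))) *
   (x c * (l c 0 (s 2) * l c 0 (u 1) * l c 0 (v 1))) *
   (x d * (l d 0 (t 2) * l d 0 (u 2) * l d 0 (v 2)))).
transitivity (\sum_s \sum_t \sum_u \sum_v \sum_a \sum_b \sum_c \sum_d G s t u v a b c d).
  apply: eq_bigr => s _; apply: eq_bigr => t _; apply: eq_bigr => u _; apply: eq_bigr => v _.
  rewrite !hF prod_sum4 mulr_sumr; apply: eq_bigr => a _.
  rewrite mulr_sumr; apply: eq_bigr => b _; rewrite mulr_sumr; apply: eq_bigr => c _.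
  by rewrite mulr_sumr.
have X (H : 'S_3 -> 'S_3 -> 'S_3 -> 'S_3 -> I -> A) :
    \sum_s \sum_t \sum_u \sum_v \sum_a H s t u v a =
    \sum_a \sum_s \sum_t \sum_u \sum_v H s t u v a.
  rewrite [RHS]exchange_big; apply: eq_bigr => s _.
  rewrite [RHS]exchange_big; apply: eq_bigr => t _.
  rewrite [RHS]exchange_big; apply: eq_bigr => u _.
  by rewrite [RHS]exchange_big.
rewrite X; apply: eq_bigr => a _; rewrite X; apply: eq_bigr => b _.
rewrite X; apply: eq_bigr => c _; rewrite X; apply: eq_bigr => d _.
rewrite /quad4 !det3_perm prod_sum4 [RHS]mulr_sumr; apply: eq_bigr => s _.
rewrite [RHS]mulr_sumr; apply: eq_bigr => t _.
rewrite [RHS]mulr_sumr; apply: eq_bigr => u _.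
rewrite [RHS]mulr_sumr; apply: eq_bigr => v _.
exact: aronhold_prod.
Qed.
End Aronhold.

Section Scorza.
Variables (K : numFieldType) (I : finType) (c : I -> K) (l : I -> 'rV[K]_3).
Let w := \sum_r c r *: ver4 (l r).
Let g := quartic_of w.

Lemma quartic_of_sum : g = \sum_r c r *: linform (l r) ^+ 4.
Proof.
transitivity (quartic_of (fbar (\sum_r c r *: linform (l r) ^+ 4))).
  congr quartic_of; rewrite /w; apply/matrixP => i j; rewrite !mxE summxE /ncoef raddf_sum /=.
  rewrite mulr_suml; apply: eq_bigr => r _.
  by rewrite mxE -fbar_pow4 [in LHS]mxE mcoeffZ mulrA.
rewrite quartic_of_fbar //; apply: rpred_sum => r _; apply: rpredZ.
by rewrite -[4%N]mul1n; apply: dhomogMn; apply: linform_homog.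
Qed.

Lemma tensor3_polar (p : 'rV[K]_3) i j k : tensor3 (polar (p 0) g) i j k =
  \sum_r (24%:R * c r * dot3 (l r) p) * (l r 0 i * l r 0 j * l r 0 k).
Proof.
rewrite /tensor3 /polar quartic_of_sum.
have E m : (\sum_r c r *: linform (l r) ^+ 4)^`M(m) =
    \sum_r (c r * (4%:R * l r 0 m)) *: linform (l r) ^+ 3.
  by rewrite raddf_sum; apply: eq_bigr => r _; rewrite /= mderivZ mderiv_linform_exp scalerA.
have -> : \sum_m p 0 m *: (\sum_r c r *: linform (l r) ^+ 4)^`M(m) =
    \sum_r (4%:R * c r * dot3 (l r) p) *: linform (l r) ^+ 3.
  under eq_bigr => m _ do rewrite E scaler_sumr.
  rewrite exchange_big; apply: eq_bigr => r _.
  rewrite /dot3 mulr_sumr scaler_suml; apply: eq_bigr => m _.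
  by rewrite scalerA; congr (_ *: _); ring.
have D m (P : I -> {mpoly K[3]}) : (\sum_r P r)^`M(m) = \sum_r (P r)^`M(m).
  exact: raddf_sum.
rewrite !D raddf_sum; apply: eq_bigr => r _ /=.
rewrite !mderivZ mderiv_linform_exp !mderivZ mderiv_linform_exp !mderivZ mderiv_linform_exp.
by rewrite !mcoeffZ expr0 mcoeff1 eqxx mulr1; ring.
Qed.

Lemma scorza_sum (p : 'rV[K]_3) : (scorza g).@[p 0] = \sum_i \sum_j \sum_k \sum_m
   (24%:R * c i * dot3 (l i) p) * (24%:R * c j * dot3 (l j) p) *
   (24%:R * c k * dot3 (l k) p) * (24%:R * c m * dot3 (l m) p)
   * quad4 (l i) (l j) (l k) (l m).
Proof. by rewrite scorzaE; apply: aronhold_sum => i j k; apply: tensor3_polar. Qed.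
End Scorza.

Lemma scorza_homog (K : numFieldType) (g : {mpoly K[3]}) : scorza g \is 4.-homog.
Proof.
have T i j k : tensor3 (polar (fun i => 'X_i) (map_mpoly (@mpolyC 3 K) g)) i j k \is 1.-homog.
  have D m (P : 'I_3 -> {mpoly {mpoly K[3]}[3]}) : (\sum_r P r)^`M(m) = \sum_r (P r)^`M(m).
    exact: raddf_sum.
  rewrite /tensor3 /polar !D raddf_sum; apply: rpred_sum => m _ /=.
  rewrite !mderivZ mcoeffZ !mcoeff_deriv mcoeff_map_mpoly /= -!mpolyCMn mulrC mul_mpolyC.
  by apply: rpredZ; rewrite dhomogX /= mdeg1.
rewrite /scorza /aronhold; do 4 (apply: rpred_sum => ? _).
have hS (b : bool) (P : {mpoly K[3]}) : P \is 4.-homog -> (-1) ^+ b * P \is 4.-homog.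
  by rewrite mulr_sign; case: b => //; rewrite dhomogN.
rewrite -!mulrA; do 4! refine (hS _ _ _); rewrite -[4%N]/(1 + (1 + (1 + 1)))%N.
by do 3! (apply: dhomogM; first exact: T); exact: T.
Qed.

Section NuIdentities.
Variables (A : comNzRingType) (p0 p1 p2 : 'rV[A]_3).
Let D := det3 p0 p1 p2.
Let n := nu p0 p1 p2.

Lemma quad4_nu a b c d : quad4 (n a) (n b) (n c) (n d) = D ^+ 4 * vdm4 a b c d ^+ 2.
Proof. by rewrite /quad4 !det3_nu -/D /vdm4; ring. Qed.

Lemma dot3_cross_nu x y z s t (a := x *: p0 + y *: p1 + z *: p2) :
  dot3 (n s) (cross a (n t)) = - (D * ((t - s) * bip x y z s t)).
Proof.
rewrite -det3_nu2 -/a -/(n s) -/(n t) !det3E; move: a (n s) (n t) => a b c.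
by rewrite !dot3E !vec3E; ring.
Qed.

Lemma dot3_cross_p2 x y z t (a := x *: p0 + y *: p1 + z *: p2) :
  dot3 p2 (cross a (n t)) = D * (x * t - y).
Proof. by rewrite /D /a /n /nu det3E !dot3E !vec3E !mxE; ring. Qed.
End NuIdentities.

Lemma sum5E (V : zmodType) (F : nat -> V) :
  \sum_(r < 5) F r = F 0%N + F 1%N + F 2%N + F 3%N + F 4%N.
Proof. by rewrite !big_ord_recr big_ord0 /= add0r. Qed.

Lemma sum_lift (V : zmodType) (k : 'I_5) (F : nat -> V) : F k = 0 ->
  \sum_(r < 5) F r = \sum_(r < 4) F (bump k r).
Proof. by move=> Fk; rewrite (bigD1_ord k) //= Fk add0r. Qed.

Section FivePowers.
Variables (K : numFieldType) (p0 p1 p2 : 'rV[K]_3) (t c : nat -> K).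
Let D := det3 p0 p1 p2.
Let l r := nu p0 p1 p2 (t r).
Let w := \sum_(r < 5) c r *: ver4 (l r).
Let S := scorza (quartic_of w).

(** At a point of the line l_k the polar cubic is a sum of only four cubes, so its Aronhold
    invariant is one bracket counted 4! times. The constants: 24^4 from the derivatives and 24 from
    the orderings; D^4 from the bracket and D^4 from the four values of the linear forms. *)
Lemma scorza_cross x y z (k : 'I_5) (a := x *: p0 + y *: p1 + z *: p2) :
  S.@[cross a (l k) 0] = 24%:R ^+ 5 * D ^+ 8 *
    (c (bump k 0) * c (bump k 1) * c (bump k 2) * c (bump k 3)) *
    vdm4 (t (bump k 0)) (t (bump k 1)) (t (bump k 2)) (t (bump k 3)) ^+ 2 *
    (((t k - t (bump k 0)) * bip x y z (t (bump k 0)) (t k)) *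
     ((t k - t (bump k 1)) * bip x y z (t (bump k 1)) (t k)) *
     ((t k - t (bump k 2)) * bip x y z (t (bump k 2)) (t k)) *
     ((t k - t (bump k 3)) * bip x y z (t (bump k 3)) (t k))).
Proof.
rewrite /S /w (scorza_sum (fun r : 'I_5 => c r) (fun r : 'I_5 => l r)).
pose X i := 24%:R * c i * dot3 (l i) (cross a (l k)).
pose F i j m n := X i * X j * X m * X n * quad4 (l i) (l j) (l m) (l n).
have Xk : X k = 0.
  by rewrite /X (dot3C (l k)) -[dot3 _ _]/(dot3 (cross a (l k)) (l k)) dot3C dot3_cross mulr0.
transitivity (\sum_(i < 4) \sum_(j < 4) \sum_(m < 4) \sum_(n < 4)
    F (bump k i) (bump k j) (bump k m) (bump k n)).
  transitivity (\sum_(i < 5) \sum_(j < 5) \sum_(m < 5) \sum_(n < 5) F i j m n); first by [].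
  rewrite (@sum_lift _ k (fun i => \sum_(j < 5) \sum_(m < 5) \sum_(n < 5) F i j m n)); last first.
    by do 3 (rewrite big1 // => ? _); rewrite /F Xk !mul0r.
  apply: eq_bigr => i _.
  rewrite (@sum_lift _ k (fun j => \sum_(m < 5) \sum_(n < 5) F (bump k i) j m n)); last first.
    by do 2 (rewrite big1 // => ? _); rewrite /F Xk !(mulr0, mul0r).
  apply: eq_bigr => j _.
  rewrite (@sum_lift _ k (fun m => \sum_(n < 5) F (bump k i) (bump k j) m n)); last first.
    by rewrite big1 // => ? _; rewrite /F Xk !(mulr0, mul0r).
  apply: eq_bigr => m _.
  rewrite (@sum_lift _ k (fun n => F (bump k i) (bump k j) (bump k m) n)) //.
  by rewrite /F Xk !(mulr0, mul0r).
have FE i j m n : F i j m n = X i * X j * X m * X n * (D ^+ 4 * vdm4 (t i) (t j) (t m) (t n) ^+ 2).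
  by rewrite /F quad4_nu.
rewrite (@sum4_sym K (fun i j m n => F (bump k i) (bump k j) (bump k m) (bump k n))) ?FE.
- by rewrite /X /l !dot3_cross_nu -/D -mulr_natl; move: (bip x y z) => B; ring.
- by move=> *; rewrite !FE /vdm4; ring.
- by move=> *; rewrite !FE /vdm4; ring.
- by move=> *; rewrite !FE /vdm4; ring.
- by move=> *; rewrite !FE /vdm4; ring.
Qed.

(** Since L_w S = L_S w, [Lk_mul_ver4] makes the left side the sum of c_k S(a x l_k), with a x l_k
    on the line l_k; [vdm_bip2] adds up the five values. *)
Lemma Lk_scorza x y z (a := x *: p0 + y *: p1 + z *: p2) :
  pair15 (ver4 a) (Lk w *m fbar S) =
  24%:R ^+ 5 * D ^+ 8 * (c 0%N * c 1%N * c 2%N * c 3%N * c 4%N) *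
  (vdm5 (t 0%N) (t 1%N) (t 2%N) (t 3%N) (t 4%N) * (y ^+ 2 - x * z)) ^+ 2.
Proof.
rewrite Lvec_mulC {1}/w mulmx_sumr.
under eq_bigr => r _ do rewrite -scalemxAr.
rewrite pair15_sumr.
transitivity (\sum_(r < 5) c r * S.@[cross a (l r) 0]).
  by apply: eq_bigr => r _; rewrite Lk_mul_ver4 pol4_fbar // scorza_homog.
under eq_bigr => r _ do rewrite scorza_cross.
rewrite (@sum5E K (fun k => c k * (24%:R ^+ 5 * D ^+ 8 *
    (c (bump k 0) * c (bump k 1) * c (bump k 2) * c (bump k 3)) *
    vdm4 (t (bump k 0)) (t (bump k 1)) (t (bump k 2)) (t (bump k 3)) ^+ 2 *
    (((t k - t (bump k 0)) * bip x y z (t (bump k 0)) (t k)) *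
     ((t k - t (bump k 1)) * bip x y z (t (bump k 1)) (t k)) *
     ((t k - t (bump k 2)) * bip x y z (t (bump k 2)) (t k)) *
     ((t k - t (bump k 3)) * bip x y z (t (bump k 3)) (t k)))))).
rewrite -[(bump 0 0)]/1%N -[bump 0 1]/2%N -[bump 0 2]/3%N -[bump 0 3]/4%N
  -[(bump 1 0)]/0%N -[bump 1 1]/2%N -[bump 1 2]/3%N -[bump 1 3]/4%N
  -[(bump 2 0)]/0%N -[bump 2 1]/1%N -[bump 2 2]/3%N -[bump 2 3]/4%N
  -[(bump 3 0)]/0%N -[bump 3 1]/1%N -[bump 3 2]/2%N -[bump 3 3]/4%N
  -[(bump 4 0)]/0%N -[bump 4 1]/1%N -[bump 4 2]/2%N -[bump 4 3]/3%N.
rewrite -vdm_bip2; move: (@bip K x y z) => B.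
move: (t 0%N) (t 1%N) (t 2%N) (t 3%N) (t 4%N) (c 0%N) (c 1%N) (c 2%N) (c 3%N) (c 4%N).
move=> t0 t1 t2 t3 t4 c0 c1 c2 c3 c4.
by move: (vdm4 t1 t2 t3 t4) (vdm4 t0 t2 t3 t4) (vdm4 t0 t1 t3 t4) (vdm4 t0 t1 t2 t4)
  (vdm4 t0 t1 t2 t3) (24%:R ^+ 5 * D ^+ 8) => *; ring.
Qed.

(** The bracket vanishes unless its four indices are distinct, and among four of five indices there
    is always i or j. *)
Lemma scorza_vertex (i j : 'I_5) (p : 'rV[K]_3) : i != j ->
  dot3 (l i) p = 0 -> dot3 (l j) p = 0 -> S.@[p 0] = 0.
Proof.
move=> ij hi hj; rewrite /S /w (scorza_sum (fun r : 'I_5 => c r) (fun r : 'I_5 => l r)).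
rewrite big1 // => a _; rewrite big1 // => b _; rewrite big1 // => d _; rewrite big1 // => e _.
have [U|] := boolP (uniq [:: a; b; d; e]); last first.
  rewrite quad4_nu /vdm4 /= !inE !negb_and !negbK => h.
  suff -> : (t b - t a) * (t d - t a) * (t e - t a) * (t d - t b) * (t e - t b) * (t e - t d) = 0.
    by rewrite expr0n !mulr0.
  case/orP: h => [/or3P[] /eqP->|/orP[/orP[]/eqP->|]]; rewrite ?subrr ?(mulr0, mul0r) //.
  by rewrite orbF => /eqP->; rewrite subrr mulr0.
have [h|h] := boolP (has (mem [:: i; j]) [:: a; b; d; e]).
  case/hasP: h => r; rewrite !inE => hr ir.
  have Xr : dot3 (l r) p = 0 by case/orP: ir => /eqP->.
  case/or4P: hr => /eqP E; move: Xr; rewrite E => ->; ring.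
have U6 : uniq [:: i, j, a, b, d & [:: e]].
  rewrite -[[:: i, j, a, b, d & [:: e]]]/([:: i; j] ++ [:: a; b; d; e]) cat_uniq U andbT.
  by rewrite (_ : uniq [:: i; j]) //= inE ij.
by have := max_card (mem [:: i, j, a, b, d & [:: e]]); rewrite (card_uniqP U6) card_ord.
Qed.
End FivePowers.

(** * Quartics with a singular Hankel matrix *)

Section SingularHankel.
Variables (K : numClosedFieldType) (p0 p1 p2 : 'rV[K]_3) (n : nat) (gam : nat -> K) (t c : 'I_n -> K).
Hypothesis D0 : det3 p0 p1 p2 != 0.
Hypothesis gamE : forall k, (k < 9)%N -> gam k = \sum_r c r * t r ^+ k.
Let w := \sum_r c r *: ver4 (nu p0 p1 p2 (t r)).

Lemma linform_neq0 (a b : 'rV[K]_3) : dot3 a b != 0 -> linform a != 0.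
Proof.
by apply: contra => /eqP h; rewrite -meval_linform h meval0.
Qed.

(* A binary quartic apolar to the octic gives a quartic, the product of the
   corresponding points of the conic, in the kernel. *)
Lemma det_Lk_hankel : \det (hankel gam) = 0 -> \det (Lk w) = 0.
Proof.
move/eqP/det0P => [v v0 vH].
pose P : {poly K} := \poly_(b < 5) v 0 (inord b).
have Pc (b : 'I_5) : P`_b = v 0 b by rewrite coef_poly ltn_ord inord_val.
have P0 : P != 0.
  apply: contra v0 => /eqP PE; apply/eqP/rowP => b.
  by rewrite -Pc PE coef0 mxE.
have sP : (size P <= 5)%N by apply: size_poly.
have [zs zE] := closed_field_poly_normal P.
have szs : (size zs <= 4)%N.
  by move: sP; rewrite zE size_scale ?lead_coef_eq0 // size_prod_XsubC ltnS.
(* When P has degree less than 4 the missing roots lie at infinity, where the point of the conic is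
   p2. *)
pose m j := if (j < size zs)%N then nu p0 p1 p2 zs`_j else p2.
pose f : {mpoly K[3]} := \prod_(j < 4) linform (m j).
have hf : f \is 4.-homog.
  rewrite -[4%N]/(1 + (1 + (1 + 1)))%N /f !big_ord_recl big_ord0 mulr1.
  by do 3! (apply: dhomogM; first exact: linform_homog); exact: linform_homog.
have f0 : f != 0.
  apply/prodf_neq0 => j _; rewrite /m; case: ifP => _.
    apply: (@linform_neq0 _ (cross p1 p2)).
    have -> : dot3 (nu p0 p1 p2 zs`_j) (cross p1 p2) = det3 p0 p1 p2; last by [].
    by rewrite det3E /nu !dot3E !vec3E !mxE; ring.
  apply: (@linform_neq0 _ (cross p0 p1)).
  have -> : dot3 p2 (cross p0 p1) = det3 p0 p1 p2; last by [].
  by rewrite det3E !dot3E !vec3E; ring.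
suff E : Lk w *m fbar f = 0.
  have u0 : fbar f != 0 by apply: contra f0 => /eqP h; apply/eqP/fbar_eq0.
  apply/eqP/det0P; exists (fbar f)^T; first by rewrite trmx_eq0.
  by rewrite -[Lk w]trmxK -trmx_mul Lvec_sym E trmx0.
apply: ver4_eq => a; rewrite [RHS]big1 => [|i _]; last by rewrite [X in _ * X]mxE mulr0.
rewrite Lvec_mulC {1}/w mulmx_sumr.
under eq_bigr => r _ do rewrite -scalemxAr.
rewrite pair15_sumr.
have [x [y [z ->]]] : exists x y z, a = x *: p0 + y *: p1 + z *: p2.
  by do 3 eexists; apply: (coord_basis D0).
set a' := _ + _.
(* As a function of s, f(a x nu s) is, up to the leading coefficient of P, the product P(s) H(s)
   with H of degree at most 4. Summing over the nodes turns it into Hankel rows applied to v, which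
   vanish. *)
pose e j : {poly K} := if (j < size zs)%N then 'X - (zs`_j)%:P else 1.
pose h j : {poly K} := if (j < size zs)%N
  then - det3 p0 p1 p2 *: ((x * zs`_j - y) *: 'X + (z - y * zs`_j)%:P)
  else det3 p0 p1 p2 *: (x *: 'X - y%:P).
have eh j s : dot3 (m j) (cross a' (nu p0 p1 p2 s)) = (e j).[s] * (h j).[s].
  rewrite /m /e /h; case: ifP => _; last by rewrite dot3_cross_p2 !hornerE.
  by rewrite dot3_cross_nu !(hornerXsubC, hornerD, hornerN, hornerZ, hornerC, hornerX) /bip; ring.
pose H := \prod_(j < 4) h j.
have sh j : (size (h j) <= 2)%N.
  rewrite /h; case: ifP => _; apply: leq_trans (size_scale_leq _ _) _.
    apply: leq_trans (size_polyD _ _) _; rewrite geq_max.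
    rewrite (leq_trans (size_scale_leq _ _)) ?size_polyX //.
    by rewrite (leq_trans (size_polyC_leq1 _)).
  apply: leq_trans (size_polyD _ _) _; rewrite geq_max size_polyN.
  rewrite (leq_trans (size_scale_leq _ _)) ?size_polyX //.
  by rewrite (leq_trans (size_polyC_leq1 _)).
have sH : (size H <= 5)%N.
  apply: leq_trans (size_prod_leq _ _) _.
  have -> : #|(fun _ : 'I_4 => true)| = 4%N by rewrite card_ord.
  rewrite leq_subLR ltnS.
  have : (\sum_(j < 4) size (h j) <= \sum_(j < 4) 2)%N by apply: leq_sum.
  by rewrite sum_nat_const card_ord.
have eE : \prod_(j < 4) e j = \prod_(z <- zs) ('X - z%:P).
  rewrite [RHS](big_nth 0) [RHS]big_mkord.
  have -> := @big_ord_widen _ 1 *%R _ _ (fun j => 'X - (zs`_j)%:P) szs.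
  by rewrite [RHS]big_mkcond; apply: eq_bigr => j _.
have lc0 : lead_coef P != 0 by rewrite lead_coef_eq0.
apply: (mulfI lc0); rewrite mulr0 mulr_sumr.
transitivity (\sum_r c r * (P.[t r] * H.[t r])).
  apply: eq_bigr => r _; rewrite Lk_mul_ver4 pol4_fbar // /f rmorph_prod /=.
  under eq_bigr => j _ do rewrite meval_linform eh.
  rewrite big_split /= -!horner_prod eE -/H {2}zE hornerZ; ring.
transitivity (\sum_(i < 5) H`_i * \sum_(b < 5) gam (b + i)%N * v 0 b).
  rewrite (eq_bigr (fun r => \sum_(i < 5) \sum_(b < 5) H`_i * (c r * t r ^+ (b + i) * v 0 b))).
    rewrite exchange_big; apply: eq_bigr => i _; rewrite exchange_big mulr_sumr.
    apply: eq_bigr => b _; rewrite gamE ?mulr_suml ?mulr_sumr //.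
    by move: (ltn_ord i) (ltn_ord b); lia.
  move=> r _; rewrite (horner_coef_wide _ sP) (horner_coef_wide _ sH).
  rewrite mulr_sumr mulr_sumr; apply: eq_bigr => i _.
  rewrite mulr_suml mulr_sumr; apply: eq_bigr => b _.
  by rewrite Pc exprD; ring.
rewrite big1 // => i _.
have /rowP/(_ i) := vH; rewrite !mxE => hi.
have -> : \sum_(b < 5) gam (b + i)%N * v 0 b = 0; last by rewrite mulr0.
by rewrite -[RHS]hi; apply: eq_bigr => b _; rewrite mxE mulrC.
Qed.
End SingularHankel.

(** * Proof of part (ii) *)

Section Apolar.
Variables (K : numClosedFieldType) (Q g : {mpoly K[3]}).
Hypothesis smQ : smooth_conic Q.
Hypothesis hg : g \is 4.-homog.
Let q := conic_coord Q.
Hypothesis apo : forall k, pair15 (fbar g) (sqv q (dirac K k)) = 0.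
Hypothesis Lg : \det (Lk (fbar g)) != 0.

Lemma scorza_apolar : exists l : 'I_5 -> 'rV[K]_3, [/\ complete_pentalateral l,
  forall i j p, i != j -> dot3 (l i) p = 0 -> dot3 (l j) p = 0 -> (scorza g).@[p 0] = 0 &
  exists2 lam : K, lam != 0 & Lk (fbar g) *m fbar (scorza g) = lam *: sqv q q].
Proof.
have [p0 [p1 [p2 [k [k0 D0 qE]]]]] := smooth_conic_param smQ.
have [gam gE] := apolar_gamma D0 k0 qE apo.
have H0 : \det (hankel gam) != 0.
  apply: contra Lg => /eqP dH.
  (* The nodes 0, ..., 8 realize the nine moments, so that [det_Lk_hankel] applies before a
     decomposition into five powers is known. *)
  have tinj : injective (fun i : 'I_9 => (nat_of_ord i)%:R : K).
    by move=> i j /eqP; rewrite eqr_nat => /eqP/val_inj.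
  have [c cE] := vandermonde_solve gam tinj.
  by rewrite (gE _ _ _ cE) (det_Lk_hankel D0 cE dH).
have [t [c [tinj c0 cE]]] := octic_decomp H0.
pose tt n := t (inord n); pose cc n := c (inord n).
pose l r := nu p0 p1 p2 (tt r).
have wE : fbar g = \sum_(r < 5) cc r *: ver4 (l r).
  rewrite (gE _ _ _ cE); apply: eq_bigr => r _.
  by rewrite /cc /l /tt inord_val.
have gS : g = quartic_of (\sum_(r < 5) cc r *: ver4 (l r)) by rewrite -wE quartic_of_fbar.
have ttn i j : (i < 5)%N -> (j < 5)%N -> (i != j)%N -> tt j - tt i != 0.
  move=> hi hj; apply: contra; rewrite subr_eq0 => /eqP/tinj/(congr1 val).
  by rewrite /= !inordK // => ->.
exists (fun r => l r); split.
- move=> i j m ij im jm; rewrite det3_nu mulf_neq0 //.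
  by rewrite !mulf_neq0 // ttn.
- by move=> i j p ij hi hj; rewrite gS; apply: scorza_vertex ij hi hj.
- pose lam := 24%:R ^+ 5 * det3 p0 p1 p2 ^+ 8 * (cc 0%N * cc 1%N * cc 2%N * cc 3%N * cc 4%N) *
    (vdm5 (tt 0%N) (tt 1%N) (tt 2%N) (tt 3%N) (tt 4%N) / k) ^+ 2.
  exists lam.
    by rewrite /lam /vdm5 !(mulf_neq0, expf_neq0, invr_neq0) ?ttn ?pnatr_eq0 // /cc c0.
  apply: ver4_eq => a; rewrite pair15Zr pair15_sqv.
  have [x [y [z ->]]] : exists x y z, a = x *: p0 + y *: p1 + z *: p2.
    by do 3 eexists; apply: (coord_basis D0).
  by rewrite {1}wE {1}gS Lk_scorza qE /lam; field.
Qed.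
End Apolar.

Lemma singular_smooth_conic (K : numClosedFieldType) (f Q : {mpoly K[3]}) :
  f \is 4.-homog -> f != 0 -> smooth_conic Q ->
  zero_locus [set` partials (WM f)]%classic (conic_coord Q) ->
  let g := border_quartic f Q in
  apolar g Q /\
  (\det (Lmat g) != 0 ->
   [/\ exists2 c : K, c != 0 & f = c *: border_quartic g Q,
       exists2 c : K, c != 0 & f = c *: scorza g &
       luroth f]).
Proof.
move=> hf f0 smQ sing g; have [hQ _] := smQ.
have hg : g \is 4.-homog by apply: border_quartic_homog.
have apo := border_apolar hQ sing.
split; first exact: apolarP.
rewrite LmatE => dg; have df := det_Lk_neq0 hf f0 hQ dg.
have [l [lcp lv [lam lam0 LS]]] := scorza_apolar smQ hg apo dg.
have [c c0 fS] : exists2 c : K, c != 0 & f = c *: scorza g.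
  (* L_g f = - det(L_f) Q^2 and L_g S(g) = lam Q^2, with L_g invertible. *)
  have [k kE] : exists k, k = - \det (Lk (fbar f)) / lam by eexists.
  exists k; first by rewrite kE mulf_neq0 ?oppr_eq0 ?invr_eq0.
  rewrite -[LHS](quartic_of_fbar hf) -[scorza g]quartic_of_fbar ?scorza_homog //.
  have -> : fbar f = k *: fbar (scorza g).
    rewrite kE; apply: (scalerI dg); rewrite scalerA mulrC -scalerA.
    rewrite -!mul_scalar_mx -!mul_adj_mx -!mulmxA LS (Lk_border f hQ).
    by rewrite mul_scalar_mx -!scalemxAr scalerA divfK.
  rewrite /quartic_of scaler_sumr; apply: eq_bigr => p _.
  by rewrite mxE -scalerA.
split; [exact: border_inv | by exists c | ].
split=> // d F hF Fp; apply: Fp; split=> //; exists l => // i j p ij hi hj.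
have E (P : {mpoly K[3]}) : P.@[p] = P.@[(\row_i p i) 0].
  by apply: meval_eq => m; rewrite mxE.
rewrite E meval_linform in hi; rewrite E meval_linform in hj.
by rewrite E fS mevalZ (lv i j) // mulr0.
Qed.

(** * Macaulay matrices of the singular locus *)

Lemma monomial_basis (n d : nat) : exists B : 'C(d + n, d).-tuple 'X_{1..n.+1},
  uniq B /\ forall m, (mdeg m == d) = (m \in B).
Proof.
pose s := [seq s2m t | t : d.-tuple 'I_n.+1 <- enum (mpoly.basis n.+1 d)].
have sz : size s == 'C(d + n, d) by rewrite /s size_basis.
exists (Tuple sz); split; first exact: uniq_basis.
by move=> m; rewrite basis_cover.
Qed.

Section Macaulay.
Variables (K : numFieldType) (d N : nat) (B : N.-tuple 'X_{1..6}).
Hypothesis uB : uniq B.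
Hypothesis cB : forall m, (mdeg m == d) = (m \in B).
Notation J := ('I_6 * 'X_{1..6 < d.+1})%type.

Section Def.
Variables (A : comNzRingType) (iota : K -> A) (u : 'cV[A]_15).
(* The rows are the degree d multiples, by monomials, of the six partial derivatives. *)
Definition mac_gen (j : J) : {mpoly A[6]} :=
  if (mdeg j.2 + 3 == d)%N then 'X_[j.2] * WMd iota u j.1 else 0.
Definition macaulay : 'M[A]_(#|{: J}|, N) :=
  \matrix_(r, i) (mac_gen (enum_val r))@_(tnth B i).
Definition evalcol (q : 'I_6 -> A) : 'cV[A]_N := \col_i mmap1 q (tnth B i).

Lemma mac_gen_homog j : mac_gen j \is d.-homog.
Proof.
rewrite /mac_gen; case: eqP => [E|_]; last exact: dhomog0.
have hp : 'X_[j.2] * WMd iota u j.1 \is (mdeg j.2 + 3).-homog.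
  by apply: dhomogM; [rewrite dhomogX | apply: WMd_homog].
by rewrite E in hp.
Qed.

Lemma homog_tuple_expand (p : {mpoly A[6]}) : p \is d.-homog ->
  p = \sum_i p@_(tnth B i) *: 'X_[tnth B i].
Proof.
move=> hp; apply/mpolyP => m; rewrite raddf_sum /=.
under eq_bigr do rewrite mcoeffZ mcoeffX.
have [/tnthP[i ->]|md] := boolP (m \in B).
  rewrite (bigD1 i) //= eqxx mulr1 big1 ?addr0 // => k ki.
  by rewrite (inj_eq (@tuple_uniqP _ _ _ uB)) (negbTE ki) mulr0.
rewrite (dhomog_nemf_coeff hp) ?cB // big1 // => i _.
by case: eqP => [E|]; rewrite ?mulr0 //; move: md; rewrite -E mem_tnth.
Qed.

Lemma homog_evalcol (p : {mpoly A[6]}) q : p \is d.-homog ->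
  \sum_i p@_(tnth B i) * evalcol q i 0 = p.@[q].
Proof.
move=> hp; rewrite [in RHS](homog_tuple_expand hp) raddf_sum; apply: eq_bigr => i _ /=.
by rewrite mevalZ mevalX mxE.
Qed.

Lemma macaulay_evalcol (q : 'I_6 -> A) r :
  (macaulay *m evalcol q) r 0 = (mac_gen (enum_val r)).@[q].
Proof.
rewrite -homog_evalcol ?mac_gen_homog // mxE; apply: eq_bigr => i _.
by rewrite [macaulay _ _]mxE.
Qed.
End Def.

(** The same matrix can thus be taken at f, along a segment, or at the generic quartic, and then
    specialized. *)
Lemma macaulay_map (A A' : comNzRingType) (iota : K -> A) (iota' : K -> A')
    (phi : {rmorphism A -> A'}) (u : 'cV[A]_15) : phi \o iota =1 iota' ->
  map_mx phi (macaulay iota u) = macaulay iota' (map_mx phi u).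
Proof.
move=> h; apply/matrixP => r i; rewrite !mxE /mac_gen.
case: ifP => _; last by rewrite !mcoeff0 raddf0.
have LE : map_mx phi (Lvec iota u) = Lvec iota' (map_mx phi u).
  rewrite Lvec_map; apply/matrixP => a b; rewrite !mxE; apply: eq_bigr => p _.
  by rewrite h.
have X (C : comNzRingType) : map_mpoly phi \o (fun a : 'I_6 => 'X_a) =1 (fun a => 'X_a).
  by move=> a; rewrite /= map_mpolyX.
have mE (C : comNzRingType) (M : 'M[C]_15) a b : (map_mx (@mpolyC 6 C) M) a b = (M a b)%:MP.
  by rewrite mxE.
rewrite -mcoeff_map_mpoly rmorphM /= map_mpolyX; congr (('X_[_] * _)@__).
rewrite /WMd rmorphN rmorphMn; congr (- (_ *+ _)).
rewrite /pair15 rmorph_sum; apply: eq_bigr => a _; rewrite rmorphM; congr (_ * _).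
  rewrite [in LHS]mxE [RHS]mxE rmorph_sum; apply: eq_bigr => b _.
  rewrite rmorphM; congr (_ * _).
    by rewrite mE [RHS]mE /= map_mpolyC -LE -map_mx_adj [in RHS]mxE.
  rewrite !mxE rmorph_sum; apply: eq_bigr => x _; rewrite rmorph_sum.
  by apply: eq_bigr => y _; rewrite !rmorphM !rmorph_nat /= !map_mpolyX.
rewrite !mxE rmorph_sum; apply: eq_bigr => x _; rewrite rmorph_sum.
by apply: eq_bigr => y _; rewrite !rmorphM !rmorph_nat /= !map_mpolyX.
Qed.

Lemma dim_ideal_piece (f : {mpoly K[3]}) :
  (\dim (ideal_piece (partials (WM f)) d) <= \rank (macaulay id (fbar f)))%N.
Proof.
set G := macaulay _ _.
pose phi (v : 'rV[K]_N) : dhomog 6 K d := \sum_i v 0 i *: indhomog d 'X_[tnth B i].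
have phiE v : val (phi v) = \sum_i v 0 i *: 'X_[tnth B i].
  rewrite raddf_sum; apply: eq_bigr => i _ /=; congr (_ *: _).
  by rewrite /indhomog insubdK // -topredE /= dhomogX /= cB mem_tnth.
have phiD v w a : phi (a *: v + w) = a *: phi v + phi w.
  rewrite /phi scaler_sumr -big_split; apply: eq_bigr => i _ /=.
  by rewrite !mxE scalerDl scalerA.
pose S := [seq phi (row i (row_base G)) | i <- enum 'I_(\rank G)].
have sS : size S = \rank G by rewrite size_map size_enum_ord.
rewrite -sS; apply: leq_trans (dim_span S); apply: dimvS.
rewrite /ideal_piece big_map big_enum; apply/subv_sumP => k _.
apply/subv_sumP => m _; rewrite -memvE WM_partial.
have rowS (v : 'rV_N) : (v <= G)%MS -> phi v \in <<S>>%VS.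
  rewrite -(eq_row_base G) => /submxP[c ->]; rewrite mulmx_sum_row.
  have phi0 : phi 0 = 0 by rewrite /phi big1 // => i _; rewrite mxE scale0r.
  have -> : phi (\sum_i c 0 i *: row i (row_base G)) = \sum_i c 0 i *: phi (row i (row_base G)).
    elim/big_rec2: _ => // i y x _ <-; exact: phiD.
  apply: memv_suml => i _; apply: memvZ; apply: memv_span.
  by apply: map_f; rewrite mem_enum.
pose r := enum_rank ((k, m) : J).
suff -> : indhomog d ('X_[m] * WMd id (fbar f) k) = phi (row r G).
  by apply: rowS; apply: row_sub.
apply: val_inj; rewrite phiE.
have rowE i : row r G 0 i = (mac_gen id (fbar f) (k, m))@_(tnth B i).
  by rewrite !mxE enum_rankK.
under eq_bigr => i _ do rewrite rowE.
rewrite -homog_tuple_expand ?mac_gen_homog // /mac_gen /=.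
have hp : 'X_[m] * WMd id (fbar f) k \is (mdeg m + 3).-homog.
  by apply: dhomogM; [rewrite dhomogX | apply: WMd_homog].
case: eqP => [E|E]; first by rewrite /indhomog insubdK // -topredE /=; rewrite E in hp.
(* In a wrong degree [indhomog] gives 0, in agreement with the zero row; a product homogeneous of
   two different degrees is itself 0. *)
rewrite /indhomog /insubd; case: insubP => //= p hpd ->.
apply/eqP; apply: contraT => p0; case: E.
exact: dhomog_uniq p0 hp hpd.
Qed.

(** U brings G to the first rows of the invertible matrix [row_ebase G], and the missing rows form a
    matrix of rank at most 28, factored as Z1 Z2. With U, Z1, Z2 fixed, the determinant is
    polynomial in the quartic. *)
Lemma macaulay_det (f : {mpoly K[3]}) : (N - \dim (ideal_piece (partials (WM f)) d) <= 28)%N ->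
  exists (U : 'M[K]_(N, #|{: J}|)) (r : nat) (Z1 : 'M[K]_(N, r)) (Z2 : 'M[K]_(r, N)),
    (r <= 28)%N /\ \det (U *m macaulay id (fbar f) + Z1 *m Z2) != 0.
Proof.
move=> h; set G := macaulay _ _; pose Z : 'M_N := copid_mx (\rank G) *m row_ebase G.
have rG : (N - \rank G <= 28)%N.
  by apply: leq_trans h; apply: leq_sub2l; apply: dim_ideal_piece.
exists (pid_mx (\rank G) *m invmx (col_ebase G)), (\rank Z), (col_base Z), (row_base Z).
split.
  by rewrite /Z mxrankMfree ?row_free_unit ?row_ebase_unit // rank_copid_mx ?rank_leq_col.
have -> : pid_mx (\rank G) *m invmx (col_ebase G) *m G = (pid_mx (\rank G) : 'M_N) *m row_ebase G.
  transitivity (pid_mx (\rank G) *m invmx (col_ebase G) *m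
    (col_ebase G *m pid_mx (\rank G) *m row_ebase G) : 'M_N); first by rewrite mulmx_ebase.
  by rewrite !mulmxA mulmxKV ?col_ebase_unit // pid_mx_id ?rank_leq_row.
rewrite mulmx_base -mulmxDl /copid_mx.
rewrite addrC subrK mul1mx -unitfE -unitmxE; exact: row_ebase_unit.
Qed.
End Macaulay.

Lemma meval_homogZ (A : comNzRingType) n d (p : {mpoly A[n]}) (c : A) x :
  p \is d.-homog -> p.@[fun i => c * x i] = c ^+ d * p.@[x].
Proof.
move=> /dhomogP hp; rewrite !mevalE mulr_sumr !big_seq; apply: eq_bigr => m /hp <-.
rewrite /= mdegE -prodrXr mulrCA; congr (_ * _); rewrite -big_split; apply: eq_bigr => i _.
by rewrite exprMn.
Qed.

(* The closure of a cone satisfies the same non-homogeneous equations as the cone. *)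
Lemma luroth_nonzero (K : numFieldType) (f : {mpoly K[3]}) (F : {mpoly K[15]}) :
  luroth f -> F.@[fun i => fbar f i 0] != 0 ->
  exists2 h, pentalateral_quartic h & F.@[fun i => fbar h i 0] != 0.
Proof.
case=> _ _ hf; apply: contraPP => no; apply/negP; rewrite negbK.
have F0 h : pentalateral_quartic h -> F.@[fun i => fbar h i 0] = 0.
  by move=> hh; apply/eqP; apply: contrapT => /negP hn; apply: no; exists h.
pose k := mmeasure mdeg F; have FE := pihomog_partitionE (leqnn k).
rewrite FE raddf_sum big1 // => d _ /=; apply: (hf d); first exact: pihomogP.
(* The coefficients of [P] are the values at h of the homogeneous components of F. It vanishes at
   every c <> 0, since c h is again pentalateral; the factor X below takes care of c = 0. *)
move=> h hh; pose P : {poly K} := \sum_(e < k) (pihomog mdeg e F).@[fun i => fbar h i 0] *: 'X^e.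
have P0 : P = 0.
  have X0 : 'X != 0 :> {poly K} by rewrite -size_poly_eq0 size_polyX.
  apply: (mulfI X0); rewrite mulr0; apply: poly_horner0 => c.
  rewrite hornerM hornerX; have [->|c0] := eqVneq c 0; first by rewrite mul0r.
  have hc : pentalateral_quartic (c *: h).
    case: hh => h4 h0 [l lc lv]; split; first exact: rpredZ.
      by rewrite scaler_eq0 negb_or c0.
    by exists l => // i j p ij pi pj; rewrite mevalZ (lv i j) // mulr0.
  have := F0 _ hc; rewrite FE raddf_sum /= => E.
  suff -> : P.[c] = 0 by rewrite mulr0.
  rewrite -[RHS]E horner_sum; apply: eq_bigr => e _.
  rewrite hornerZ hornerXn mulrC -(meval_homogZ _ _ (pihomogP _ e F)).
  by apply: meval_eq => i; rewrite fbarZ [RHS]mxE.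
have := congr1 (fun p : {poly K} => p`_d) P0; rewrite coef0 coef_sum (bigD1 d) //= big1.
  by rewrite addr0 coefZ coefXn eqxx mulr1.
by move=> e ed; rewrite coefZ coefXn val_eqE eq_sym (negbTE ed) mulr0.
Qed.

Lemma det_mulmx_lt (A : idomainType) m r (X : 'M[A]_(m, r)) (Y : 'M[A]_(r, m)) :
  (r < m)%N -> \det (X *m Y) = 0.
Proof.
move=> rm; apply/eqP; apply: contraLR rm => d0; rewrite -leqNgt.
have : map_mx (@tofrac A) X *m map_mx (@tofrac A) Y \in unitmx.
  by rewrite -map_mxM unitmxE det_map_mx unitfE tofrac_eq0.
rewrite -row_free_unit => /eqP <-.
by apply: leq_trans (mxrankM_maxl _ _) _; apply: rank_leq_col.
Qed.

(** * Points imposing independent conditions, and their deformations *)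

Section Separation.
Variables (K : fieldType) (n e : nat) (q0 : 'I_n.+2 -> 'I_e -> K).
Hypothesis sep : forall i j, i != j -> exists a b, q0 i a * q0 j b != q0 i b * q0 j a.

Lemma separating_form i j : i != j -> exists2 p : {mpoly K[e]}, p \is 1.-homog &
  p.@[q0 i] != 0 /\ p.@[q0 j] = 0.
Proof.
move=> /sep[a [b ab]]; exists (q0 j b *: 'X_a - q0 j a *: 'X_b).
  by apply: rpredB; apply: rpredZ; rewrite dhomogX /= mdeg1.
rewrite !mevalB !mevalZ !mevalXU; split; last by rewrite mulrC subrr.
by rewrite subr_eq0 mulrC (mulrC (q0 j a)).
Qed.

Lemma separating_prod i (s : seq 'I_n.+2) : i \notin s ->
  exists2 p : {mpoly K[e]}, p \is (size s).-homog &
  p.@[q0 i] != 0 /\ forall j, j \in s -> p.@[q0 j] = 0.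
Proof.
elim: s => [|j s IH] /=; first by exists 1; [exact: dhomog1 | split; rewrite ?meval1 ?oner_eq0].
rewrite inE negb_or => /andP[ij /IH[p hp [pi pj]]].
have [l hl [li lj]] := separating_form ij.
exists (l * p); first by rewrite -add1n; apply: dhomogM.
split; first by rewrite mevalM mulf_neq0.
by move=> m; rewrite inE mevalM => /orP[/eqP->|/pj->]; rewrite ?lj ?mul0r ?mulr0.
Qed.

(** One linear form for each other point, whence the bound d >= 28 for 29 points; the remaining
    degree is filled by a power of a form that does not vanish at the point i. *)
Lemma separating_degree i d : (n.+1 <= d)%N -> exists2 p : {mpoly K[e]}, p \is d.-homog &
  p.@[q0 i] != 0 /\ forall j, j != i -> p.@[q0 j] = 0.
Proof.
move=> nd; pose s := rem i (enum 'I_n.+2).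
have si : i \notin s by rewrite mem_rem_uniqF ?enum_uniq.
have [p hp [pi pj]] := separating_prod si.
have sz : size s = n.+1 by rewrite size_rem ?mem_enum // size_enum_ord.
have [j ij] : exists j, i != j.
  exists (if i == ord0 then ord_max else ord0); case: (eqVneq i ord0) => [->|//]; by [].
have [l hl [li _]] := separating_form ij.
exists (p * l ^+ (d - n.+1)).
  rewrite -[d in d.-homog](subnKC nd) -sz; apply: dhomogM => //.
  by rewrite -[X in X.-homog]mul1n; apply: dhomogMn.
split; first by rewrite mevalM rmorphXn mulf_neq0 ?expf_neq0.
by move=> m mi; rewrite mevalM pj ?mul0r // mem_rem_uniq ?enum_uniq // inE mi mem_enum.
Qed.
End Separation.

Lemma dvdp_det (K : fieldType) n (b : {poly K}) (M M' : 'M[{poly K}]_n) :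
  (forall i j, b %| M i j - M' i j) -> b %| \det M - \det M'.
Proof.
move=> h; rewrite /determinant -sumrB; apply: (big_ind (fun x => b %| x)); [exact: dvdp0 | exact: dvdp_add |].
move=> s _; rewrite -mulrBr dvdp_mull //.
elim/big_rec2: _ => [|i y x _ IH]; first by rewrite subrr dvdp0.
have -> : M i (s i) * x - M' i (s i) * y = (M i (s i) - M' i (s i)) * x + M' i (s i) * (x - y).
  by ring.
by apply: dvdp_add; [apply: dvdp_mulr; apply: h | apply: dvdp_mull].
Qed.

Section Deformation.
Variables (K : numFieldType) (d N n : nat) (B : N.-tuple 'X_{1..6}).
Hypothesis uB : uniq B.
Hypothesis cB : forall m, (mdeg m == d) = (m \in B).
Variables (q0 : 'I_n.+2 -> 'I_6 -> K) (u : 'cV[{poly K}]_15).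
Hypothesis sep : forall i j, i != j -> exists a b, q0 i a * q0 j b != q0 i b * q0 j a.
Hypothesis nd : (n.+1 <= d)%N.
Hypothesis lift : forall k, exists q : 'I_n.+2 -> 'I_6 -> {poly K},
  (forall i a, (q i a).[0] = q0 i a) /\
  forall i j, 'X^k %| (WMd (@polyC K) u j).@[q i].

(* A determinant vanishing to all orders at s = 0, because modulo s^k the n + 2
   points impose independent conditions on the multiples of the partials. *)
Lemma macaulay_deformation r (U : 'M_(N, _)) (Z1 : 'M[K]_(N, r)) (Z2 : 'M[K]_(r, N)) :
  (r <= n.+1)%N ->
  \det (map_mx polyC U *m macaulay d B (@polyC K) u + map_mx polyC (Z1 *m Z2)) = 0.
Proof.
move=> rn; set BM := _ + _; set G := macaulay _ _ _ _ in BM *.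
have [L hL1 hL2] := fin_all_exists2 (fun i => separating_degree sep i nd).
pose W : 'M[K]_(n.+2, N) := \matrix_(i, a) (L i)@_(tnth B a).
suff key k : 'X^k %| \det BM ^+ n.+2.
  suff : \det BM ^+ n.+2 == 0 by rewrite expf_eq0 => /eqP.
  apply: contraT => nz.
  have := dvdp_leq nz (key (size (\det BM ^+ n.+2))).
  by rewrite size_polyXn ltnn.
have [q [qq0 hq]] := lift k.
pose E : 'M[{poly K}]_(N, n.+2) := \matrix_(a, i) evalcol B (q i) a 0.
have GE r' i : 'X^k %| (G *m E) r' i.
  have -> : (G *m E) r' i = (G *m evalcol B (q i)) r' 0.
    by rewrite !mxE; apply: eq_bigr => a _; rewrite [E _ _]mxE.
  rewrite macaulay_evalcol // /mac_gen; case: ifP => _; last by rewrite meval0 dvdp0.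
  by rewrite mevalM dvdp_mull.
pose W' := map_mx polyC W.
(* At s = 0 the forms [L i] are dual to the points up to nonzero factors, so this determinant is
   prime to s^k. *)
have WE0 : \det (map_mx (horner_eval 0) (W' *m E)) != 0.
  have -> : map_mx (horner_eval 0) (W' *m E) = diag_mx (\row_i (L i).@[q0 i]).
    apply/matrixP => i j; rewrite !mxE.
    have E1 : horner_eval 0 (\sum_a W' i a * E a j) = (L i).@[q0 j].
      rewrite -(homog_evalcol uB cB) ?hL1 //.
      rewrite rmorph_sum; apply: eq_bigr => a _; rewrite rmorphM /=; congr (_ * _).
        by rewrite !mxE /horner_eval hornerC.
      rewrite !mxE /mmap1 rmorph_prod; apply: eq_bigr => b _.
      by rewrite rmorphXn /= /horner_eval qq0.
    rewrite E1; case: (hL2 i) => _ hi; case: eqVneq => [->|ij]; first by rewrite mulr1n.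
    by rewrite hi ?mulr0n // eq_sym.
  by rewrite det_diag; apply/prodf_neq0 => i _; rewrite mxE; case: (hL2 i).
have cop : coprimep 'X^k (\det (W' *m E)).
  rewrite coprimep_sym; apply: coprimep_expr; rewrite -[X in coprimep _ X]subr0 -polyC0 coprimep_XsubC.
  by rewrite /root -[_.[0]]/(horner_eval 0 _) -det_map_mx.
rewrite -(Gauss_dvdpl _ cop).
(* Modulo s^k, BM E is Z1 Z2 E, of rank at most r < n + 2. Multiplication by W' adj(BM) gives a
   square matrix, at the cost of a power of det BM. *)
have -> : \det BM ^+ n.+2 * \det (W' *m E) = \det (W' *m \adj BM *m (BM *m E)).
  by rewrite mulmxA -[W' *m _ *m _]mulmxA mul_adj_mx mul_mx_scalar -scalemxAl detZ.
pose Y1 := W' *m \adj BM *m map_mx polyC Z1; pose Y2 := map_mx polyC Z2 *m E.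
have d0 : \det (Y1 *m Y2) = 0 by apply: det_mulmx_lt; rewrite ltnS.
rewrite -[X in _ %| X]subr0 -d0; apply: dvdp_det => i j.
have -> : W' *m \adj BM *m (BM *m E) = W' *m \adj BM *m map_mx polyC U *m (G *m E) + Y1 *m Y2.
  by rewrite {2}/BM mulmxDl mulmxDr map_mxM /Y1 /Y2 !mulmxA.
rewrite [X in X - _]mxE addrK mxE; apply: (big_ind (fun x => 'X^k %| x)); [exact: dvdp0 | exact: dvdp_add |].
by move=> a _; rewrite dvdp_mull.
Qed.
End Deformation.

(** * Pentalateral quartics *)

Section Pol4Expand.
Variables (A : comNzRingType) (u : 'cV[A]_15).
Implicit Types (a b c p q : 'rV[A]_3) (x y : A).
Let T := pol4 u.

Lemma pol4_lin22 x y a b p q : T (x *: a + y *: b) (x *: a + y *: b) p q =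
  x ^+ 2 * T a a p q + x * y * T a b p q *+ 2 + y ^+ 2 * T b b p q.
Proof. by rewrite /T pol4_lin1 !pol4_lin2 (pol4C12 u b a); ring. Qed.

Lemma pol4_lin33 x y a b p (s := x *: a + y *: b) : T s s s p =
  x ^+ 3 * T a a a p + x ^+ 2 * y * T a a b p *+ 3 + x * y ^+ 2 * T a b b p *+ 3 + y ^+ 3 * T b b b p.
Proof.
rewrite pol4_lin22 /s /T !pol4_lin3 (pol4C23 u a b a) (pol4C23 u b b a) (pol4C12 u b a b).
by ring.
Qed.

Lemma pol4_lin44 x y a b (s := x *: a + y *: b) : T s s s s =
  x ^+ 4 * T a a a a + x ^+ 3 * y * T a a a b *+ 4 + x ^+ 2 * y ^+ 2 * T a a b b *+ 6
  + x * y ^+ 3 * T a b b b *+ 4 + y ^+ 4 * T b b b b.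
Proof.
rewrite pol4_lin33 /s /T !pol4_lin4 (pol4C34 u a a b a) (pol4C34 u a b b a)
  (pol4C23 u a b a b) (pol4C34 u b b b a) (pol4C23 u b b a b) (pol4C12 u b a b b).
by ring.
Qed.

Lemma pol4_trinomial x y z a b c (s := x *: a + y *: b + z *: c) : T s s s s =
  x ^+ 4 * T a a a a + y ^+ 4 * T b b b b + z ^+ 4 * T c c c c
  + x ^+ 3 * y * T a a a b *+ 4 + x ^+ 3 * z * T a a a c *+ 4 + x * y ^+ 3 * T a b b b *+ 4
  + y ^+ 3 * z * T b b b c *+ 4 + x * z ^+ 3 * T a c c c *+ 4 + y * z ^+ 3 * T b c c c *+ 4
  + x ^+ 2 * y ^+ 2 * T a a b b *+ 6 + x ^+ 2 * z ^+ 2 * T a a c c *+ 6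
  + y ^+ 2 * z ^+ 2 * T b b c c *+ 6 + x ^+ 2 * y * z * T a a b c *+ 12
  + x * y ^+ 2 * z * T a b b c *+ 12 + x * y * z ^+ 2 * T a b c c *+ 12.
Proof.
rewrite /s -[x *: a + y *: b]scale1r pol4_lin44 pol4_lin44 pol4_lin33 pol4_lin22.
by rewrite [T (_ + _) c c c]pol4_lin1 /T; ring.
Qed.
End Pol4Expand.

Lemma homog4_ext (K : numFieldType) (f g : {mpoly K[3]}) : f \is 4.-homog -> g \is 4.-homog ->
  (forall p : 'rV[K]_3, f.@[p 0] = g.@[p 0]) -> f = g.
Proof.
move=> hf hg h; have E : Hbar f = Hbar g.
  by apply: ver4_eq => a; rewrite !pair15_Hbar.
rewrite (homog4_expand hf) (homog4_expand hg); apply: eq_bigr => i _.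
by have /matrixP/(_ i 0) := E; rewrite !mxE => ->.
Qed.

Section PentalateralForm.
Variables (A : comNzRingType) (p0 p1 p2 : 'rV[A]_3) (t kap : nat -> A).
Definition pent_line j : {mpoly A[3]} := linform (nu p0 p1 p2 (t j)).
(** The squares of [vdm4] are those of [scorza_cross]: for nonzero weights this is, up to a factor,
    the Scorza quartic of the sum of the l_k^4 / kap_k, written so as to stay polynomial in the
    parameters. *)
Definition pent_form : {mpoly A[3]} := \sum_(k < 5)
  (kap k * vdm4 (t (bump k 0)) (t (bump k 1)) (t (bump k 2)) (t (bump k 3)) ^+ 2) *:
  (pent_line (bump k 0) * pent_line (bump k 1) * pent_line (bump k 2) * pent_line (bump k 3)).

Lemma pent_form_homog : pent_form \is 4.-homog.
Proof.
apply: rpred_sum => k _; apply: rpredZ; rewrite -[4%N]/(1 + 1 + 1 + 1)%N.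
by do 3! (apply: dhomogM; last exact: linform_homog); exact: linform_homog.
Qed.
End PentalateralForm.

Section Binary.
Variable K : fieldType.

(** The two equations say that h2 y^2 + h1 y z + h0 z^2 vanishes at (a2, - a1) and (b2, - b1), the
    zeros of a1 y + a2 z and b1 y + b2 z. *)
Lemma binary_quadratic (a1 a2 b1 b2 h2 h1 h0 : K) : a1 != 0 -> b1 != 0 ->
  a1 * b2 - a2 * b1 != 0 ->
  h2 * a2 ^+ 2 - h1 * a1 * a2 + h0 * a1 ^+ 2 = 0 ->
  h2 * b2 ^+ 2 - h1 * b1 * b2 + h0 * b1 ^+ 2 = 0 ->
  exists c, [/\ h2 = c * (a1 * b1), h1 = c * (a1 * b2 + a2 * b1) & h0 = c * (a2 * b2)].
Proof.
move=> a10 b10 d0 ea eb; exists (h2 / (a1 * b1)).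
have e1 : (a1 * b2 - a2 * b1) * (h2 * (a1 * b2 + a2 * b1) - h1 * (a1 * b1)) = 0.
  transitivity (a1 ^+ 2 * (h2 * b2 ^+ 2 - h1 * b1 * b2 + h0 * b1 ^+ 2)
    - b1 ^+ 2 * (h2 * a2 ^+ 2 - h1 * a1 * a2 + h0 * a1 ^+ 2)); first by ring.
  by rewrite ea eb !mulr0 subrr.
have e2 : (a1 * b2 - a2 * b1) * (h2 * (a2 * b2) - h0 * (a1 * b1)) = 0.
  transitivity (a1 * a2 * (h2 * b2 ^+ 2 - h1 * b1 * b2 + h0 * b1 ^+ 2)
    - b1 * b2 * (h2 * a2 ^+ 2 - h1 * a1 * a2 + h0 * a1 ^+ 2)); first by ring.
  by rewrite ea eb !mulr0 subrr.
have ab0 : a1 * b1 != 0 by rewrite mulf_neq0.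
move/eqP: e1; rewrite mulf_eq0 (negbTE d0) subr_eq0 => /eqP e1.
move/eqP: e2; rewrite mulf_eq0 (negbTE d0) subr_eq0 => /eqP e2.
by split; apply: (mulIf ab0); rewrite ?divfK // mulrAC divfK // -?e1 -?e2.
Qed.

Lemma linear_pencil (a0 a1 a2 b0 b1 b2 x y z : K) : a0 * b1 - a1 * b0 != 0 ->
  x * (a1 * b2 - a2 * b1) + y * (a2 * b0 - a0 * b2) + z * (a0 * b1 - a1 * b0) = 0 ->
  exists c e, [/\ x = c * a0 + e * b0, y = c * a1 + e * b1 & z = c * a2 + e * b2].
Proof.
move=> d0 h; exists ((x * b1 - y * b0) / (a0 * b1 - a1 * b0)), ((a0 * y - a1 * x) / (a0 * b1 - a1 * b0)).
split; [by field | by field |].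
apply: (mulIf d0); apply/eqP; rewrite -subr_eq0 -[X in _ == X]h; apply/eqP; by field.
Qed.
End Binary.

Section TenVertices.
Variable K : fieldType.

(** Three of the lines are the coordinate lines. On x = 0 the quartic is y z times a binary
    quadratic vanishing on L3 and L4, which gives c0, and likewise c1 and c2. Subtracting these
    terms leaves x y z times a linear form (X, Y, Z) vanishing at the meet of L3 and L4, hence a
    combination of L3 and L4. *)
Lemma ten_vertices_coord (H : K -> K -> K -> K)
    (k400 k040 k004 k310 k301 k130 k031 k103 k013 k220 k202 k022 k211 k121 k112 : K)
    (a0 a1 a2 b0 b1 b2 : K) (L3 := fun x y z => a0 * x + a1 * y + a2 * z)
    (L4 := fun x y z => b0 * x + b1 * y + b2 * z) :
  (forall x y z, H x y z = x ^+ 4 * k400 + y ^+ 4 * k040 + z ^+ 4 * k004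
    + x ^+ 3 * y * k310 + x ^+ 3 * z * k301 + x * y ^+ 3 * k130
    + y ^+ 3 * z * k031 + x * z ^+ 3 * k103 + y * z ^+ 3 * k013
    + x ^+ 2 * y ^+ 2 * k220 + x ^+ 2 * z ^+ 2 * k202
    + y ^+ 2 * z ^+ 2 * k022 + x ^+ 2 * y * z * k211
    + x * y ^+ 2 * z * k121 + x * y * z ^+ 2 * k112) ->
  [/\ a0 != 0, a1 != 0 & a2 != 0] -> [/\ b0 != 0, b1 != 0 & b2 != 0] ->
  [/\ a1 * b2 - a2 * b1 != 0, a0 * b2 - a2 * b0 != 0 & a0 * b1 - a1 * b0 != 0] ->
  [/\ H 1 0 0 = 0, H 0 1 0 = 0 & H 0 0 1 = 0] ->
  [/\ H 0 a2 (- a1) = 0, H a2 0 (- a0) = 0 & H a1 (- a0) 0 = 0] ->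
  [/\ H 0 b2 (- b1) = 0, H b2 0 (- b0) = 0 & H b1 (- b0) 0 = 0] ->
  H (a1 * b2 - a2 * b1) (a2 * b0 - a0 * b2) (a0 * b1 - a1 * b0) = 0 ->
  exists c0 c1 c2 c3 c4, forall x y z, H x y z =
    c0 * (y * z * L3 x y z * L4 x y z) + c1 * (x * z * L3 x y z * L4 x y z)
    + c2 * (x * y * L3 x y z * L4 x y z) + c3 * (x * y * z * L4 x y z) + c4 * (x * y * z * L3 x y z).
Proof.
move=> HE [a00 a10 a20] [b00 b10 b20] [d12 d02 d01] [h1 h2 h3] [e0 e1 e2] [f0 f1 f2] hv.
have z400 : k400 = 0 by rewrite -h1 HE; ring.
have z040 : k040 = 0 by rewrite -h2 HE; ring.
have z004 : k004 = 0 by rewrite -h3 HE; ring.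
have Q (x y P : K) : x != 0 -> y != 0 -> - (x * y) * P = 0 -> P = 0.
  move=> x0 y0 /eqP; rewrite mulf_eq0 oppr_eq0 mulf_eq0 (negbTE x0) (negbTE y0) /=.
  by move/eqP.
have [c0 [k031E k022E k013E]] : exists c, [/\ k031 = c * (a1 * b1),
    k022 = c * (a1 * b2 + a2 * b1) & k013 = c * (a2 * b2)].
  apply: binary_quadratic => //.
    by apply: (Q a1 a2) => //; rewrite -[RHS]e0 HE z040 z004; ring.
  by apply: (Q b1 b2) => //; rewrite -[RHS]f0 HE z040 z004; ring.
have [c1 [k301E k202E k103E]] : exists c, [/\ k301 = c * (a0 * b0),
    k202 = c * (a0 * b2 + a2 * b0) & k103 = c * (a2 * b2)].
  apply: binary_quadratic => //.
    by apply: (Q a0 a2) => //; rewrite -[RHS]e1 HE z400 z004; ring.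
  by apply: (Q b0 b2) => //; rewrite -[RHS]f1 HE z400 z004; ring.
have [c2 [k310E k220E k130E]] : exists c, [/\ k310 = c * (a0 * b0),
    k220 = c * (a0 * b1 + a1 * b0) & k130 = c * (a1 * b1)].
  apply: binary_quadratic => //.
    by apply: (Q a0 a1) => //; rewrite -[RHS]e2 HE z400 z040; ring.
  by apply: (Q b0 b1) => //; rewrite -[RHS]f2 HE z400 z040; ring.
pose X := k211 - c0 * (a0 * b0) - c1 * (a0 * b1 + a1 * b0) - c2 * (a0 * b2 + a2 * b0).
pose Y := k121 - c0 * (a0 * b1 + a1 * b0) - c1 * (a1 * b1) - c2 * (a1 * b2 + a2 * b1).
pose Z := k112 - c0 * (a0 * b2 + a2 * b0) - c1 * (a1 * b2 + a2 * b1) - c2 * (a2 * b2).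
have HX x y z : H x y z = c0 * (y * z * L3 x y z * L4 x y z) + c1 * (x * z * L3 x y z * L4 x y z)
    + c2 * (x * y * L3 x y z * L4 x y z) + x * y * z * (X * x + Y * y + Z * z).
  rewrite HE z400 z040 z004 k031E k022E k013E k301E k202E k103E k310E k220E k130E.
  by rewrite /X /Y /Z /L3 /L4; ring.
have [c4 [c3 [XE YE ZE]]] : exists c e, [/\ X = c * a0 + e * b0, Y = c * a1 + e * b1 &
    Z = c * a2 + e * b2].
  apply: linear_pencil => //; apply: (Q (a1 * b2 - a2 * b1) (a2 * b0 - a0 * b2)) => //.
    by rewrite -oppr_eq0 opprB.
  apply: (mulfI d01); rewrite mulr0 -[RHS]oppr0 -hv HX /L3 /L4; ring.
exists c0, c1, c2, c3, c4 => x y z; rewrite HX XE YE ZE /L3 /L4; ring.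
Qed.
End TenVertices.

Section Pentalateral.
Variable K : numFieldType.
Variables (h : {mpoly K[3]}) (l : 'I_5 -> 'rV[K]_3).
Hypothesis hh : h \is 4.-homog.
Hypothesis lc : complete_pentalateral l.
Hypothesis lv : forall i j p, i != j ->
  (linform (l i)).@[p] = 0 -> (linform (l j)).@[p] = 0 -> h.@[p] = 0.
Let D := det3 (l 0) (l 1) (l 2).
Let D0 : D != 0. Proof. exact: lc. Qed.

Lemma pent_vertex i j c : i != j -> h.@[(c *: cross (l i) (l j)) 0] = 0.
Proof.
move=> ij; have Z a : dot3 a (c *: cross (l i) (l j)) = c * dot3 a (cross (l i) (l j)).
  by rewrite !dot3E !mxE; ring.
by apply: (lv ij); rewrite meval_linform Z dot3_cross mulr0.
Qed.

Lemma det3_lin (a b c : 'rV[K]_3) (x0 x1 x2 y0 y1 y2 : K)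
    (s := x0 *: a + x1 *: b + x2 *: c) (t := y0 *: a + y1 *: b + y2 *: c) :
  [/\ det3 b c s = det3 a b c * x0, det3 c a s = det3 a b c * x1 & det3 a b s = det3 a b c * x2] /\
  [/\ det3 a s t = det3 a b c * (x1 * y2 - x2 * y1), det3 b s t = det3 a b c * (x2 * y0 - x0 * y2) &
      det3 c s t = det3 a b c * (x0 * y1 - x1 * y0)].
Proof. by split; split; rewrite !det3E !dot3E !vec3E !mxE; ring. Qed.

Lemma pent_coord a : exists x y z, a = x *: l 0 + y *: l 1 + z *: l 2.
Proof.
exists (dot3 a (cross (l 1) (l 2)) / D), (dot3 a (cross (l 2) (l 0)) / D),
  (dot3 a (cross (l 0) (l 1)) / D).
apply: (scalerI D0); rewrite {1}/D cramer3' !scalerDr !scalerA.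
by congr (_ *: _ + _ *: _ + _ *: _); rewrite mulrC divfK.
Qed.

Lemma pent_decomp : exists (a0 a1 a2 b0 b1 b2 : K) (c : nat -> K),
  [/\ l 3 = a0 *: l 0 + a1 *: l 1 + a2 *: l 2 /\ l 4 = b0 *: l 0 + b1 *: l 1 + b2 *: l 2,
   [/\ a0 != 0, a1 != 0 & a2 != 0] /\ [/\ b0 != 0, b1 != 0 & b2 != 0],
   [/\ a1 * b2 - a2 * b1 != 0, a0 * b2 - a2 * b0 != 0 & a0 * b1 - a1 * b0 != 0] &
   forall p : 'rV[K]_3, h.@[p 0] =
     c 0%N * (dot3 (l 1) p * dot3 (l 2) p * dot3 (l 3) p * dot3 (l 4) p)
     + c 1%N * (dot3 (l 0) p * dot3 (l 2) p * dot3 (l 3) p * dot3 (l 4) p)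
     + c 2%N * (dot3 (l 0) p * dot3 (l 1) p * dot3 (l 3) p * dot3 (l 4) p)
     + c 3%N * (dot3 (l 0) p * dot3 (l 1) p * dot3 (l 2) p * dot3 (l 4) p)
     + c 4%N * (dot3 (l 0) p * dot3 (l 1) p * dot3 (l 2) p * dot3 (l 3) p)].
Proof.
have [a0 [a1 [a2 E3]]] := pent_coord (l 3); have [b0 [b1 [b2 E4]]] := pent_coord (l 4).
have [[da0 da1 da2] [d0 d1 d2]] := det3_lin (l 0) (l 1) (l 2) a0 a1 a2 b0 b1 b2.
have [[db0 db1 db2] _] := det3_lin (l 0) (l 1) (l 2) b0 b1 b2 b0 b1 b2.
rewrite -E3 -/D in da0 da1 da2; rewrite -E4 -/D in db0 db1 db2; rewrite -E3 -E4 -/D in d0 d1 d2.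
have nz i j k x : det3 (l i) (l j) (l k) = D * x -> i != j -> i != k -> j != k -> x != 0.
  move=> E ij ik jk; have := lc ij ik jk; rewrite E mulf_eq0 negb_or => /andP[_].
  by [].
have a00 := nz _ _ _ _ da0 isT isT isT; have a10 := nz _ _ _ _ da1 isT isT isT.
have a20 := nz _ _ _ _ da2 isT isT isT; have b00 := nz _ _ _ _ db0 isT isT isT.
have b10 := nz _ _ _ _ db1 isT isT isT; have b20 := nz _ _ _ _ db2 isT isT isT.
have m12 := nz _ _ _ _ d0 isT isT isT; have m02 := nz _ _ _ _ d1 isT isT isT.
have m01 := nz _ _ _ _ d2 isT isT isT.
have m02' : a0 * b2 - a2 * b0 != 0 by rewrite -oppr_eq0 opprB.
pose e0 := D^-1 *: cross (l 1) (l 2); pose e1 := D^-1 *: cross (l 2) (l 0).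
pose e2 := D^-1 *: cross (l 0) (l 1).
pose H x y z := h.@[(x *: e0 + y *: e1 + z *: e2) 0].
have Hv x y z i j c : i != j -> x *: e0 + y *: e1 + z *: e2 = c *: cross (l i) (l j) -> H x y z = 0.
  by move=> ij E; rewrite /H E pent_vertex.
have l0l3 (u v w : 'rV[K]_3) (x y z : K) (s := x *: u + y *: v + z *: w) : [/\
   cross u s = y *: cross u v - z *: cross w u, cross v s = z *: cross v w - x *: cross u v &
   cross w s = x *: cross w u - y *: cross v w].
  by split; apply: vec3P; rewrite /s !mxE /= ; ring.
have l3l4 (u v w : 'rV[K]_3) (x y z x' y' z' : K) :
  cross (x *: u + y *: v + z *: w) (x' *: u + y' *: v + z' *: w) =
  (y * z' - z * y') *: cross v w + (z * x' - x * z') *: cross w u + (x * y' - y * x') *: cross u v.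
  by apply: vec3P; rewrite !mxE /=; ring.
have [c0 [c1 [c2 [c3 [c4 HE]]]]] : exists c0 c1 c2 c3 c4, forall x y z, H x y z =
    c0 * (y * z * (a0 * x + a1 * y + a2 * z) * (b0 * x + b1 * y + b2 * z))
    + c1 * (x * z * (a0 * x + a1 * y + a2 * z) * (b0 * x + b1 * y + b2 * z))
    + c2 * (x * y * (a0 * x + a1 * y + a2 * z) * (b0 * x + b1 * y + b2 * z))
    + c3 * (x * y * z * (b0 * x + b1 * y + b2 * z)) + c4 * (x * y * z * (a0 * x + a1 * y + a2 * z)).
  pose T := pol4 (fbar h).
  apply: (@ten_vertices_coord K H (T e0 e0 e0 e0) (T e1 e1 e1 e1) (T e2 e2 e2 e2)
    (T e0 e0 e0 e1 *+ 4) (T e0 e0 e0 e2 *+ 4) (T e0 e1 e1 e1 *+ 4) (T e1 e1 e1 e2 *+ 4)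
    (T e0 e2 e2 e2 *+ 4) (T e1 e2 e2 e2 *+ 4) (T e0 e0 e1 e1 *+ 6) (T e0 e0 e2 e2 *+ 6)
    (T e1 e1 e2 e2 *+ 6) (T e0 e0 e1 e2 *+ 12) (T e0 e1 e1 e2 *+ 12) (T e0 e1 e2 e2 *+ 12)) => //.
  - by move=> x y z; rewrite /H -pol4_fbar // pol4_trinomial /T; ring.
  - split; [apply: (@Hv _ _ _ 1 2 D^-1) | apply: (@Hv _ _ _ 2 0 D^-1) | apply: (@Hv _ _ _ 0 1 D^-1)] => //;
      by rewrite !scale0r scale1r ?addr0 ?add0r.
  - have [E0 E1 E2] := l0l3 (l 0) (l 1) (l 2) a0 a1 a2.
    split; [apply: (@Hv _ _ _ 0 3 (- D^-1)) | apply: (@Hv _ _ _ 1 3 D^-1) |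
      apply: (@Hv _ _ _ 2 3 (- D^-1))] => //; rewrite E3 ?E0 ?E1 ?E2 /e0 /e1 /e2;
      by apply/rowP => i; rewrite !mxE; ring.
  - have [E0 E1 E2] := l0l3 (l 0) (l 1) (l 2) b0 b1 b2.
    split; [apply: (@Hv _ _ _ 0 4 (- D^-1)) | apply: (@Hv _ _ _ 1 4 D^-1) |
      apply: (@Hv _ _ _ 2 4 (- D^-1))] => //; rewrite E4 ?E0 ?E1 ?E2 /e0 /e1 /e2;
      by apply/rowP => i; rewrite !mxE; ring.
  - apply: (@Hv _ _ _ 3 4 D^-1) => //; rewrite E3 E4 l3l4 /e0 /e1 /e2.
    by apply/rowP => i; rewrite !mxE; ring.
exists a0, a1, a2, b0, b1, b2, (nth 0 [:: c0; c1; c2; c3; c4]); split=> // p.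
have {1}-> : p = dot3 (l 0) p *: e0 + dot3 (l 1) p *: e1 + dot3 (l 2) p *: e2.
  apply: (scalerI D0); rewrite {1}/D cramer3 !scalerDr !scalerA !(dot3C p).
  by congr (_ *: _ + _ *: _ + _ *: _); rewrite mulrAC divff // mul1r.
rewrite -/(H _ _ _) HE /=.
have dl (u v w : 'rV[K]_3) x y z :
    dot3 (x *: u + y *: v + z *: w) p = x * dot3 u p + y * dot3 v p + z * dot3 w p.
  by rewrite !dot3E !mxE; ring.
by rewrite [l 3]E3 [l 4]E4 !dl.
Qed.
End Pentalateral.

(* The conic is obtained from a line by the Cremona transformation inverting the
   coordinates in the basis u, v, w. *)
Lemma conic_through_five (K : numFieldType) (u v w : 'rV[K]_3) (a0 a1 a2 b0 b1 b2 : K) :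
  [/\ a0 != 0, a1 != 0 & a2 != 0] -> [/\ b0 != 0, b1 != 0 & b2 != 0] ->
  [/\ a1 * b2 - a2 * b1 != 0, a0 * b2 - a2 * b0 != 0 & a0 * b1 - a1 * b0 != 0] ->
  exists p0 p1 p2 t0 t1 t2 m0 m1 m2 m3 m4,
  [/\ u = m0 *: nu p0 p1 p2 t0, v = m1 *: nu p0 p1 p2 t1, w = m2 *: nu p0 p1 p2 t2,
      a0 *: u + a1 *: v + a2 *: w = m3 *: nu p0 p1 p2 0 &
      b0 *: u + b1 *: v + b2 *: w = m4 *: nu p0 p1 p2 1].
Proof.
move=> [a00 a10 a20] [b00 b10 b20] [d12 d02 d01].
(* The conic is the image of the line A + t F through 1/a (t = 0) and 1/(s b) (t = 1). The scalar s
   makes all F_i nonzero, so that the line meets the three coordinate lines at finite parameters -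
   A_i / F_i. *)
have [n] := natr_notin [:: 0; a0 / b0; a1 / b1; a2 / b2].
rewrite !inE !negb_or => /and4P[]; set s : K := n%:R => s0 sa0 sa1 sa2.
have E0 (a b : K) : a != 0 -> b != 0 -> s != a / b -> (s * b)^-1 - a^-1 != 0.
  move=> an bn; apply: contra; rewrite subr_eq0 => /eqP/invr_inj <-.
  by rewrite mulfK.
pose A0 := a0^-1; pose A1 := a1^-1; pose A2 := a2^-1.
pose F0 := (s * b0)^-1 - A0; pose F1 := (s * b1)^-1 - A1; pose F2 := (s * b2)^-1 - A2.
have F00 : F0 != 0 by apply: E0.
have F10 : F1 != 0 by apply: E0.
have F20 : F2 != 0 by apply: E0.
pose p0 := (A1 * A2) *: u + (A0 * A2) *: v + (A0 * A1) *: w.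
pose p1 := (A1 * F2 + F1 * A2) *: u + (A0 * F2 + F0 * A2) *: v + (A0 * F1 + F0 * A1) *: w.
pose p2 := (F1 * F2) *: u + (F0 * F2) *: v + (F0 * F1) *: w.
have nuE t : nu p0 p1 p2 t = ((A1 + t * F1) * (A2 + t * F2)) *: u +
    ((A0 + t * F0) * (A2 + t * F2)) *: v + ((A0 + t * F0) * (A1 + t * F1)) *: w.
  by apply/rowP => i; rewrite /nu !mxE; ring.
have Z (A F : K) : F != 0 -> A + - (A / F) * F = 0 by move=> h; field.
have C (a b a' b' : K) : a != 0 -> b != 0 -> a' != 0 -> b' != 0 -> a * b' - a' * b != 0 ->
    (s * b)^-1 - a^-1 != 0 ->
    a'^-1 + - (a^-1 / ((s * b)^-1 - a^-1)) * ((s * b')^-1 - a'^-1) != 0.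
  move=> an bn an' bn' dn Fn.
  set P := (s * b)^-1 - a^-1 in Fn *.
  have E : (a'^-1 + - (a^-1 / P) * ((s * b')^-1 - a'^-1)) * P =
      (a * b' - a' * b) / (s * a * a' * b * b').
    rewrite mulrDl mulNr mulNr [_ / P * _ * P]mulrAC divfK // /P; field.
    by rewrite s0 an bn an' bn'.
  have : (a * b' - a' * b) / (s * a * a' * b * b') != 0.
    by rewrite mulf_neq0 // invr_eq0 !mulf_neq0.
  by rewrite -E mulf_eq0 negb_or => /andP[].
have d12' : a2 * b1 - a1 * b2 != 0 by rewrite -oppr_eq0 opprB.
have d02' : a2 * b0 - a0 * b2 != 0 by rewrite -oppr_eq0 opprB.
have d01' : a1 * b0 - a0 * b1 != 0 by rewrite -oppr_eq0 opprB.
exists p0, p1, p2, (- (A0 / F0)), (- (A1 / F1)), (- (A2 / F2)).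
exists ((A1 + - (A0 / F0) * F1) * (A2 + - (A0 / F0) * F2))^-1.
exists ((A0 + - (A1 / F1) * F0) * (A2 + - (A1 / F1) * F2))^-1.
exists ((A0 + - (A2 / F2) * F0) * (A1 + - (A2 / F2) * F1))^-1.
exists (a0 * a1 * a2), (s ^+ 2 * b0 * b1 * b2); split.
- by rewrite nuE Z // !mul0r !scale0r !addr0 scalerA mulVf ?scale1r // mulf_neq0 // C.
- by rewrite nuE Z // mul0r mulr0 !scale0r addr0 add0r scalerA mulVf ?scale1r // mulf_neq0 // C.
- by rewrite nuE Z // !mulr0 !scale0r !add0r scalerA mulVf ?scale1r // mulf_neq0 // C.
- rewrite nuE !mul0r !addr0 /A0 /A1 /A2 !scalerDr !scalerA.
  by congr (_ *: _ + _ *: _ + _ *: _); field; rewrite ?a00 ?a10 ?a20.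
- rewrite nuE !mul1r /F0 /F1 /F2 !(addrC _ (_ - _)) !subrK !scalerDr !scalerA.
  by congr (_ *: _ + _ *: _ + _ *: _); field; rewrite s0 ?b00 ?b10 ?b20.
Qed.

Lemma pentalateral_pent_form (K : numFieldType) (h : {mpoly K[3]}) : pentalateral_quartic h ->
  exists p0 p1 p2 t kap, h = pent_form p0 p1 p2 t kap.
Proof.
case=> hh _ [l lc lv].
have [a0 [a1 [a2 [b0 [b1 [b2 [c [[E3 E4] [an bn] dn hE]]]]]]]] := pent_decomp hh lc lv.
have [p0 [p1 [p2 [t0 [t1 [t2 [m0 [m1 [m2 [m3 [m4 [L0 L1 L2]]]]]]]]]]]] :=
  @conic_through_five K (l 0) (l 1) (l 2) _ _ _ _ _ _ an bn dn.
rewrite -E3 -E4 => L3 L4.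
pose t := nth 0 [:: t0; t1; t2; 0; 1]; pose m := nth 0 [:: m0; m1; m2; m3; m4].
have lE (i : 'I_5) : l i = m i *: nu p0 p1 p2 (t i).
  case: i => [[|[|[|[|[|//]]]]] hi]; [rewrite [RHS]/= -L0 | rewrite [RHS]/= -L1 |
    rewrite [RHS]/= -L2 | rewrite [RHS]/= -L3 | rewrite [RHS]/= -L4];
  by congr l; apply: val_inj.
have tn (i j : nat) : (i < 5)%N -> (j < 5)%N -> i != j -> t j - t i != 0.
  move=> hi hj ij.
  (* A third line: equal parameters would make the determinant of the three vanish. *)
  have [k ki kj] : exists2 k : 'I_5, Ordinal hi != k & Ordinal hj != k.
    move: hi hj ij; case: i => [|[|[|[|[|//]]]]]; case: j => [|[|[|[|[|//]]]]] hi hj // _;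
    by [exists ord0 | exists (inord 1); rewrite -?val_eqE /= ?inordK |
        exists (inord 2); rewrite -?val_eqE /= ?inordK].
  have ij' : Ordinal hi != Ordinal hj by rewrite -val_eqE.
  have := lc _ _ _ ij' ki kj; rewrite !lE; apply: contra => /eqP tij.
  have -> : det3 (m i *: nu p0 p1 p2 (t i)) (m j *: nu p0 p1 p2 (t j)) (m k *: nu p0 p1 p2 (t k)) =
    m i * m j * m k * det3 (nu p0 p1 p2 (t i)) (nu p0 p1 p2 (t j)) (nu p0 p1 p2 (t k)).
    by rewrite !det3E !dot3E !vec3E !mxE; ring.
  by rewrite det3_nu tij !(mul0r, mulr0).
pose kap k := c k * (m (bump k 0) * m (bump k 1) * m (bump k 2) * m (bump k 3)) /
  vdm4 (t (bump k 0)) (t (bump k 1)) (t (bump k 2)) (t (bump k 3)) ^+ 2.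
have v0 (k : 'I_5) : vdm4 (t (bump k 0)) (t (bump k 1)) (t (bump k 2)) (t (bump k 3)) != 0.
  by rewrite /vdm4 !mulf_neq0 ?tn //; case: k => [[|[|[|[|[|//]]]]] hk].
exists p0, p1, p2, t, kap; apply: homog4_ext => // [|p]; first exact: pent_form_homog.
rewrite hE /pent_form raddf_sum /=.
have dl (i : 'I_5) : dot3 (l i) p = m i * dot3 (nu p0 p1 p2 (t i)) p.
  by rewrite lE !dot3E !mxE; ring.
under [RHS]eq_bigr => k _ do rewrite mevalZ !mevalM !meval_linform /kap divfK ?expf_neq0 //.
rewrite (@sum5E K (fun k => c k * (m (bump k 0) * m (bump k 1) * m (bump k 2) * m (bump k 3)) *
  (dot3 (nu p0 p1 p2 (t (bump k 0))) p * dot3 (nu p0 p1 p2 (t (bump k 1))) p *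
   dot3 (nu p0 p1 p2 (t (bump k 2))) p * dot3 (nu p0 p1 p2 (t (bump k 3))) p))) !dl.
rewrite -[(bump 0 0)]/1%N -[bump 0 1]/2%N -[bump 0 2]/3%N -[bump 0 3]/4%N
  -[(bump 1 0)]/0%N -[bump 1 1]/2%N -[bump 1 2]/3%N -[bump 1 3]/4%N
  -[(bump 2 0)]/0%N -[bump 2 1]/1%N -[bump 2 2]/3%N -[bump 2 3]/4%N
  -[(bump 3 0)]/0%N -[bump 3 1]/1%N -[bump 3 2]/2%N -[bump 3 3]/4%N
  -[(bump 4 0)]/0%N -[bump 4 1]/1%N -[bump 4 2]/2%N -[bump 4 3]/3%N.
pose x i := m i * dot3 (nu p0 p1 p2 (t i)) p.
transitivity (c 0%N * (x 1%N * x 2%N * x 3%N * x 4%N) + c 1%N * (x 0%N * x 2%N * x 3%N * x 4%N)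
  + c 2%N * (x 0%N * x 1%N * x 3%N * x 4%N) + c 3%N * (x 0%N * x 1%N * x 2%N * x 4%N)
  + c 4%N * (x 0%N * x 1%N * x 2%N * x 3%N)); first by [].
rewrite /x; move: (c) (m) (t) => c' m' t'.
move: (dot3 (nu p0 p1 p2 (t' 0%N)) p) (dot3 (nu p0 p1 p2 (t' 1%N)) p)
  (dot3 (nu p0 p1 p2 (t' 2%N)) p) (dot3 (nu p0 p1 p2 (t' 3%N)) p) (dot3 (nu p0 p1 p2 (t' 4%N)) p).
by move=> y0 y1 y2 y3 y4; ring.
Qed.

Definition lin2 (A : comNzRingType) (a b : 'rV[A]_3) : 'I_6 -> A :=
  conic_coord (linform a * linform b).
Definition lin4 (A : comNzRingType) (a b c d : 'rV[A]_3) : 'cV[A]_15 :=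
  Hbar (linform a * linform b * linform c * linform d).
(* The conic through the points nu t, up to a factor. *)
Definition nu_conic (A : comNzRingType) (p0 p1 p2 : 'rV[A]_3) : 'I_6 -> A :=
  fun i => lin2 (cross p2 p0) (cross p2 p0) i - lin2 (cross p1 p2) (cross p0 p1) i.

Section Lin.
Variable A : comNzRingType.
Implicit Types a b c d : 'rV[A]_3.

Lemma ev2_lin2 a b c : ev2 (lin2 a b) c = dot3 a c * dot3 b c.
Proof.
rewrite ev2_conic_coord ?mevalM ?meval_linform //.
by rewrite -[2%N]/(1 + 1)%N; apply: dhomogM; apply: linform_homog.
Qed.

Lemma pair15_lin4 a b c d e :
  pair15 (ver4 e) (lin4 a b c d) = dot3 a e * dot3 b e * dot3 c e * dot3 d e.
Proof.
rewrite pair15_Hbar ?mevalM ?meval_linform // -[4%N]/(1 + 1 + 1 + 1)%N.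
by do 3! (apply: dhomogM; last exact: linform_homog); exact: linform_homog.
Qed.

Lemma ev2_nu_conic (p0 p1 p2 c : 'rV[A]_3) : ev2 (nu_conic p0 p1 p2) c =
  dot3 (cross p2 p0) c ^+ 2 - dot3 (cross p1 p2) c * dot3 (cross p0 p1) c.
Proof.
rewrite expr2 -!ev2_lin2 /ev2 -sumrB; apply: eq_bigr => i _.
by rewrite /nu_conic mulrBl.
Qed.

Lemma ev2_nu_conic_nu (p0 p1 p2 : 'rV[A]_3) t : ev2 (nu_conic p0 p1 p2) (nu p0 p1 p2 t) = 0.
Proof.
have E : [/\ dot3 (cross p2 p0) (nu p0 p1 p2 t) = det3 p0 p1 p2 * t,
    dot3 (cross p1 p2) (nu p0 p1 p2 t) = det3 p0 p1 p2 &
    dot3 (cross p0 p1) (nu p0 p1 p2 t) = det3 p0 p1 p2 * t ^+ 2].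
  by split; rewrite det3E /nu !dot3E !vec3E !mxE; ring.
by case: E => E1 E2 E3; rewrite ev2_nu_conic E1 E2 E3; ring.
Qed.
End Lin.

Section Naturality.
Variables (A A' : comNzRingType) (phi : {rmorphism A -> A'}).
Local Notation "M ^phi" := (map_mx phi M) (at level 2).

Lemma cross_map (a b : 'rV[A]_3) : (cross a b)^phi = cross a^phi b^phi.
Proof. by apply: vec3P; rewrite vec3E mxE vec3E rmorphB !rmorphM !mxE. Qed.

Lemma nu_map (p0 p1 p2 : 'rV[A]_3) t : (nu p0 p1 p2 t)^phi = nu p0^phi p1^phi p2^phi (phi t).
Proof. by apply/rowP => i; rewrite !mxE !rmorphD !rmorphM. Qed.

Lemma ver4_map (a : 'rV[A]_3) : (ver4 a)^phi = ver4 a^phi.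
Proof.
apply/matrixP => p j; rewrite !mxE /mmap1 rmorph_prod; apply: eq_bigr => i _.
by rewrite rmorphXn mxE.
Qed.

Lemma linform_map (a : 'rV[A]_3) : map_mpoly phi (linform a) = linform a^phi.
Proof.
rewrite rmorph_sum; apply: eq_bigr => i _ /=.
by rewrite map_mpolyZ map_mpolyX mxE.
Qed.

Lemma lin2_map (a b : 'rV[A]_3) i : phi (lin2 a b i) = lin2 a^phi b^phi i.
Proof. by rewrite /lin2 /conic_coord -!linform_map -rmorphM mcoeff_map_mpoly. Qed.

Lemma nu_conic_map (p0 p1 p2 : 'rV[A]_3) i :
  phi (nu_conic p0 p1 p2 i) = nu_conic p0^phi p1^phi p2^phi i.
Proof. by rewrite /nu_conic rmorphB !lin2_map !cross_map. Qed.

Lemma lin4_map (a b c d : 'rV[A]_3) : (lin4 a b c d)^phi = lin4 a^phi b^phi c^phi d^phi.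
Proof. by apply/matrixP => i j; rewrite !mxE -!linform_map -!rmorphM mcoeff_map_mpoly. Qed.

Lemma pol4_map (u : 'cV[A]_15) (p q r s : 'rV[A]_3) :
  phi (pol4 u p q r s) = pol4 u^phi p^phi q^phi r^phi s^phi.
Proof.
rewrite /pol4 rmorph_sum; apply: eq_bigr => i _; rewrite rmorph_sum; apply: eq_bigr => j _.
rewrite rmorph_sum; apply: eq_bigr => k _; rewrite rmorph_sum; apply: eq_bigr => l _.
by rewrite !rmorphM !mxE.
Qed.

Lemma pair15_map (u v : 'cV[A]_15) : phi (pair15 u v) = pair15 u^phi v^phi.
Proof. by rewrite rmorph_sum; apply: eq_bigr => i _; rewrite rmorphM !mxE. Qed.

Lemma pent_form_map (p0 p1 p2 : 'rV[A]_3) (t kap : nat -> A) :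
  map_mpoly phi (pent_form p0 p1 p2 t kap) =
  pent_form p0^phi p1^phi p2^phi (phi \o t) (phi \o kap).
Proof.
have vE a b c d : phi (vdm4 a b c d ^+ 2) = vdm4 (phi a) (phi b) (phi c) (phi d) ^+ 2.
  by rewrite rmorphXn /vdm4 !rmorphM !rmorphB.
have lE j : map_mpoly phi (pent_line p0 p1 p2 t j) = pent_line p0^phi p1^phi p2^phi (phi \o t) j.
  by rewrite /pent_line linform_map nu_map.
rewrite /pent_form rmorph_sum; apply: eq_bigr => k _ /=.
by rewrite map_mpolyZ rmorphM vE 3!(rmorphM (map_mpoly phi)) /= !lE.
Qed.
End Naturality.

(** * Explicit solutions of L w = C q^2 *)

Section FieldIdentities.
Variable K : numFieldType.
Implicit Types (u : 'cV[K]_15) (p q : 'rV[K]_3).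

Lemma sqv_ext (q q' : 'I_6 -> K) : q =1 q' -> sqv q q = sqv q' q'.
Proof.
move=> h; apply/matrixP => i j; rewrite !mxE; do 2 (apply: eq_bigr => ? _).
by rewrite !h.
Qed.

(** At b the left side is the quartic at b x (p x q) = (b.q) p - (b.p) q, a point of the line pq,
    expanded as a binary quartic. If the line is tangent at p and q, only the middle term remains, a
    multiple of the square of the conic pq. *)
Lemma Lk_bitangent u p q : Lk u *m ver4 (cross p q) =
  (pol4 u p p q q *+ 6) *: sqv (lin2 p q) (lin2 p q) +
  (pol4 u p p p p *: lin4 q q q q - (pol4 u p p p q *+ 4) *: lin4 p q q q
   - (pol4 u q q q p *+ 4) *: lin4 p p p q + pol4 u q q q q *: lin4 p p p p).
Proof.
apply: ver4_eq => b; rewrite Lk_mul_ver4.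
have -> : cross b (cross p q) = dot3 b q *: p + (- dot3 b p) *: q.
  by apply: vec3P; rewrite !dot3E !mxE /=; ring.
rewrite pol4_lin44 -!scaleNr !pair15Dr !pair15Zr pair15_sqv !pair15_lin4 ev2_lin2.
rewrite (pol4C34 u q q q p) (pol4C23 u q q p q) (pol4C12 u q p q q) !(dot3C b).
by ring.
Qed.

(** The sum of the l_k^4 / kap_k, with denominators cleared: the quartic g of part (ii) up to a
    factor. *)
Definition pent_dual (A : comNzRingType) (p0 p1 p2 : 'rV[A]_3) (t kap : nat -> A) : 'cV[A]_15 :=
  \sum_(k < 5) (kap (bump k 0) * kap (bump k 1) * kap (bump k 2) * kap (bump k 3)) *:
    ver4 (nu p0 p1 p2 (t k)).

Lemma pent_dual_apolar (p0 p1 p2 : 'rV[K]_3) (t kap : nat -> K) r :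
  pair15 (pent_dual p0 p1 p2 t kap) (sqv (nu_conic p0 p1 p2) r) = 0.
Proof.
rewrite pair15_suml big1 // => k _.
by rewrite pair15_sqv ev2_nu_conic_nu mul0r mulr0.
Qed.

Lemma dot3_cross_nu' (p0 p1 p2 a : 'rV[K]_3) s t : dot3 (nu p0 p1 p2 s) (cross a (nu p0 p1 p2 t)) =
  - ((t - s) * bip (dot3 (cross p1 p2) a) (dot3 (cross p2 p0) a) (dot3 (cross p0 p1) a) s t).
Proof. by rewrite /nu /bip !dot3E !vec3E !mxE; ring. Qed.

(** As in [Lk_scorza]: on the line l_k only the summand without the factor l_k survives. *)
Lemma Lk_pent_dual (p0 p1 p2 : 'rV[K]_3) (t kap : nat -> K) :
  Lk (fbar (pent_form p0 p1 p2 t kap)) *m pent_dual p0 p1 p2 t kap =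
  (kap 0%N * kap 1%N * kap 2%N * kap 3%N * kap 4%N *
    vdm5 (t 0%N) (t 1%N) (t 2%N) (t 3%N) (t 4%N) ^+ 2) *:
  sqv (nu_conic p0 p1 p2) (nu_conic p0 p1 p2).
Proof.
apply: ver4_eq => a; rewrite pair15Zr pair15_sqv ev2_nu_conic.
set x := dot3 (cross p1 p2) a; set y := dot3 (cross p2 p0) a; set z := dot3 (cross p0 p1) a.
rewrite /pent_dual mulmx_sumr.
under eq_bigr => k _ do rewrite -scalemxAr.
rewrite pair15_sumr.
pose l k := nu p0 p1 p2 (t k).
pose G k := kap (bump k 0) * kap (bump k 1) * kap (bump k 2) * kap (bump k 3) *
   (kap k * vdm4 (t (bump k 0)) (t (bump k 1)) (t (bump k 2)) (t (bump k 3)) ^+ 2 *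
    (((t k - t (bump k 0)) * bip x y z (t (bump k 0)) (t k)) *
     ((t k - t (bump k 1)) * bip x y z (t (bump k 1)) (t k)) *
     ((t k - t (bump k 2)) * bip x y z (t (bump k 2)) (t k)) *
     ((t k - t (bump k 3)) * bip x y z (t (bump k 3)) (t k)))).
transitivity (\sum_(k < 5) G k).
  apply: eq_bigr => k _; congr (_ * _).
  rewrite Lk_mul_ver4 pol4_fbar ?pent_form_homog // /pent_form raddf_sum (bigD1 k) //= big1 => [|j jk].
    by rewrite addr0 mevalZ !mevalM !meval_linform !dot3_cross_nu' -/x -/y -/z; congr (_ * _); ring.
  have lk0 : (pent_line p0 p1 p2 t k).@[cross a (l k) 0] = 0.
    by rewrite meval_linform dot3_cross.
  have [i ki] : exists i : 'I_4, k = lift j i :> nat.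
    by have [i ki _] := unlift_some jk; exists i; rewrite ki.
  rewrite mevalZ !mevalM; case: i ki => [[|[|[|[|//]]]] hi] /= <-;
    by rewrite lk0 !(mul0r, mulr0).
rewrite (@sum5E K G) /G.
rewrite -[(bump 0 0)]/1%N -[bump 0 1]/2%N -[bump 0 2]/3%N -[bump 0 3]/4%N
  -[(bump 1 0)]/0%N -[bump 1 1]/2%N -[bump 1 2]/3%N -[bump 1 3]/4%N
  -[(bump 2 0)]/0%N -[bump 2 1]/1%N -[bump 2 2]/3%N -[bump 2 3]/4%N
  -[(bump 3 0)]/0%N -[bump 3 1]/1%N -[bump 3 2]/2%N -[bump 3 3]/4%N
  -[(bump 4 0)]/0%N -[bump 4 1]/1%N -[bump 4 2]/2%N -[bump 4 3]/3%N.
transitivity (kap 0%N * kap 1%N * kap 2%N * kap 3%N * kap 4%N *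
  (vdm5 (t 0%N) (t 1%N) (t 2%N) (t 3%N) (t 4%N) * (y ^+ 2 - x * z)) ^+ 2); last by ring.
rewrite -vdm_bip2; move: (@bip K x y z) => B.
move: (t 0%N) (t 1%N) (t 2%N) (t 3%N) (t 4%N) (kap 0%N) (kap 1%N) (kap 2%N) (kap 3%N) (kap 4%N).
move=> t0 t1 t2 t3 t4 c0 c1 c2 c3 c4.
by move: (vdm4 t1 t2 t3 t4) (vdm4 t0 t2 t3 t4) (vdm4 t0 t1 t3 t4) (vdm4 t0 t1 t2 t4)
  (vdm4 t0 t1 t2 t3) => *; ring.
Qed.
End FieldIdentities.

(** * Singular points along one-parameter families *)

Section PolyFamilies.
Variable K : numFieldType.
Local Notation A := {poly K}.
Local Notation ev s := (horner_eval (s : K)).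
Implicit Types (u : 'cV[A]_15) (p q : 'rV[A]_3).

Lemma poly_ext (a b : A) : (forall s, a.[s] = b.[s]) -> a = b.
Proof.
move=> h; apply/eqP; rewrite -subr_eq0; apply/eqP/poly_horner0 => s.
by rewrite hornerD hornerN h subrr.
Qed.

(** Identities proved over K, where fourth powers span, pass in this way to polynomial
    coefficients. *)
Lemma mx_poly_ext m n (M N : 'M[A]_(m, n)) :
  (forall s, map_mx (ev s) M = map_mx (ev s) N) -> M = N.
Proof.
move=> h; apply/matrixP => i j; apply: poly_ext => s.
by have /matrixP/(_ i j) := h s; rewrite !mxE.
Qed.

Lemma Lvec_ev s u : map_mx (ev s) (Lvec (@polyC K) u) = Lk (map_mx (ev s) u).
Proof.
rewrite Lvec_map; apply/matrixP => i j; rewrite !mxE; apply: eq_bigr => p _.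
by rewrite /= /horner_eval hornerC.
Qed.

Lemma lin2_ev s p q i : (lin2 p q i).[s] = lin2 (map_mx (ev s) p) (map_mx (ev s) q) i.
Proof. exact: (lin2_map (ev s)). Qed.

Lemma Lvec_bitangent u p q : Lvec (@polyC K) u *m ver4 (cross p q) =
  (pol4 u p p q q *+ 6) *: sqv (lin2 p q) (lin2 p q) +
  (pol4 u p p p p *: lin4 q q q q - (pol4 u p p p q *+ 4) *: lin4 p q q q
   - (pol4 u q q q p *+ 4) *: lin4 p p p q + pol4 u q q q q *: lin4 p p p p).
Proof.
apply: mx_poly_ext => s; rewrite map_mxM Lvec_ev ver4_map cross_map Lk_bitangent.
rewrite !(map_mxD, map_mxN, map_mxZ) !lin4_map sqv_map !rmorphMn /= !(pol4_map (ev s)).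
by congr (_ *: _ + _); apply: sqv_ext => i; rewrite /= -(lin2_map (ev s)).
Qed.

Lemma dvdX_coprime k (a b : A) : a.[0] != 0 -> 'X^k %| a * b -> 'X^k %| b.
Proof.
move=> a0; rewrite Gauss_dvdpr // coprimep_sym; apply: coprimep_expr.
by rewrite -[X in coprimep _ X]subr0 -polyC0 coprimep_XsubC /root.
Qed.

Lemma dvdXP k (a : A) : reflect (exists b, a = 'X^k * b) ('X^k %| a).
Proof.
apply: (iffP idP) => [h|[b ->]]; last exact: dvdp_mulr.
by exists (a %/ 'X^k); rewrite mulrC divpK.
Qed.

(** A tangency holding modulo X^k gives a singular point modulo X^k: the error terms of
    [Lvec_bitangent] are multiples of X^k, and its main coefficient is prime to X. *)
Lemma WMd_bitangent k u p q : (pol4 u p p q q).[0] != 0 ->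
  'X^k %| pol4 u p p p p -> 'X^k %| pol4 u p p p q ->
  'X^k %| pol4 u q q q p -> 'X^k %| pol4 u q q q q ->
  forall j, 'X^k %| (WMd (@polyC K) u j).@[lin2 p q].
Proof.
move=> c0 /dvdXP[b1 E1] /dvdXP[b2 E2] /dvdXP[b3 E3] /dvdXP[b4 E4] j.
have LE := Lvec_bitangent u p q.
rewrite E1 E2 E3 E4 -!(mulrnAr 'X^k) -!scalerA -!scalerBr -!scalerDr in LE.
have [|z Ez] := WMd_singular LE _ j.
  by move=> i; rewrite pair15_sqv ev2_lin2 dot3_cross !mul0r.
apply: (@dvdX_coprime k (pol4 u p p q q *+ 6)); last by rewrite Ez dvdp_mulr.
by rewrite hornerMn mulrn_eq0.
Qed.

Lemma pol4_step1 k u p d : exists z, pol4 u (p + 'X^k *: d) (p + 'X^k *: d) (p + 'X^k *: d) (p + 'X^k *: d) =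
  pol4 u p p p p + 'X^k * (pol4 u p p p d *+ 4) + 'X^k * 'X^k * z.
Proof.
set x := 'X^k; have -> : p + x *: d = 1 *: p + x *: d by rewrite scale1r.
rewrite pol4_lin44.
exists (pol4 u p p d d *+ 6 + x * pol4 u p d d d *+ 4 + x ^+ 2 * pol4 u d d d d).
by ring.
Qed.

Lemma pol4_step2 k u p q d e : exists z, pol4 u (p + 'X^k *: d) (p + 'X^k *: d) (p + 'X^k *: d) (q + 'X^k *: e) =
  pol4 u p p p q + 'X^k * (pol4 u p p d q *+ 3 + pol4 u p p p e) + 'X^k * 'X^k * z.
Proof.
set x := 'X^k; have E (a b : 'rV[A]_3) : a + x *: b = 1 *: a + x *: b by rewrite scale1r.
rewrite (E p d) (E q e) pol4_lin33 !pol4_lin4.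
exists (pol4 u p p d e *+ 3 + pol4 u p d d q *+ 3 + x * pol4 u p d d e *+ 3
   + x * (pol4 u d d d q + x * pol4 u d d d e)).
by ring.
Qed.

Lemma dvdX_step k (a b z : A) : (0 < k)%N ->
  (exists2 r : A, a = 'X^k * r & r.[0] + b.[0] = 0) -> 'X^(k.+1) %| (a + 'X^k * b + 'X^k * 'X^k * z).
Proof.
move=> k0 [r -> h]; rewrite -mulrDr; apply: dvdp_add.
  rewrite exprSr dvdp_mul2l -?size_poly_eq0 ?size_polyXn //.
  by rewrite -['X]subr0 -polyC0 dvdp_XsubCl /root hornerD h.
by apply: dvdp_mulr; rewrite -exprD dvdp_exp2l // -addn1 leq_add2l.
Qed.

(* Newton iteration for the system expressing that the quartic restricted to the line
   through p and q is the square of the quadratic form vanishing at p and q. *)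
Lemma bitangent_hensel u (x y n : 'rV[K]_3) (u0 := map_mx (ev 0) u) :
  pol4 u0 x x x x = 0 -> pol4 u0 x x x y = 0 -> pol4 u0 y y y x = 0 -> pol4 u0 y y y y = 0 ->
  pol4 u0 x x y y != 0 -> pol4 u0 x x x n != 0 -> pol4 u0 y y y n != 0 ->
  forall k, exists p q, [/\ map_mx (ev 0) p = x, map_mx (ev 0) q = y,
    'X^(k.+1) %| pol4 u p p p p /\ 'X^(k.+1) %| pol4 u p p p q &
    'X^(k.+1) %| pol4 u q q q p /\ 'X^(k.+1) %| pol4 u q q q q].
Proof.
move=> xxxx xxxy yyyx yyyy c0 m0 m0'.
have evC (a : 'rV[K]_3) : map_mx (ev 0) (map_mx polyC a) = a.
  by apply/rowP => i; rewrite !mxE /horner_eval hornerC.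
have ev0 p q r s : (pol4 u p q r s).[0] =
    pol4 u0 (map_mx (ev 0) p) (map_mx (ev 0) q) (map_mx (ev 0) r) (map_mx (ev 0) s).
  exact: (pol4_map (ev 0)).
elim=> [|k [p [q [px qy [/dvdXP[r1 E1] /dvdXP[r2 E2]] [/dvdXP[r3 E3] /dvdXP[r4 E4]]]]]].
  exists (map_mx polyC x), (map_mx polyC y); split; rewrite ?evC //.
    by split; rewrite expr1 -['X]subr0 -polyC0 dvdp_XsubCl /root ev0 !evC ?xxxx ?xxxy.
  by split; rewrite expr1 -['X]subr0 -polyC0 dvdp_XsubCl /root ev0 !evC ?yyyx ?yyyy.
(* The corrections are d = a1 y + b1 n and e = a2 x + b2 n. As xxxx, xxxy, yyyx and yyyy vanish, the
   four linearized equations are triangular: the first and the last give b1 and b2, then the middle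
   ones give a1 and a2. *)
pose b1 := - r1.[0] / (pol4 u0 x x x n *+ 4).
pose b2 := - r4.[0] / (pol4 u0 y y y n *+ 4).
pose a1 := - (r2.[0] + b1 * pol4 u0 x x n y *+ 3 + b2 * pol4 u0 x x x n) / (pol4 u0 x x y y *+ 3).
pose a2 := - (r3.[0] + b2 * pol4 u0 y y n x *+ 3 + b1 * pol4 u0 y y y n) / (pol4 u0 x x y y *+ 3).
pose d := map_mx polyC (a1 *: y + b1 *: n); pose e := map_mx polyC (a2 *: x + b2 *: n).
have yyxx : pol4 u0 y y x x = pol4 u0 x x y y.
  by rewrite pol4C23 pol4C12 pol4C34 pol4C23.
have ev0X p' e' : map_mx (ev 0) (p' + 'X^(k.+1) *: e') = map_mx (ev 0) p' :> 'rV_3.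
  by apply/rowP => i; rewrite !mxE /horner_eval hornerD hornerM hornerXn expr0n mul0r addr0.
exists (p + 'X^(k.+1) *: d), (q + 'X^(k.+1) *: e); split; rewrite ?ev0X //; split.
- have [z ->] := pol4_step1 k.+1 u p d; apply: dvdX_step => //.
  exists r1 => //; rewrite hornerMn ev0 px evC pol4_lin4 xxxy /b1; field; exact: m0.
- have [z ->] := pol4_step2 k.+1 u p q d e; apply: dvdX_step => //.
  exists r2 => //; rewrite hornerD hornerMn !ev0 px qy !evC pol4_lin3 pol4_lin4 xxxx /a1.
  by field; exact: c0.
- have [z ->] := pol4_step2 k.+1 u q p e d; apply: dvdX_step => //.
  exists r3 => //; rewrite hornerD hornerMn !ev0 px qy !evC pol4_lin3 pol4_lin4 yyyy yyxx /a2.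
  by field; exact: c0.
- have [z ->] := pol4_step1 k.+1 u q e; apply: dvdX_step => //.
  exists r4 => //; rewrite hornerMn ev0 qy evC pol4_lin4 yyyx /b2; field; exact: m0'.
Qed.

Lemma bitangent_lift u (x y n : 'rV[K]_3) (u0 := map_mx (ev 0) u) :
  pol4 u0 x x x x = 0 -> pol4 u0 x x x y = 0 -> pol4 u0 y y y x = 0 -> pol4 u0 y y y y = 0 ->
  pol4 u0 x x y y != 0 -> pol4 u0 x x x n != 0 -> pol4 u0 y y y n != 0 ->
  forall k, exists q : 'I_6 -> A, (forall i, (q i).[0] = lin2 x y i) /\
    forall j, 'X^k %| (WMd (@polyC K) u j).@[q].
Proof.
move=> h1 h2 h3 h4 c0 m1 m2 k.
have [p [q [px qy [d1 d2] [d3 d4]]]] := bitangent_hensel h1 h2 h3 h4 c0 m1 m2 k.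
exists (lin2 p q); split=> [i|j]; first by rewrite lin2_ev px qy.
have le (a : A) : 'X^(k.+1) %| a -> 'X^k %| a.
  by apply: dvdp_trans; rewrite dvdp_exp2l.
apply: WMd_bitangent; try exact: le.
by rewrite -[_.[0]]/(ev 0 _) pol4_map px qy.
Qed.

Definition fbarP (H : {mpoly A[3]}) : 'cV[A]_15 :=
  \col_i (H@_(tnth mon4 i) * ((multi4 (tnth mon4 i))%:R^-1)%:P).

Lemma fbarP_ev s H : map_mx (ev s) (fbarP H) = fbar (map_mpoly (ev s) H).
Proof.
apply/matrixP => i j; rewrite !mxE /ncoef mcoeff_map_mpoly.
by rewrite /horner_eval hornerM hornerC.
Qed.

(** The smooth conic is singular along the whole family, so [WMd_singular] applies with e = 0, and
    the nonzero polynomial C is cancelled in the domain {poly K}. *)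
Lemma pent_form_lift (p0 p1 p2 : 'rV[A]_3) (t kap : nat -> A) :
  (kap 0%N * kap 1%N * kap 2%N * kap 3%N * kap 4%N *
    vdm5 (t 0%N) (t 1%N) (t 2%N) (t 3%N) (t 4%N) ^+ 2) != 0 ->
  forall j, (WMd (@polyC K) (fbarP (pent_form p0 p1 p2 t kap)) j).@[nu_conic p0 p1 p2] = 0.
Proof.
set C := _ * _ => C0 j; pose q := nu_conic p0 p1 p2; pose w := pent_dual p0 p1 p2 t kap.
have wE s : map_mx (ev s) w = pent_dual (map_mx (ev s) p0) (map_mx (ev s) p1) (map_mx (ev s) p2)
    (ev s \o t) (ev s \o kap).
  rewrite /w /pent_dual map_mx_sum; apply: eq_bigr => k _.
  by rewrite map_mxZ ver4_map nu_map !rmorphM.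
have qE s : ev s \o q =1 nu_conic (map_mx (ev s) p0) (map_mx (ev s) p1) (map_mx (ev s) p2).
  by move=> i; rewrite /= (nu_conic_map (ev s)).
have LE : Lvec (@polyC K) (fbarP (pent_form p0 p1 p2 t kap)) *m w = C *: sqv q q + 0 *: 0.
  rewrite scale0r addr0; apply: mx_poly_ext => s.
  rewrite map_mxM Lvec_ev fbarP_ev pent_form_map wE Lk_pent_dual map_mxZ sqv_map.
  rewrite (sqv_ext (qE s)); congr (_ *: _).
  by rewrite /C /vdm5 !(rmorphM, rmorphXn, rmorphB).
have apo i : pair15 w (sqv q (dirac A i)) = 0.
  apply: poly_ext => s; rewrite horner0 -[LHS]/(ev s _) pair15_map wE sqv_map.
  have -> : sqv (ev s \o q) (ev s \o dirac A i) =
     sqv (nu_conic (map_mx (ev s) p0) (map_mx (ev s) p1) (map_mx (ev s) p2)) (ev s \o dirac A i).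
    apply/matrixP => a b; rewrite !mxE; apply: eq_bigr => x _; apply: eq_bigr => y _.
    by rewrite (qE s).
  exact: pent_dual_apolar.
have [z] := WMd_singular LE apo j; rewrite mul0r => /eqP.
by rewrite mulf_eq0 (negbTE C0) => /eqP.
Qed.
End PolyFamilies.

(** * A pentalateral quartic with explicit bitangents *)

Section EdgeQuartic.
Variable K : numFieldType.
Implicit Types (p q r s : 'rV[K]_3).

(* x^4 + y^4 + z^4 + 7 (x^2 y^2 + y^2 z^2 + z^2 x^2), written as a sum of fourth powers. *)
Definition edge_vec : 'cV[K]_15 :=
  (- 4%:R / 3%:R) *: (ver4 (vec3 1 0 0) + ver4 (vec3 0 1 0) + ver4 (vec3 0 0 1)) +
  (7%:R / 12%:R) *: (ver4 (vec3 1 1 0) + ver4 (vec3 1 (-1) 0) + ver4 (vec3 1 0 1) +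
    ver4 (vec3 1 0 (-1)) + ver4 (vec3 0 1 1) + ver4 (vec3 0 1 (-1))).

Lemma pol4_edge p q r s : pol4 edge_vec p q r s =
  - 4%:R / 3%:R * (p 0 0 * q 0 0 * r 0 0 * s 0 0 + p 0 1 * q 0 1 * r 0 1 * s 0 1
     + p 0 2 * q 0 2 * r 0 2 * s 0 2)
  + 7%:R / 12%:R * (
     (p 0 0 + p 0 1) * (q 0 0 + q 0 1) * (r 0 0 + r 0 1) * (s 0 0 + s 0 1)
   + (p 0 0 - p 0 1) * (q 0 0 - q 0 1) * (r 0 0 - r 0 1) * (s 0 0 - s 0 1)
   + (p 0 0 + p 0 2) * (q 0 0 + q 0 2) * (r 0 0 + r 0 2) * (s 0 0 + s 0 2)
   + (p 0 0 - p 0 2) * (q 0 0 - q 0 2) * (r 0 0 - r 0 2) * (s 0 0 - s 0 2)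
   + (p 0 1 + p 0 2) * (q 0 1 + q 0 2) * (r 0 1 + r 0 2) * (s 0 1 + s 0 2)
   + (p 0 1 - p 0 2) * (q 0 1 - q 0 2) * (r 0 1 - r 0 2) * (s 0 1 - s 0 2)).
Proof.
have D (u v : 'cV[K]_15) : pol4 (u + v) p q r s = pol4 u p q r s + pol4 v p q r s.
  by rewrite -[u in LHS]scale1r -[v in LHS]scale1r pol4_linu !mul1r.
have E (x y z : K) a : dot3 (vec3 x y z) a = x * a 0 0 + y * a 0 1 + z * a 0 2.
  by rewrite dot3E !vec3E.
rewrite /edge_vec pol4_linu !D !pol4_ver4 !E.
by congr (_ * _ + _ * _); ring.
Qed.

Lemma edge_xxxx p : pol4 edge_vec p p p p = p 0 0 ^+ 4 + p 0 1 ^+ 4 + p 0 2 ^+ 4 +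
  7%:R * (p 0 0 ^+ 2 * p 0 1 ^+ 2 + p 0 0 ^+ 2 * p 0 2 ^+ 2 + p 0 1 ^+ 2 * p 0 2 ^+ 2).
Proof. by rewrite pol4_edge; field. Qed.

Lemma edge_xxxy p q : pol4 edge_vec p p p q *+ 2 =
  p 0 0 * (p 0 0 ^+ 2 *+ 2 + (p 0 1 ^+ 2 + p 0 2 ^+ 2) *+ 7) * q 0 0
  + p 0 1 * (p 0 1 ^+ 2 *+ 2 + (p 0 0 ^+ 2 + p 0 2 ^+ 2) *+ 7) * q 0 1
  + p 0 2 * (p 0 2 ^+ 2 *+ 2 + (p 0 0 ^+ 2 + p 0 1 ^+ 2) *+ 7) * q 0 2.
Proof. by rewrite pol4_edge; field. Qed.

Lemma edge_xxyy p q : pol4 edge_vec p p q q *+ 6 =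
  (p 0 0 ^+ 2 * q 0 0 ^+ 2 + p 0 1 ^+ 2 * q 0 1 ^+ 2 + p 0 2 ^+ 2 * q 0 2 ^+ 2) *+ 6
  + (p 0 0 ^+ 2 * q 0 1 ^+ 2 + p 0 1 ^+ 2 * q 0 0 ^+ 2 + p 0 0 * p 0 1 * q 0 0 * q 0 1 *+ 4) *+ 7
  + (p 0 0 ^+ 2 * q 0 2 ^+ 2 + p 0 2 ^+ 2 * q 0 0 ^+ 2 + p 0 0 * p 0 2 * q 0 0 * q 0 2 *+ 4) *+ 7
  + (p 0 1 ^+ 2 * q 0 2 ^+ 2 + p 0 2 ^+ 2 * q 0 1 ^+ 2 + p 0 1 * p 0 2 * q 0 1 * q 0 2 *+ 4) *+ 7.
Proof. by rewrite pol4_edge; field. Qed.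

(** x and y are the points of contact. The vector n is a direction in which the derivative of the
    quartic is nonzero at both, as the Newton iteration requires. *)
Definition bitangent x y n : Prop :=
  [/\ pol4 edge_vec x x x x = 0, pol4 edge_vec x x x y = 0,
      pol4 edge_vec y y y x = 0 & pol4 edge_vec y y y y = 0] /\
  [/\ pol4 edge_vec x x y y != 0, pol4 edge_vec x x x n != 0 & pol4 edge_vec y y y n != 0].

Lemma bitangentP x y n :
  [/\ pol4 edge_vec x x x x = 0, pol4 edge_vec x x x y *+ 2 = 0,
      pol4 edge_vec y y y x *+ 2 = 0 & pol4 edge_vec y y y y = 0] ->
  [/\ pol4 edge_vec x x y y *+ 6 != 0, pol4 edge_vec x x x n *+ 2 != 0 &
      pol4 edge_vec y y y n *+ 2 != 0] -> bitangent x y n.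
Proof.
move=> [h1 /eqP h2 /eqP h3 h4] [h5 h6 h7].
rewrite mulrn_eq0 /= in h2; rewrite mulrn_eq0 /= in h3.
rewrite mulrn_eq0 /= in h5; rewrite mulrn_eq0 /= in h6; rewrite mulrn_eq0 /= in h7.
by split; split=> //; apply/eqP.
Qed.

Lemma lin2E (a b : 'rV[K]_3) : [/\ lin2 a b 0 = a 0 0 * b 0 0,
  lin2 a b 1 = a 0 0 * b 0 1 + a 0 1 * b 0 0, lin2 a b 2 = a 0 0 * b 0 2 + a 0 2 * b 0 0 &
  lin2 a b 3 = a 0 1 * b 0 1] /\ lin2 a b 4 = a 0 1 * b 0 2 + a 0 2 * b 0 1 /\
  lin2 a b 5 = a 0 2 * b 0 2.
Proof.
have E x y z : ev2 (lin2 a b) (vec3 x y z) =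
    (a 0 0 * x + a 0 1 * y + a 0 2 * z) * (b 0 0 * x + b 0 1 * y + b 0 2 * z).
  by rewrite ev2_lin2 !dot3E !vec3E.
have F x y z (q : 'I_6 -> K) : ev2 q (vec3 x y z) = q 0 * x ^+ 2 + q 1 * (x * y)
    + q 2 * (x * z) + q 3 * y ^+ 2 + q 4 * (y * z) + q 5 * z ^+ 2.
  by rewrite ev2E !vec3E.
have G x y z : lin2 a b 0 * x ^+ 2 + lin2 a b 1 * (x * y) + lin2 a b 2 * (x * z)
    + lin2 a b 3 * y ^+ 2 + lin2 a b 4 * (y * z) + lin2 a b 5 * z ^+ 2 =
    (a 0 0 * x + a 0 1 * y + a 0 2 * z) * (b 0 0 * x + b 0 1 * y + b 0 2 * z).
  by rewrite -F E.
move: G; move: (lin2 a b 0) (lin2 a b 1) (lin2 a b 2) (lin2 a b 3) (lin2 a b 4) (lin2 a b 5).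
move=> q0 q1 q2 q3 q4 q5 G.
have e0 : q0 = a 0 0 * b 0 0 by have := G 1 0 0; rewrite !(mulr0, addr0, mulr1, expr0n, expr1n).
have e3 : q3 = a 0 1 * b 0 1 by have := G 0 1 0; rewrite !(mulr0, mul0r, addr0, add0r, mulr1, expr0n, expr1n).
have e5 : q5 = a 0 2 * b 0 2 by have := G 0 0 1; rewrite !(mulr0, mul0r, addr0, add0r, mulr1, expr0n, expr1n).
have := G 1 1 0; have := G 1 0 1; have := G 0 1 1; rewrite e0 e3 e5 => h1 h2 h3.
have z (x y x' y' : K) : x' = y' -> x - y = x' - y' -> x = y.
  by move=> ->; rewrite subrr => /eqP; rewrite subr_eq0 => /eqP.
by do !split=> //; [apply: (z _ _ _ _ h3)|apply: (z _ _ _ _ h2)|apply: (z _ _ _ _ h1)]; ring.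
Qed.
End EdgeQuartic.

Lemma I6P (P : 'I_6 -> Prop) : P 0 -> P 1 -> P 2 -> P 3 -> P 4 -> P 5 -> forall i, P i.
Proof.
move=> p0 p1 p2 p3 p4 p5 [[|[|[|[|[|[|//]]]]]] h].
- by rewrite (_ : Ordinal _ = 0) //; apply: val_inj.
- by rewrite (_ : Ordinal _ = 1) //; apply: val_inj.
- by rewrite (_ : Ordinal _ = 2) //; apply: val_inj.
- by rewrite (_ : Ordinal _ = 3) //; apply: val_inj.
- by rewrite (_ : Ordinal _ = 4) //; apply: val_inj.
- by rewrite (_ : Ordinal _ = 5) //; apply: val_inj.
Qed.

(* The pair (a, b) of integers stands for a + b theta, where theta ^+ 2 = -2. *)
Section QuadraticIntegers.
Variables (K : numFieldType) (theta : K).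
Hypothesis theta2 : theta ^+ 2 = - 2%:R.

Definition quad (z : int * int) : K := z.1%:~R + z.2%:~R * theta.

Lemma quad_eq0 z : quad z = 0 -> z = (0, 0).
Proof.
case: z => a b; rewrite /quad /= => h.
have : (a ^+ 2 + b ^+ 2 * 2)%:~R = 0 :> K.
  rewrite rmorphD rmorphM !rmorphXn /=.
  have -> : a%:~R = - (b%:~R * theta) :> K by apply/eqP; rewrite -addr_eq0 h.
  by ring: theta2.
move/eqP; rewrite intr_eq0 => /eqP h2.
by have [-> ->] : a = 0 /\ b = 0 by nia.
Qed.

Definition quad_mul (z w : int * int) : int * int :=
  (z.1 * w.1 - 2 * (z.2 * w.2), z.1 * w.2 + z.2 * w.1).

Lemma quadM z w : quad z * quad w = quad (quad_mul z w).
Proof.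
case: z w => a b [c d]; rewrite /quad /quad_mul /= rmorphB rmorphD 5!rmorphM /=.
by ring: theta2.
Qed.

Definition quad_independent (v w : seq (int * int)) : bool :=
  has (fun a => has (fun b => quad_mul (nth (0, 0) v a) (nth (0, 0) w b) !=
    quad_mul (nth (0, 0) v b) (nth (0, 0) w a)) (iota 0 6)) (iota 0 6).

Lemma quad_independentP v w : quad_independent v w ->
  exists a b : 'I_6, quad (nth (0, 0) v a) * quad (nth (0, 0) w b) !=
    quad (nth (0, 0) v b) * quad (nth (0, 0) w a).
Proof.
case/hasP => a; rewrite mem_iota add0n => /andP[_ ha] /hasP[b]; rewrite mem_iota add0n => /andP[_ hb] h.
exists (Ordinal ha), (Ordinal hb); apply: contraNneq h => /=.
rewrite !quadM => /eqP; rewrite -subr_eq0.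
move: (quad_mul _ _) (quad_mul _ _) => [x1 x2] [y1 y2]; rewrite /quad /=.
move/eqP=> h.
have : quad (y1 - x1, y2 - x2) = 0 by rewrite /quad /= 2!rmorphB; apply: etrans h; rewrite /=; ring.
by case/quad_eq0 => /eqP; rewrite subr_eq0 => /eqP -> /eqP; rewrite subr_eq0 => /eqP ->.
Qed.
End QuadraticIntegers.

(* Coordinates of the conics xy, where x and y are the points of contact of a
   bitangent of edge_vec: there are 4 + 12 + 12 bitangents. *)
Definition rowA (e1 e2 : int) : seq (int * int) :=
  [:: (1, 0); (- e1, 0); (- e2, 0); (1, 0); (- (e1 * e2), 0); (1, 0)].
Definition rowB (axis : nat) (e1 e2 : int) : seq (int * int) :=
  let a := (9, 0) in let l := (6 * e1, 12 * e2) in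
  let m := (7, 14 * e1 * e2) in let l2 := (- 7, 4 * e1 * e2) in
  match axis with
  | 0%N => [:: m; (0, 0); (0, 0); a; l; l2]
  | 1%N => [:: a; (0, 0); l; m; (0, 0); l2]
  | _ => [:: a; l; (0, 0); l2; (0, 0); m]
  end.
Definition rowC (axis : nat) (e1 e2 : int) : seq (int * int) :=
  let a := (1, 0) in let b := (- 1, 0) in
  let c := (6 * e1 * e2, 0) in let u := (0, 2 * e1) in let v := (0, 2 * e2) in
  match axis with
  | 0%N => [:: b; u; v; a; c; a]
  | 1%N => [:: a; u; c; b; v; a]
  | _ => [:: a; c; u; a; v; b]
  end.

Definition signs : seq (int * int) := [:: (1, 1); (1, -1); (-1, 1); (-1, -1)].
Definition bitangent_rows : seq (seq (int * int)) :=
  [seq rowA e.1 e.2 | e <- signs] ++ [seq rowB k e.1 e.2 | k <- iota 0 3, e <- signs] ++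
  [seq rowC k e.1 e.2 | k <- iota 0 3, e <- signs].
(** The added row is the twenty-ninth point, the smooth conic -4 (y_0^2 + y_1^2 + y_2^2); see
    [edge_nu_conic]. *)
Definition nodal_rows : seq (seq (int * int)) :=
  rcons bitangent_rows [:: (-4, 0); (0, 0); (0, 0); (-4, 0); (0, 0); (-4, 0)].

Lemma size_bitangent_rows : size bitangent_rows = 28. Proof. by []. Qed.

Lemma nodal_rows_independent (i j : 'I_29) : i != j ->
  quad_independent (nth [::] nodal_rows i) (nth [::] nodal_rows j).
Proof.
have h : all (fun i => all (fun j => (i == j) ||
   quad_independent (nth [::] nodal_rows i) (nth [::] nodal_rows j)) (iota 0 29)) (iota 0 29).
  by vm_compute.
move=> ij; move/allP: h => /(_ i); rewrite mem_iota ltn_ord => /(_ isT) /allP /(_ j).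
by rewrite mem_iota ltn_ord => /(_ isT); rewrite -[i == j :> nat]/(i == j) (negPf ij).
Qed.

Section Bitangents.
Variable K : numClosedFieldType.
Implicit Types e : int.

Definition bitangent_row (theta : K) (v : seq (int * int)) := exists x y n : 'rV[K]_3,
  bitangent x y n /\ forall i : 'I_6, lin2 x y i = quad theta (nth (0, 0) v i).

Variables (s theta : K).
Hypotheses (s2 : s ^+ 2 = 2%:R) (thetaE : theta = 'i * s).

Let i2 : ('i : K) ^+ 2 = -1. Proof. exact: sqrCi. Qed.
Let theta2 : theta ^+ 2 = - 2%:R. Proof. by rewrite thetaE; ring: i2 s2. Qed.
Let sgK e : e ^+ 2 = 1 -> (e%:~R : K) ^+ 2 = 1.
Proof. by move=> h; rewrite -rmorphXn h. Qed.
Let neq0 (a : K) b n : a * b = n%:R -> (0 < n)%N -> a != 0.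
Proof.
by move=> ab n0; apply: contraTneq n0 => a0; move/eqP: ab; rewrite a0 mul0r eq_sym pnatr_eq0 => /eqP ->.
Qed.

(** The bitangents x + e1 y + e2 z = 0. The coordinates of the points of contact are cube roots of
    unity up to sign, and [w] is a primitive one. *)
Lemma bitangent_rowA e1 e2 : e1 ^+ 2 = 1 -> e2 ^+ 2 = 1 -> bitangent_row theta (rowA e1 e2).
Proof.
move=> /sgK h1 /sgK h2.
pose w : K := (-1 + 'i * sqrtC 3%:R) / 2%:R.
have w2 : w ^+ 2 = - w - 1.
  have h3 : (sqrtC 3%:R : K) ^+ 2 = 3%:R by rewrite sqrtCK.
  have : (w *+ 2) ^+ 2 = - (w *+ 2) *+ 2 - 4%:R.
    have -> : w *+ 2 = -1 + 'i * sqrtC 3%:R by rewrite /w; field.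
    by ring: i2 h3.
  move=> h; apply: (mulIf (_ : 4%:R != 0 :> K)); first by rewrite pnatr_eq0.
  have -> : w ^+ 2 * 4%:R = (w *+ 2) ^+ 2 by ring.
  by rewrite h; ring.
move: w w2 => w w2; move: h1 h2; set a : K := e1%:~R; set b : K := e2%:~R => h1 h2.
exists (vec3 1 (a * w) (b * w ^+ 2)), (vec3 1 (a * w ^+ 2) (b * w)), (vec3 1 0 0); split.
  apply: bitangentP; split; rewrite ?edge_xxxx ?edge_xxyy ?edge_xxxy !vec3E.
  1-4: by ring: h1 h2 w2.
  - by apply: (@neq0 _ 1 81) => //; ring: h1 h2 w2.
  - by apply: (@neq0 _ (-1) 5) => //; ring: h1 h2 w2.
  - by apply: (@neq0 _ (-1) 5) => //; ring: h1 h2 w2.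
have := lin2E (vec3 1 (a * w) (b * w ^+ 2)) (vec3 1 (a * w ^+ 2) (b * w)); rewrite !vec3E.
case=> [[l0 l1 l2 l3] [l4 l5]].
by apply: I6P; rewrite ?l0 ?l1 ?l2 ?l3 ?l4 ?l5 /quad /= ?rmorphN ?rmorphM /= -/a -/b;
  ring: h1 h2 w2.
Qed.

(** Bitangents through a vertex of the coordinate triangle, such as 3 z = l y. The points of contact
    differ by the sign of m, a further square root, but their conic only involves m^2. *)
Lemma bitangent_rowB k e1 e2 : e1 ^+ 2 = 1 -> e2 ^+ 2 = 1 -> bitangent_row theta (rowB k e1 e2).
Proof.
move=> /sgK; rewrite /bitangent_row; set a : K := e1%:~R => h1 /sgK; set b : K := e2%:~R => h2.
pose l : K := a + 2%:R * b * theta; pose m := sqrtC (- 7%:R * (1 + 2%:R * a * b * theta)).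
have m2 : m ^+ 2 = - 7%:R * (1 + 2%:R * a * b * theta) by rewrite sqrtCK.
have l0 : l != 0 by apply: (@neq0 _ (a - 2%:R * b * theta) 9) => //; rewrite /l; ring: h1 h2 theta2.
have m0 : m != 0.
  apply: contraTneq isT => m0; have : m ^+ 2 * (1 - 2%:R * a * b * theta) = - 63%:R.
    by rewrite m2; ring: h1 h2 theta2.
  by move/eqP; rewrite m0 expr0n mul0r eq_sym oppr_eq0 pnatr_eq0.
(* These are the values of 6 [pol4] at xxyy and of 2 [pol4] at xxxn and yyyn, for the points given
   below. *)
have nz1 : 16%:R * m ^+ 4 != 0 by rewrite mulf_neq0 ?expf_neq0 ?pnatr_eq0.
have nz2 : - 90%:R * (a * b * theta * l) != 0.
  have z (c d : K) : c ^+ 2 = d -> d != 0 -> c != 0.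
    by move=> <- h; apply: contraNneq h => ->; rewrite expr0n.
  rewrite !mulf_neq0 ?oppr_eq0 ?pnatr_eq0 //; first by apply: z h1 _; rewrite oner_eq0.
    by apply: z h2 _; rewrite oner_eq0.
  by apply: z theta2 _; rewrite oppr_eq0 pnatr_eq0.
have lE : l = a + 2%:R * b * theta by [].
clearbody l m; case: k => [|[|k]].
- exists (vec3 m 3%:R l), (vec3 (- m) 3%:R l), (vec3 0 0 1); split.
    apply: bitangentP; split; rewrite ?edge_xxxx ?edge_xxyy ?edge_xxxy !vec3E.
    1-4: by rewrite lE; ring: h1 h2 theta2 m2.
    + by apply: contraNneq nz1 => <-; rewrite lE; apply/eqP; ring: h1 h2 theta2 m2.
    + by apply: contraNneq nz2 => <-; rewrite lE; apply/eqP; ring: h1 h2 theta2 m2.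
    + by apply: contraNneq nz2 => <-; rewrite lE; apply/eqP; ring: h1 h2 theta2 m2.
  have := lin2E (vec3 m 3%:R l) (vec3 (- m) 3%:R l); rewrite !vec3E lE.
  case=> [[c0 c1 c2 c3] [c4 c5]].
  by apply: I6P; rewrite ?c0 ?c1 ?c2 ?c3 ?c4 ?c5 /quad /= ?rmorphM /= -/a -/b;
    ring: h1 h2 theta2 m2.
- exists (vec3 3%:R m l), (vec3 3%:R (- m) l), (vec3 0 0 1); split.
    apply: bitangentP; split; rewrite ?edge_xxxx ?edge_xxyy ?edge_xxxy !vec3E.
    1-4: by rewrite lE; ring: h1 h2 theta2 m2.
    + by apply: contraNneq nz1 => <-; rewrite lE; apply/eqP; ring: h1 h2 theta2 m2.
    + by apply: contraNneq nz2 => <-; rewrite lE; apply/eqP; ring: h1 h2 theta2 m2.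
    + by apply: contraNneq nz2 => <-; rewrite lE; apply/eqP; ring: h1 h2 theta2 m2.
  have := lin2E (vec3 3%:R m l) (vec3 3%:R (- m) l); rewrite !vec3E lE.
  case=> [[c0 c1 c2 c3] [c4 c5]].
  by apply: I6P; rewrite ?c0 ?c1 ?c2 ?c3 ?c4 ?c5 /quad /= ?rmorphM /= -/a -/b;
    ring: h1 h2 theta2 m2.
- exists (vec3 3%:R l m), (vec3 3%:R l (- m)), (vec3 0 1 0); split.
    apply: bitangentP; split; rewrite ?edge_xxxx ?edge_xxyy ?edge_xxxy !vec3E.
    1-4: by rewrite lE; ring: h1 h2 theta2 m2.
    + by apply: contraNneq nz1 => <-; rewrite lE; apply/eqP; ring: h1 h2 theta2 m2.
    + by apply: contraNneq nz2 => <-; rewrite lE; apply/eqP; ring: h1 h2 theta2 m2.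
    + by apply: contraNneq nz2 => <-; rewrite lE; apply/eqP; ring: h1 h2 theta2 m2.
  have := lin2E (vec3 3%:R l m) (vec3 3%:R l (- m)); rewrite !vec3E lE.
  case=> [[c0 c1 c2 c3] [c4 c5]].
  by apply: I6P; rewrite ?c0 ?c1 ?c2 ?c3 ?c4 ?c5 /quad /= ?rmorphM /= -/a -/b;
    ring: h1 h2 theta2 m2.
Qed.

(** The bitangents 2 theta x + e1 y + e2 z = 0 and those obtained by moving 2 theta to another
    coordinate. *)
Lemma bitangent_rowC k e1 e2 : e1 ^+ 2 = 1 -> e2 ^+ 2 = 1 -> bitangent_row theta (rowC k e1 e2).
Proof.
move=> /sgK; rewrite /bitangent_row; set a : K := e1%:~R => h1 /sgK; set b : K := e2%:~R => h2.
case: k => [|[|k]].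
- exists (vec3 'i (a * (s + 1)) (b * (s - 1))), (vec3 'i (a * (s - 1)) (b * (s + 1))), (vec3 1 0 0).
  split.
    apply: bitangentP; split; rewrite ?edge_xxxx ?edge_xxyy ?edge_xxxy !vec3E.
    1-4: by ring: h1 h2 s2 i2.
    + by apply: (@neq0 _ 1 144) => //; ring: h1 h2 s2 i2.
    + by apply: (@neq0 _ (- 'i) 40) => //; ring: h1 h2 s2 i2.
    + by apply: (@neq0 _ (- 'i) 40) => //; ring: h1 h2 s2 i2.
  have := lin2E (vec3 'i (a * (s + 1)) (b * (s - 1))) (vec3 'i (a * (s - 1)) (b * (s + 1))).
  rewrite !vec3E => -[[c0 c1 c2 c3] [c4 c5]].
  by apply: I6P; rewrite ?c0 ?c1 ?c2 ?c3 ?c4 ?c5 thetaE /quad /= ?rmorphM /= -/a -/b;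
    ring: h1 h2 s2 i2.
- exists (vec3 (a * (s + 1)) 'i (b * (s - 1))), (vec3 (a * (s - 1)) 'i (b * (s + 1))), (vec3 0 1 0).
  split.
    apply: bitangentP; split; rewrite ?edge_xxxx ?edge_xxyy ?edge_xxxy !vec3E.
    1-4: by ring: h1 h2 s2 i2.
    + by apply: (@neq0 _ 1 144) => //; ring: h1 h2 s2 i2.
    + by apply: (@neq0 _ (- 'i) 40) => //; ring: h1 h2 s2 i2.
    + by apply: (@neq0 _ (- 'i) 40) => //; ring: h1 h2 s2 i2.
  have := lin2E (vec3 (a * (s + 1)) 'i (b * (s - 1))) (vec3 (a * (s - 1)) 'i (b * (s + 1))).
  rewrite !vec3E => -[[c0 c1 c2 c3] [c4 c5]].
  by apply: I6P; rewrite ?c0 ?c1 ?c2 ?c3 ?c4 ?c5 thetaE /quad /= ?rmorphM /= -/a -/b;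
    ring: h1 h2 s2 i2.
- exists (vec3 (a * (s + 1)) (b * (s - 1)) 'i), (vec3 (a * (s - 1)) (b * (s + 1)) 'i), (vec3 0 0 1).
  split.
    apply: bitangentP; split; rewrite ?edge_xxxx ?edge_xxyy ?edge_xxxy !vec3E.
    1-4: by ring: h1 h2 s2 i2.
    + by apply: (@neq0 _ 1 144) => //; ring: h1 h2 s2 i2.
    + by apply: (@neq0 _ (- 'i) 40) => //; ring: h1 h2 s2 i2.
    + by apply: (@neq0 _ (- 'i) 40) => //; ring: h1 h2 s2 i2.
  have := lin2E (vec3 (a * (s + 1)) (b * (s - 1)) 'i) (vec3 (a * (s - 1)) (b * (s + 1)) 'i).
  rewrite !vec3E => -[[c0 c1 c2 c3] [c4 c5]].
  by apply: I6P; rewrite ?c0 ?c1 ?c2 ?c3 ?c4 ?c5 thetaE /quad /= ?rmorphM /= -/a -/b;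
    ring: h1 h2 s2 i2.
Qed.

Lemma bitangent_rowsP v : v \in bitangent_rows -> bitangent_row theta v.
Proof.
have sg (e : int * int) : e \in signs -> e.1 ^+ 2 = 1 /\ e.2 ^+ 2 = 1.
  by rewrite !inE => /or4P[] /eqP ->.
rewrite mem_cat => /orP[/mapP[e /sg[h1 h2] ->]|]; first exact: bitangent_rowA.
rewrite mem_cat => /orP[] /allpairsP[[k e] /= [_ /sg[h1 h2] ->]].
- exact: bitangent_rowB.
- exact: bitangent_rowC.
Qed.
End Bitangents.

Section EdgePentForm.
Variable K : numClosedFieldType.

(* With these vectors nu t = (1 - t^2, i (1 + t^2), 2 t), which parametrizes the
   conic x^2 + y^2 + z^2 = 0. *)
Definition edge_p0 : 'rV[K]_3 := vec3 1 'i 0.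
Definition edge_p1 : 'rV[K]_3 := vec3 0 0 2%:R.
Definition edge_p2 : 'rV[K]_3 := vec3 (-1) 'i 0.

Lemma edge_nu_conic (theta : K) (i : 'I_6) : nu_conic edge_p0 edge_p1 edge_p2 i =
  quad theta (nth (0, 0) [:: (-4, 0); (0, 0); (0, 0); (-4, 0); (0, 0); (-4, 0)] i).
Proof.
have i2 : ('i : K) ^+ 2 = -1 by exact: sqrCi.
rewrite /nu_conic.
have := lin2E (cross edge_p2 edge_p0) (cross edge_p2 edge_p0).
have := lin2E (cross edge_p1 edge_p2) (cross edge_p0 edge_p1).
rewrite /edge_p0 /edge_p1 /edge_p2 !vec3E.
case=> [[c0 c1 c2 c3] [c4 c5]] [[d0 d1 d2 d3] [d4 d5]].
by elim/I6P: i; rewrite ?c0 ?c1 ?c2 ?c3 ?c4 ?c5 ?d0 ?d1 ?d2 ?d3 ?d4 ?d5 /quad /=; ring: i2.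
Qed.

Lemma edge_quartic_pent_identity (x y z u w r l0 l1 l2 l3 l4 : K) : r ^+ 4 = 5%:R ->
  u = x + 'i * y -> w = x - 'i * y ->
  l0 = u -> l1 = u + r * z *+ 2 - r ^+ 2 * w -> l2 = u + 'i * r * z *+ 2 + r ^+ 2 * w ->
  l3 = u - r * z *+ 2 - r ^+ 2 * w -> l4 = u - 'i * r * z *+ 2 + r ^+ 2 * w ->
  -1 / 80%:R * (l1 * l2 * l3 * l4) + - 6%:R / 80%:R * (l0 * l2 * l3 * l4) +
  - 6%:R / 80%:R * (l0 * l1 * l3 * l4) + - 6%:R / 80%:R * (l0 * l1 * l2 * l4) +
  - 6%:R / 80%:R * (l0 * l1 * l2 * l3) =
  x ^+ 4 + y ^+ 4 + z ^+ 4 + 7%:R * (x ^+ 2 * y ^+ 2 + x ^+ 2 * z ^+ 2 + y ^+ 2 * z ^+ 2).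
Proof.
have i2 : ('i : K) ^+ 2 = -1 by exact: sqrCi.
move=> r4 uE wE -> -> -> -> ->.
apply: (mulfI (_ : 80%:R != 0 :> K)); first by rewrite pnatr_eq0.
(* Multiplying the lines of opposite parameters first leaves only r^4 = 5. *)
transitivity (- ((u ^+ 2 - 5%:R * w ^+ 2) ^+ 2 - 80%:R * u * w * z ^+ 2 - 80%:R * z ^+ 4)
   - 6%:R * u * (4%:R * u * (u ^+ 2 - 5%:R * w ^+ 2) - 80%:R * w * z ^+ 2)).
  by field: i2 r4.
by rewrite uE wE; ring: i2.
Qed.

Lemma edge_pent_form : exists t kap : nat -> K,
  fbar (pent_form edge_p0 edge_p1 edge_p2 t kap) = edge_vec K /\
  kap 0%N * kap 1%N * kap 2%N * kap 3%N * kap 4%N *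
    vdm5 (t 0%N) (t 1%N) (t 2%N) (t 3%N) (t 4%N) ^+ 2 != 0.
Proof.
have i2 : ('i : K) ^+ 2 = -1 by exact: sqrCi.
have [r r4] : exists r : K, r ^+ 4 = 5%:R by exists (sqrtC (sqrtC 5%:R)); rewrite (exprM _ 2 2) !sqrtCK.
have nz (d : K) n : (d ^+ 4 = n%:R) \/ (d ^+ 4 = - n%:R) -> (0 < n)%N -> d != 0.
  move=> h n0; apply: contraTneq n0 => d0.
  by case: h => /eqP; rewrite d0 expr0n eq_sym ?oppr_eq0 pnatr_eq0 => /eqP ->.
(* The roots of t^5 - 5 t, the derivative in s at s = 1 of the octahedral form s t^5 - s^5 t. *)
pose t := nth 0 [:: 0; r; 'i * r; - r; - ('i * r)].
have tn : [/\ [/\ t 1%N - t 0%N != 0, t 2 - t 0%N != 0, t 3 - t 0%N != 0 & t 4 - t 0%N != 0],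
   [/\ t 2 - t 1%N != 0, t 3 - t 1%N != 0 & t 4 - t 1%N != 0] &
   [/\ t 3 - t 2 != 0, t 4 - t 2 != 0 & t 4 - t 3 != 0]].
  split; split; rewrite /t /=.
  1-4: by apply: (@nz _ 5) => //; left; ring: i2 r4.
  - by apply: (@nz _ 20) => //; right; ring: i2 r4.
  - by apply: (@nz _ 80) => //; left; ring: i2 r4.
  - by apply: (@nz _ 20) => //; right; ring: i2 r4.
  - by apply: (@nz _ 20) => //; right; ring: i2 r4.
  - by apply: (@nz _ 80) => //; left; ring: i2 r4.
  - by apply: (@nz _ 20) => //; right; ring: i2 r4.
case: tn => [[a1 a2 a3 a4] [b2 b3 b4] [c3 c4 d4]].
pose v k := vdm4 (t (bump k 0)) (t (bump k 1)) (t (bump k 2)) (t (bump k 3)).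
have v0 k : (k < 5)%N -> v k != 0.
  case: k => [|[|[|[|[|//]]]]] _; rewrite /v /vdm4 ![bump _ _]/= !mulf_neq0 //.
pose d := nth 0 [:: -1; - 6%:R; - 6%:R; - 6%:R; - 6%:R] : nat -> K.
pose kap k := d k / 80%:R / v k ^+ 2.
have kap0 k : (k < 5)%N -> kap k != 0.
  move=> hk; rewrite /kap !mulf_neq0 ?invr_eq0 ?expf_neq0 ?v0 ?pnatr_eq0 //.
  by case: k hk => [|[|[|[|[|//]]]]] _; rewrite /d /= oppr_eq0 ?oner_eq0 ?pnatr_eq0.
exists t, kap; split; last first.
  apply: mulf_neq0; first by do 4 (apply: mulf_neq0; last exact: kap0); exact: kap0.
  by rewrite expf_neq0 // /vdm5 !mulf_neq0.
rewrite -[RHS]fbar_quartic_of; congr fbar.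
apply: homog4_ext; [exact: pent_form_homog | exact: quartic_of_homog |] => p.
rewrite -(pol4_fbar p (quartic_of_homog _)) fbar_quartic_of edge_xxxx.
have kv k : (k < 5)%N -> kap k * v k ^+ 2 = d k / 80%:R.
  by move=> hk; rewrite /kap divfK // expf_neq0 ?v0.
pose L j := p 0 0 + 'i * p 0 1 + t j * p 0 2 *+ 2 + t j ^+ 2 * ('i * p 0 1 - p 0 0).
have LE j : (pent_line edge_p0 edge_p1 edge_p2 t j).@[p 0] = L j.
  have n i : nu edge_p0 edge_p1 edge_p2 (t j) 0 i =
    edge_p0 0 i + t j * edge_p1 0 i + t j ^+ 2 * edge_p2 0 i by rewrite !mxE.
  by rewrite meval_linform dot3E !n /edge_p0 /edge_p1 /edge_p2 !vec3E /L; ring.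
transitivity (\sum_(k < 5) d k / 80%:R * (L (bump k 0) * L (bump k 1) * L (bump k 2) * L (bump k 3))).
  rewrite raddf_sum; apply: eq_bigr => k _ /=.
  by rewrite mevalZ 3!mevalM !LE -kv.
have l0 : L 0%N = p 0 0 + 'i * p 0 1 by rewrite /L /t /=; ring.
have l1 : L 1%N = p 0 0 + 'i * p 0 1 + r * p 0 2 *+ 2 - r ^+ 2 * (p 0 0 - 'i * p 0 1).
  by rewrite /L /t /=; ring.
have l2 : L 2 = p 0 0 + 'i * p 0 1 + 'i * r * p 0 2 *+ 2 + r ^+ 2 * (p 0 0 - 'i * p 0 1).
  by rewrite /L /t /=; ring: i2.
have l3 : L 3 = p 0 0 + 'i * p 0 1 - r * p 0 2 *+ 2 - r ^+ 2 * (p 0 0 - 'i * p 0 1).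
  by rewrite /L /t /=; ring.
have l4 : L 4 = p 0 0 + 'i * p 0 1 - 'i * r * p 0 2 *+ 2 + r ^+ 2 * (p 0 0 - 'i * p 0 1).
  by rewrite /L /t /=; ring: i2.
rewrite (@sum5E _ (fun k => d k / 80%:R * (L (bump k 0) * L (bump k 1) * L (bump k 2) * L (bump k 3)))).
exact: (edge_quartic_pent_identity r4 erefl erefl l0 l1 l2 l3 l4).
Qed.
End EdgePentForm.

(** * Lueroth quartics and the Hilbert function *)

Section Segment.
Variable K : fieldType.

Lemma segment_scalars (a b : nat -> K) : exists c : nat -> {poly K},
  horner_eval 0 \o c = a /\ horner_eval 1 \o c = b.
Proof.
exists (fun k => (a k)%:P + 'X * (b k - a k)%:P); split; apply: funext => k;
  rewrite /= /horner_eval hornerD hornerM !hornerC hornerX.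
  by rewrite mul0r addr0.
by rewrite mul1r addrC subrK.
Qed.

Lemma segment_vectors (p q : 'rV[K]_3) : exists v : 'rV[{poly K}]_3,
  map_mx (horner_eval 0) v = p /\ map_mx (horner_eval 1) v = q.
Proof.
exists (\row_i ((p 0 i)%:P + 'X * (q 0 i - p 0 i)%:P)); split; apply/rowP => i;
  rewrite !mxE /horner_eval hornerD hornerM !hornerC hornerX.
  by rewrite mul0r addr0.
by rewrite mul1r addrC subrK.
Qed.
End Segment.

Lemma vdm5_map (A A' : comNzRingType) (phi : {rmorphism A -> A'}) c0 c1 c2 c3 c4 t0 t1 t2 t3 t4 :
  phi (c0 * c1 * c2 * c3 * c4 * vdm5 t0 t1 t2 t3 t4 ^+ 2) =
  phi c0 * phi c1 * phi c2 * phi c3 * phi c4 *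
    vdm5 (phi t0) (phi t1) (phi t2) (phi t3) (phi t4) ^+ 2.
Proof. by rewrite /vdm5 !(rmorphM, rmorphXn, rmorphB). Qed.

(** All genericity is checked at s = 0, where the 29 points are explicit. The determinant vanishes
    as a polynomial in s, and s = 1 gives the assertion. *)
Lemma pent_form_determinant (K : numClosedFieldType) d N (B : N.-tuple 'X_{1..6})
    (U : 'M[K]_(N, _)) r (Z1 : 'M[K]_(N, r)) (Z2 : 'M[K]_(r, N)) p0 p1 p2 t kap :
  uniq B -> (forall m, (mdeg m == d) = (m \in B)) -> (28 <= d)%N -> (r <= 28)%N ->
  \det (U *m macaulay d B id (fbar (pent_form p0 p1 p2 t kap)) + Z1 *m Z2) = 0.
Proof.
move=> uB cB dd rr.
have [t0 [kap0 [h0 nz0]]] := edge_pent_form K.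
have [P0 [P00 P01]] := segment_vectors (edge_p0 K) p0.
have [P1 [P10 P11]] := segment_vectors (edge_p1 K) p1.
have [P2 [P20 P21]] := segment_vectors (edge_p2 K) p2.
have [T [T0 T1]] := segment_scalars t0 t; have [C [C0 C1]] := segment_scalars kap0 kap.
have [u uE] : exists u, u = fbarP (pent_form P0 P1 P2 T C) by eexists.
have u0 : map_mx (horner_eval 0) u = edge_vec K.
  by rewrite uE fbarP_ev pent_form_map P00 P10 P20 T0 C0.
have u1 : map_mx (horner_eval 1) u = fbar (pent_form p0 p1 p2 t kap).
  by rewrite uE fbarP_ev pent_form_map P01 P11 P21 T1 C1.
pose s : K := sqrtC 2%:R; have s2 : s ^+ 2 = 2%:R by rewrite sqrtCK.
have [theta thE] : exists theta, theta = 'i * s by eexists.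
have th2 : theta ^+ 2 = - 2%:R by rewrite thE exprMn sqrCi s2 mulN1r.
pose q0 (i : 'I_29) (a : 'I_6) := quad theta (nth (0, 0) (nth [::] nodal_rows i) a).
have sep i j : i != j -> exists a b, q0 i a * q0 j b != q0 i b * q0 j a.
  by move=> ij; apply: (quad_independentP th2); apply: nodal_rows_independent.
have lift k : exists q : 'I_29 -> 'I_6 -> {poly K}, (forall i a, (q i a).[0] = q0 i a) /\
    forall i j, 'X^k %| (WMd (@polyC K) u j).@[q i].
  have /fin_all_exists[q hq] (i : 'I_29) : exists q : 'I_6 -> {poly K},
      (forall a, (q a).[0] = q0 i a) /\ forall j, 'X^k %| (WMd (@polyC K) u j).@[q].
    rewrite /q0 /nodal_rows nth_rcons size_bitangent_rows.
    have [hi|hi] := ltnP i 28.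
      have := bitangent_rowsP s2 thE (mem_nth [::] (hi : i < size bitangent_rows)%N).
      case=> x [y [n [[[e1 e2 e3 e4] [e5 e6 e7]] hl]]].
      rewrite -u0 in e1 e2 e3 e4 e5 e6 e7.
      have [q [hq1 hq2]] := bitangent_lift e1 e2 e3 e4 e5 e6 e7 k.
      by exists q; split=> // a; rewrite hq1 hl.
    have -> : (i : nat) = 28 by apply/eqP; rewrite eqn_leq hi -ltnS ltn_ord.
    rewrite eqxx; exists (nu_conic P0 P1 P2); split=> [a|j].
      by rewrite -edge_nu_conic -[LHS]/(horner_eval 0 _) nu_conic_map P00 P10 P20.
    rewrite uE pent_form_lift ?dvdp0 //.
    apply: contraNneq nz0 => /(congr1 (horner_eval 0)).
    by rewrite vdm5_map rmorph0 -C0 -T0 /= => ->.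
  by exists q; split=> i; case: (hq i).
have := macaulay_deformation uB cB sep dd lift U Z1 Z2 rr.
move/(congr1 (horner_eval 1)); rewrite rmorph0 -det_map_mx map_mxD map_mxM => <-.
have evC m n (M : 'M[K]_(m, n)) : map_mx (horner_eval 1) (map_mx polyC M) = M.
  by apply/matrixP => i j; rewrite !mxE /horner_eval hornerC.
rewrite !evC (@macaulay_map _ _ _ _ _ _ _ id) ?u1 // => x.
by rewrite /= /horner_eval hornerC.
Qed.

(** U, Z1 and Z2 are chosen at f and then kept fixed while the quartic becomes the generic vector.
    Because of the constant term Z1 Z2 the resulting F need not be homogeneous, hence the use of
    [luroth_nonzero]. *)
Lemma luroth_hilbert (K : numClosedFieldType) (f : {mpoly K[3]}) d :
  (28 <= d)%N -> luroth f -> (28 < hilbert_function (partials (WM f)) d)%N.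
Proof.
move=> dd hf; rewrite ltnNge; apply/negP => hle.
have [B [uB cB]] := monomial_basis 5 d.
have [U [r [Z1 [Z2 [rr dt]]]]] : exists (U : 'M[K]_(_, _)) (r : nat) (Z1 : 'M[K]_(_, r)) (Z2 : 'M[K]_(r, _)),
    (r <= 28)%N /\ \det (U *m macaulay d B id (fbar f) + Z1 *m Z2) != 0.
  apply: macaulay_det => //; apply: leq_trans hle.
  by rewrite /hilbert_function dimvf.
pose F : {mpoly K[15]} := \det (map_mx (@mpolyC 15 K) U *m
  macaulay d B (@mpolyC 15 K) (\col_i 'X_i) + map_mx (@mpolyC 15 K) (Z1 *m Z2)).
have FE (v : 'cV[K]_15) : F.@[fun i => v i 0] = \det (U *m macaulay d B id v + Z1 *m Z2).
  rewrite /F -det_map_mx map_mxD map_mxM.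
  have evC m n (M : 'M[K]_(m, n)) : map_mx (meval (fun i => v i 0)) (map_mx (@mpolyC 15 K) M) = M.
    by apply/matrixP => i j; rewrite !mxE mevalC.
  have vE : map_mx (meval (fun i => v i 0)) (\col_i 'X_i) = v.
    by apply/matrixP => i j; rewrite !mxE ord1 mevalXU.
  by rewrite !evC (@macaulay_map _ _ _ _ _ _ _ id) ?vE // => x; rewrite /= mevalC.
have [h /pentalateral_pent_form[p0 [p1 [p2 [t [kap ->]]]]]] : exists2 h, pentalateral_quartic h &
    F.@[fun i => fbar h i 0] != 0 by apply: (luroth_nonzero hf); rewrite FE.
by rewrite FE pent_form_determinant ?eqxx.
Qed.

Lemma degree28_not_luroth (K : numClosedFieldType) (f : {mpoly K[3]}) :
  scheme_dim_degree (partials (WM f)) 0 28 -> ~ luroth f.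
Proof.
case=> _ [P [[d0 hP] sP lP]] hf.
have PE : P = 28%:R%:P.
  have e : lead_coef P = P`_0 by rewrite lead_coefE sP.
  by rewrite [LHS](@size1_polyC _ P) ?sP // -e lP divr1.
have := @luroth_hilbert K f (maxn d0 28) (leq_maxr _ _) hf.
have := hP _ (leq_maxl d0 28); rewrite PE hornerC => /eqP; rewrite eqr_nat => /eqP <-.
by rewrite ltnn.
Qed.

Theorem mainTheorem2 (R : realType) (f : {mpoly (complex R)[3]}) :
  f \is 4.-homog -> f != 0 ->
  (scheme_dim_degree (partials (WM f)) 0 28 -> ~ luroth f) /\
  (forall Q : {mpoly (complex R)[3]},
     smooth_conic Q ->
     zero_locus [set` partials (WM f)]%classic (conic_coord Q) ->
     let g := border_quartic f Q in
     apolar g Q /\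
     (\det (Lmat g) != 0 ->
      [/\ exists2 c : complex R, c != 0 & f = c *: border_quartic g Q,
          exists2 c : complex R, c != 0 & f = c *: scorza g &
          luroth f])).
Proof.
move=> hf f0; split; first exact: degree28_not_luroth.
by move=> Q sQ sing; apply: singular_smooth_conic.
Qed.
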